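(* Let $D\subset\mathbb{R}^3$ be a bounded domain with $C^1$-smooth boundary $S$ and outward unit normal $N$, and let $k>0$. Suppose $u$ solves $$(\nabla^2+k^2)u=c \text{ in } D,\qquad u|_S=u_N|_S=0,$$ with a constant $c\neq 0$. Let $\{u_j\}_{j=1}^J$ be a maximal linearly independent set of solutions to $(\nabla^2+k^2)u_j=0$ in $D$, $u_j|_S=0$, normalized in $L^2(D)$. Then there exist constant vectors $c_1,\dots,c_J\in\mathbb{R}^3$ such that $$[s,N(s)]=\sum_{j=1}^J c_j\,u_{jN}(s)\qquad\text{for all } s\in S.$$
   Context: $[s,N]$ denotes the cross product of the position vector $s$ and the normal $N(s)$; $u_N$, $u_{jN}$ denote outward normal derivatives on $S$. *)

(* Defs.v *)
From HB Require Import structures.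
From mathcomp Require Import all_boot all_order all_algebra.
From mathcomp Require Import all_classical all_reals all_analysis.
Set Implicit Arguments. Unset Strict Implicit. Unset Printing Implicit Defensive.
Import Order.TTheory GRing.Theory Num.Theory.
Import numFieldNormedType.Exports.
Local Open Scope classical_set_scope.
Local Open Scope ring_scope.

Section R3.
Variable R : realType.
Notation P := (R * R * R)%type.

Definition e1 : P := (1, 0, 0).
Definition e2 : P := (0, 1, 0).
Definition e3 : P := (0, 0, 1).

Definition dot3 (a b : P) : R := a.1.1 * b.1.1 + a.1.2 * b.1.2 + a.2 * b.2.
Definition enorm3 (a : P) : R := Num.sqrt (dot3 a a).
Definition cross3 (a b : P) : P :=
  (a.1.2 * b.2 - a.2 * b.1.2, a.2 * b.1.1 - a.1.1 * b.2, a.1.1 * b.1.2 - a.1.2 * b.1.1).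
Definition scale3 (r : R) (a : P) : P := (r * a.1.1, r * a.1.2, r * a.2).

Definition grad3 (f : P -> R) (x : P) : P := ('D_e1 f x, 'D_e2 f x, 'D_e3 f x).
Definition lap3 (f : P -> R) (x : P) : R :=
  'D_e1 ('D_e1 f) x + 'D_e2 ('D_e2 f) x + 'D_e3 ('D_e3 f) x.

Definition C1_on (A : set P) (f : P -> R) : Prop :=
  forall x, A x -> differentiable f x /\ {for x, continuous (grad3 f)}.
Definition C2_on (A : set P) (f : P -> R) : Prop :=
  C1_on A f /\ C1_on A ('D_e1 f) /\ C1_on A ('D_e2 f) /\ C1_on A ('D_e3 f).

(* boundary S of an open set D *)
Definition bdry (D : set P) : set P := closure D `\` D.

Definition C1_boundary_outward_normal (D : set P) (N : P -> P) : Prop :=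
  forall s, bdry D s ->
  exists (U : set P) (phi : P -> R),
    [/\ open U, U s, C1_on U phi,
        (forall x, U x -> bdry D x -> grad3 phi x <> (0, 0, 0)) &
        [/\ D `&` U = [set x | U x /\ phi x < 0],
             bdry D `&` U = [set x | U x /\ phi x = 0] &
             N s = scale3 (enorm3 (grad3 phi s))^-1 (grad3 phi s)]].

Definition grad_up_to_bdry (D : set P) (f : P -> R) : Prop :=
  forall s, bdry D s -> exists l : P, grad3 f @ within D (nbhs s) --> l.

Definition normal_deriv (D : set P) (N : P -> P) (f : P -> R) (s : P) : R :=
  lim ((fun x => dot3 (grad3 f x) (N s)) @ within D (nbhs s)).

Definition zero_on_bdry (D : set P) (f : P -> R) : Prop :=
  forall s, bdry D s -> f @ within D (nbhs s) --> (0 : R).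

Definition dirichlet_sol (D : set P) (k : R) (v : P -> R) : Prop :=
  [/\ C2_on D v, grad_up_to_bdry D v,
      (forall x, D x -> lap3 v x + k ^+ 2 * v x = 0) & zero_on_bdry D v].

Definition leb3 := (((@lebesgue_measure R) \x (@lebesgue_measure R)) \x (@lebesgue_measure R))%E.

End R3.

(* Main.v *)
Require Import Defs.
From HB Require Import structures.
From mathcomp Require Import all_boot all_order all_algebra.
From mathcomp Require Import all_classical all_reals all_analysis.
From mathcomp Require Import ring lra.
Import Order.TTheory GRing.Theory Num.Theory.
Import numFieldNormedType.Exports.
Set Implicit Arguments. Unset Strict Implicit. Unset Printing Implicit Defensive.
Local Open Scope classical_set_scope.
Local Open Scope ring_scope.

(* Each component of cross3 x (grad u) solves the homogeneous Helmholtz equation and vanishes on S, and its normal derivative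
   is c [s, N]_i, because the Hessian of u tends to c N N^T at S. Expanding these components in the u_j gives the c_j.

   The limit of the Hessian, and u in C^3(D), come from potential theory. Extended by zero, u is C^1 on R^3, and solves
   the equation with source c 1_D in the weak sense. For x near s in S, let p = x + d N(s) be the point where the normal
   line leaves D, let u0 be the solution in the half space (y - p).N < 0 that depends on (y - p).N only and has zero
   Cauchy data, and represent u - u0 at x and at the mirror point p + d N, outside D, by the kernel cos(k r)/r. The
   source c (1_D - 1_H) lives in a cone |(y - p).N| <= eps |y - p|, on which the second derivatives of the kernel at the
   two points differ by O(d (|y - p|^2 + d^2)^-2). The integral of this bound over the cone is O(eps).

   Only positivity, linearity and integration by parts of the integral are used. *)

(** * Directional derivatives *)

Section Calculus.
Context {R : realType} {V : normedModType R}.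
Implicit Types (f g : V -> R) (x v : V).

(** The boundary is only C^1. For such a domain the potential of 1_D need not have bounded second
    derivatives: the integral of |z|^-3 over the thin region between S and its tangent plane may
    diverge logarithmically. Subtracting the half-space solution is therefore not enough. The
    difference with the mirror point, where the Hessian vanishes, gains a factor d / |y - p|; the
    resulting bound is integrable and invariant under scaling, so that it is O(eps) uniformly in d.
    Both Cauchy data must vanish for the extension by zero to be a weak solution across S.

    The functional that replaces the integral is applied to bounded functions, so the singular
    kernel is reached as a limit: |z|^2 is replaced by |z|^2 + e, and e tends to 0 at points where
    the source vanishes nearby. The mass of the Dirac limit is never computed; it is divided out, so
    that it only has to be nonzero. It is measured against a plane wave, as constants do not solve
    the homogeneous equation. The condition 20 k^2 a <= 1 on the cutoff radius keeps both this wave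
    and the second derivative of the kernel profile positive on the support. *)

Definition dif f x : Prop := differentiable f x.

(* Locked: unification that unfolds the limit in 'D_v may not terminate in practice. *)
Definition Dv : V -> (V -> R) -> V -> R := locked (fun v f x => 'D_v f x).

Lemma DvE v f x : Dv v f x = 'D_v f x.
Proof. by rewrite /Dv; unlock. Qed.

Lemma DvEfun v f : Dv v f = 'D_v f.
Proof. by apply/funext => x; rewrite DvE. Qed.

Lemma dif_continuous f x : dif f x -> {for x, continuous f}.
Proof. exact: differentiable_continuous. Qed.

Lemma dif_derivable f x v : dif f x -> derivable f x v.
Proof. exact: diff_derivable. Qed.

Lemma dif_cst (a : R) x : dif (fun=> a) x.
Proof. exact: differentiable_cst. Qed.

Lemma Dv_cst v (a : R) x : Dv v (fun=> a) x = 0.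
Proof. by rewrite DvE; exact: derive_cst. Qed.

Lemma difD f g x : dif f x -> dif g x -> dif (fun y => f y + g y) x.
Proof. by move=> df dg; apply: (@differentiableD _ _ _ f g x df dg). Qed.

Lemma DvD v f g x : dif f x -> dif g x ->
  Dv v (fun y => f y + g y) x = Dv v f x + Dv v g x.
Proof.
move=> df dg; rewrite !DvE.
by apply: (@deriveD _ _ _ f g x v); apply: dif_derivable.
Qed.

Lemma difN f x : dif f x -> dif (fun y => - f y) x.
Proof. by move=> df; apply: (@differentiableN _ _ _ f x df). Qed.

Lemma DvN v f x : dif f x -> Dv v (fun y => - f y) x = - Dv v f x.
Proof.
by move=> df; rewrite !DvE; apply: (@deriveN _ _ _ f x v); apply: dif_derivable.
Qed.

Lemma difB f g x : dif f x -> dif g x -> dif (fun y => f y - g y) x.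
Proof. by move=> df dg; apply: difD => //; apply: difN. Qed.

Lemma DvB v f g x : dif f x -> dif g x ->
  Dv v (fun y => f y - g y) x = Dv v f x - Dv v g x.
Proof. by move=> df dg; rewrite DvD ?DvN //; apply: difN. Qed.

Lemma difM f g x : dif f x -> dif g x -> dif (fun y => f y * g y) x.
Proof. by move=> df dg; apply: (@differentiableM _ _ f g x df dg). Qed.

Lemma DvM v f g x : dif f x -> dif g x ->
  Dv v (fun y => f y * g y) x = f x * Dv v g x + g x * Dv v f x.
Proof.
move=> df dg; rewrite !DvE.
by apply: (@deriveM _ _ f g x v); apply: dif_derivable.
Qed.

Lemma difZ (a : R) f x : dif f x -> dif (fun y => a * f y) x.
Proof. by move=> df; apply: difM => //; apply: dif_cst. Qed.

Lemma DvZ v (a : R) f x : dif f x -> Dv v (fun y => a * f y) x = a * Dv v f x.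
Proof. by move=> df; rewrite DvM ?Dv_cst ?mulr0 ?addr0//; apply: dif_cst. Qed.

Lemma dif_comp (h : R -> R) (h' : R) f x :
  is_derive (f x) 1 h h' -> dif f x -> dif (fun y => h (f y)) x.
Proof.
move=> hh df; apply: (@differentiable_comp _ _ _ _ f h x df).
by apply/derivable1_diffP; case: hh.
Qed.

Lemma Dv_comp v (h : R -> R) (h' : R) f x :
  is_derive (f x) 1 h h' -> dif f x -> Dv v (fun y => h (f y)) x = h' * Dv v f x.
Proof.
move=> hh df; rewrite !DvE.
have dh : differentiable h (f x) by apply/derivable1_diffP; case: hh.
rewrite (deriveE v (dif_comp hh df)) (deriveE v df).
have -> : 'd (fun y => h (f y)) x = 'd h (f x) \o 'd f x :> (V -> R).
  exact: (@diff_comp _ _ _ _ f h x df dh).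
rewrite /= -(deriveE ('d f x v) dh) -[X in 'D_X _ _]mulr1 -/('d f x v *: (1:R)).
rewrite (deriveE _ dh) linearZ /= -(deriveE _ dh) mulrC; congr (_ * _).
by rewrite derive_val.
Qed.

Lemma Dv_near v f g x : (\forall y \near x, f y = g y) -> Dv v f x = Dv v g x.
Proof. by move=> fg; rewrite !DvE; apply: near_eq_derive. Qed.

Lemma Dv_lin f x (a : R) v w : dif f x ->
  Dv (a *: v + w) f x = a * Dv v f x + Dv w f x.
Proof. by move=> df; rewrite !DvE !(deriveE _ df) linearP. Qed.

Lemma Dv_addv f x v w : dif f x -> Dv (v + w) f x = Dv v f x + Dv w f x.
Proof. by move=> df; rewrite -[v]scale1r Dv_lin // mul1r scale1r. Qed.

Lemma Dv_scalev f x (a : R) v : dif f x -> Dv (a *: v) f x = a * Dv v f x.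
Proof. by move=> df; rewrite !DvE !(deriveE _ df) linearZ. Qed.

Lemma difP f x (L : {linear V -> R}) : continuous L ->
  (forall e, 0 < e -> \forall h \near (0 : V), `|f (h + x) - f x - L h| <= e * `|h|) ->
  dif f x /\ forall v, Dv v f x = L v.
Proof.
move=> cL H.
have E : f \o shift x = (cst (f x) + L) +o_ 0 id.
  apply/eqaddoP => e e0; near=> h.
  rewrite /= -[X in `|X|]/(f (h + x) - (f x + L h)) opprD addrA.
  near: h; exact: H.
have dE := diff_unique cL E.
have df : dif f x by apply/diff_locallyP; split; rewrite dE.
by split=> // v; rewrite DvE (deriveE _ df) dE.
Unshelve. all: by end_near. Qed.

Lemma dif_approx f x : dif f x -> forall e, 0 < e ->
  \forall h \near (0 : V), `|f (h + x) - f x - Dv h f x| <= e * `|h|.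
Proof.
move=> df e e0; have [_ E] := (diff_locallyP x f).1 df.
have /eqaddoP/(_ e e0) H := E.
near=> h.
rewrite DvE (deriveE _ df) -addrA -opprD.
by near: h; exact: H.
Unshelve. all: by end_near. Qed.

Lemma dif_near f g x : (\forall y \near x, f y = g y) -> dif f x -> dif g x.
Proof.
move=> fg df.
have [_ E] := (diff_locallyP x f).1 df.
suff H : forall e, 0 < e -> \forall h \near (0 : V),
    `|g (h + x) - g x - 'd f x h| <= e * `|h|.
  by have [] := @difP g x ('d f x) (diff_continuous df) H.
move=> e e0; have fx : f x = g x by exact: nbhs_singleton fg.
have fg0 : \forall h \near (0 : V), f (h + x) = g (h + x).
  have : (fun h : V => h + x) @ (0 : V) --> (x : V).
    rewrite -[X in _ --> X]add0r; apply: cvgD; [exact: cvg_id | exact: cvg_cst].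
  by move/(_ _ fg).
have := dif_approx df e0; apply: filterS2 fg0 => h <- .
by rewrite fx DvE (deriveE _ df).
Qed.

End Calculus.

(** * Restriction to lines and the mean value theorem *)

Section Lines.
Context {R : realType} {V : normedModType R}.
Implicit Types (f g : V -> R) (x v w : V).

Lemma open_normP (A : set V) x : open A -> A x ->
  exists2 r : R, 0 < r & forall y, `|y - x| < r -> A y.
Proof.
move=> oA Ax; have /nbhs_ballP[r /= r0 H] : nbhs x A by exact: open_nbhs_nbhs.
by exists r => // y xy; apply: H; rewrite -ball_normE /= distrC.
Qed.

Lemma near_open (A : set V) x (P : V -> Prop) :
  open A -> A x -> (forall y, A y -> P y) -> \forall y \near x, P y.
Proof.
by move=> oA Ax H; have : nbhs x A by [exact: open_nbhs_nbhs]; apply: filterS.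
Qed.

Lemma dif_compV (W : normedModType R) (g : W -> V) (L : W -> V) f (y : W) :
  is_diff y g L -> dif f (g y) ->
  dif (fun z => f (g z)) y /\ forall w : W, Dv w (fun z => f (g z)) y = Dv (L w) f (g y).
Proof.
move=> [dg Lg] df.
have dfg : dif (fun z => f (g z)) y by exact: (@differentiable_comp _ _ _ _ g f y dg df).
split=> // w; rewrite !DvE (deriveE _ dfg) (deriveE _ df).
have -> : 'd (fun z => f (g z)) y = 'd f (g y) \o 'd g y :> (W -> R).
  exact: (@diff_comp _ _ _ _ g f y dg df).
by rewrite /= Lg.
Qed.

Lemma dif_refl f x y : dif f (x - y) ->
  dif (fun z => f (x - z)) y /\ forall w, Dv w (fun z => f (x - z)) y = - Dv w f (x - y).
Proof.
move=> df.
have D : is_diff y (fun z : V => x - z) (0 - (id : V -> V)).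
  exact: (@is_diffB _ _ _ (cst x) id 0 id y).
have [? E] := dif_compV (g := fun z : V => x - z) D df; split=> // w.
rewrite E (_ : (0 - id) w = (-1) *: w); last by rewrite scaleN1r -[LHS]/(0 - w) sub0r.
by rewrite Dv_scalev // mulN1r.
Qed.

Lemma dif_trans f x y : dif f (y + x) ->
  dif (fun z => f (z + x)) y /\ forall w, Dv w (fun z => f (z + x)) y = Dv w f (y + x).
Proof.
move=> df.
have D : is_diff y (fun z : V => z + x) ((id : V -> V) + 0).
  exact: (@is_diffD _ _ _ id (cst x) id 0 y).
have [? E] := dif_compV (g := fun z : V => z + x) D df; split=> // w.
by rewrite E -[(id + 0) w]/(w + 0) addr0.
Qed.

Lemma line_derive f x v (t : R) : dif f (x + t *: v) ->
  is_derive t 1 (fun s : R => f (x + s *: v)) (Dv v f (x + t *: v)).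
Proof.
move=> df.
have D : is_diff t (cst x + ( fun s : R => s *: v)) (0 + (fun s : R => s *: v)).
  exact: is_diffD.
have [d1 E] := dif_compV (g := fun s : R => x + s *: v) D df.
have d2 := dif_derivable (v := (1 : R)) d1.
split=> //; rewrite -DvE E; congr (Dv _ _ _).
by rewrite -[LHS]/(0 + 1 *: v) add0r scale1r.
Qed.

Lemma MVT_line f x v :
  (forall t, 0 < t < 1 -> dif f (x + t *: v)) ->
  (forall t, 0 <= t <= 1 -> {for x + t *: v, continuous f}) ->
  exists2 t, 0 < t < 1 & f (x + v) - f x = Dv v f (x + t *: v).
Proof.
move=> df cf.
have [||t + E] := @MVT R (fun s : R => f (x + s *: v)) (fun s => Dv v f (x + s *: v)) 0 1 ltr01.
- by move=> t; rewrite in_itv /= => t01; apply: line_derive; apply: df.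
- have cl t : {for t, continuous (fun s : R => x + s *: v)}.
    by apply: cvgD; [exact: cvg_cst|apply: cvgZr_tmp; exact: cvg_id].
  apply: continuous_in_subspaceT => t; rewrite inE /= in_itv /= => t01.
  by apply: (continuous_comp (cl t)); apply: cf.
rewrite in_itv /= => t01; exists t => //.
by move: E; rewrite scale1r scale0r addr0 subr0 mulr1.
Qed.

End Lines.

(** * Functions of class C^k and the symmetry of second derivatives *)

Section Smooth.
Context {R : realType} {V : normedModType R}.
Implicit Types (f g : V -> R) (x v w : V) (A B : set V).

(** Class C^n on an open set, by recursion on directional derivatives in all directions: no higher
    differentials occur, and every closure property is an induction on [n]. *)
Fixpoint Ck (n : nat) A f : Prop :=
  if n is n'.+1 then (forall x, A x -> dif f x) /\ forall v, Ck n' A (Dv v f)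
  else forall x, A x -> {for x, continuous f}.

Lemma CkS n A f : Ck n.+1 A f -> Ck n A f.
Proof.
elim: n f => [|n IH] f [df Df]; first by move=> x Ax; apply: dif_continuous; apply: df.
by split=> // v; apply: IH.
Qed.

Lemma Ck_le n m A f : (m <= n)%N -> Ck n A f -> Ck m A f.
Proof.
elim: n => [|n IH]; first by rewrite leqn0 => /eqP ->.
by rewrite leq_eqVlt => /predU1P[->//|]; rewrite ltnS => mn /CkS; apply: IH.
Qed.

Lemma Ck_dif n A f x : Ck n.+1 A f -> A x -> dif f x.
Proof. by move=> [df _]; apply: df. Qed.

Lemma Ck_Dv n A f v : Ck n.+1 A f -> Ck n A (Dv v f).
Proof. by move=> [_ Df]; apply: Df. Qed.

Lemma Ck_cont n A f x : Ck n A f -> A x -> {for x, continuous f}.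
Proof.
case: n => [|n]; first by apply.
by move=> h Ax; apply: dif_continuous; apply: (Ck_dif h).
Qed.

Lemma Ck_sub n A B f : (forall x, B x -> A x) -> Ck n A f -> Ck n B f.
Proof.
move=> BA; elim: n f => [|n IH] f /=; first by move=> cf x /BA; apply: cf.
by move=> [df Df]; split=> [x /BA|v]; [apply: df | apply: IH].
Qed.

Lemma Ck_union n A B f : Ck n A f -> Ck n B f -> Ck n (fun x => A x \/ B x) f.
Proof.
elim: n f => [|n IH] f /=; first by move=> cA cB x [/cA|/cB].
by move=> [dA DA] [dB DB]; split=> [x [/dA|/dB]//|v]; apply: IH.
Qed.

Lemma Ck_ext n A f g : open A -> (forall x, A x -> f x = g x) -> Ck n A f -> Ck n A g.
Proof.
move=> oA; elim: n f g => [|n IH] f g fg /=.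
  move=> cf x Ax; have N : \forall y \near x, f y = g y by exact: (near_open oA Ax).
  rewrite /prop_for /continuous_at -(fg _ Ax).
  by apply: cvg_trans (cf x Ax); apply: near_eq_cvg.
move=> [df Df]; split=> [x Ax|v].
  by apply: (@dif_near _ _ f); [exact: (near_open oA Ax)|apply: df].
by apply: IH (Df v) => x Ax; apply: Dv_near; exact: (near_open oA Ax).
Qed.

Lemma Ck_cst n A (a : R) : Ck n A (fun=> a).
Proof.
elim: n a => [|n IH] a /=; first by move=> x _; exact: cvg_cst.
split=> [x _|v]; first exact: dif_cst.
by rewrite (_ : Dv v (fun=> a) = fun=> 0); [exact: IH | apply/funext => x; exact: Dv_cst].
Qed.

Lemma CkD n A f g : open A -> Ck n A f -> Ck n A g -> Ck n A (fun y => f y + g y).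
Proof.
move=> oA; elim: n f g => [|n IH] f g /=; first by move=> cf cg x Ax; apply: cvgD; [exact: cf | exact: cg].
move=> [df Df] [dg Dg]; split=> [x Ax|v]; first by apply: difD; [exact: df | exact: dg].
apply: (@Ck_ext n A (fun y => Dv v f y + Dv v g y)) => //; last exact: IH.
by move=> x Ax; rewrite DvD //; [exact: df | exact: dg].
Qed.

Lemma CkM n A f g : open A -> Ck n A f -> Ck n A g -> Ck n A (fun y => f y * g y).
Proof.
move=> oA; elim: n f g => [|n IH] f g /=; first by move=> cf cg x Ax; apply: cvgM; [exact: cf | exact: cg].
move=> hf hg; have [df Df] := hf; have [dg Dg] := hg.
split=> [x Ax|v]; first by apply: difM; [exact: df | exact: dg].
apply: (@Ck_ext n A (fun y => f y * Dv v g y + g y * Dv v f y)) => //.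
  by move=> x Ax; rewrite DvM //; [exact: df | exact: dg].
by apply: CkD => //; apply: IH => //; exact: CkS.
Qed.

Lemma CkZ n A f (a : R) : open A -> Ck n A f -> Ck n A (fun y => a * f y).
Proof. by move=> oA; apply: CkM => //; exact: Ck_cst. Qed.

Lemma CkN n A f : open A -> Ck n A f -> Ck n A (fun y => - f y).
Proof.
move=> oA hf; apply: (Ck_ext oA _ (CkZ (-1) oA hf)) => x _; exact: mulN1r.
Qed.

Lemma CkB n A f g : open A -> Ck n A f -> Ck n A g -> Ck n A (fun y => f y - g y).
Proof. by move=> oA hf hg; apply: CkD => //; exact: CkN. Qed.

Lemma Ck_refl n A f x : open A -> Ck n A f -> Ck n (fun y => A (x - y)) (fun y => f (x - y)).
Proof.
move=> oA.
have cR y : {for y, continuous (fun z : V => x - z)}.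
  by apply: cvgB; [exact: cvg_cst | exact: cvg_id].
have oA' : open (fun y => A (x - y)).
  by apply: (@open_comp _ _ (fun z : V => x - z) A) => // y _; exact: cR.
elim: n f => [|n IH] f /=.
  by move=> cf y Ay; apply: (continuous_comp (cR y)); apply: cf.
move=> [df Df]; split=> [y Ay|v]; first by have [] := dif_refl (df _ Ay).
apply: (Ck_ext oA' _ (CkN oA' (IH _ (Df v)))) => y Ay.
by have [_ ->] := dif_refl (df _ Ay).
Qed.

Lemma Ck_trans n A f x : open A -> Ck n A f -> Ck n (fun y => A (y + x)) (fun y => f (y + x)).
Proof.
move=> oA.
have cR y : {for y, continuous (fun z : V => z + x)}.
  by apply: cvgD; [exact: cvg_id | exact: cvg_cst].
have oA' : open (fun y => A (y + x)).
  by apply: (@open_comp _ _ (fun z : V => z + x) A) => // y _; exact: cR.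
elim: n f => [|n IH] f /=.
  by move=> cf y Ay; apply: (continuous_comp (cR y)); apply: cf.
move=> [df Df]; split=> [y Ay|v]; first by have [] := dif_trans (df _ Ay).
apply: (Ck_ext oA' _ (IH _ (Df v))) => y Ay.
by have [_ ->] := dif_trans (df _ Ay).
Qed.

(** The one-variable counterpart of [Ck], for outer functions of compositions. The derivative is
    existential so that explicit formulas can be supplied, and [B] leaves room for functions
    singular at 0. *)
Fixpoint SC (n : nat) (B : set R) (h : R -> R) : Prop :=
  if n is n'.+1 then
    exists h', (forall t, B t -> is_derive t 1 h (h' t)) /\ SC n' B h'
  else forall t, B t -> {for t, continuous h}.

Lemma SC_cont n (B : set R) h (t : R) : SC n B h -> B t -> {for t, continuous h}.
Proof.
case: n => [|n] /=; first by apply.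
move=> [h' [dh _]] Bt; have [dd _] := dh _ Bt.
by apply: differentiable_continuous; apply/derivable1_diffP.
Qed.

Lemma Ck_comp n A (B : set R) h f : open A -> SC n B h ->
  (forall x, A x -> B (f x)) -> Ck n A f -> Ck n A (fun y => h (f y)).
Proof.
move=> oA; elim: n h => [|n IH] h.
  move=> ch AB cf x Ax; apply: (continuous_comp (cf x Ax)).
  by apply: ch; apply: AB.
move=> [h' [dh sh]] AB hf; have [df Df] := hf; split=> [x Ax|v].
  by apply: (dif_comp (dh _ (AB _ Ax))); apply: df.
apply: (@Ck_ext n A (fun y => h' (f y) * Dv v f y)) => //.
  by move=> x Ax; rewrite (Dv_comp v (dh _ (AB _ Ax))) //; apply: df.
by apply: CkM; [done | exact: (IH h' sh AB (CkS hf)) | exact: Df].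
Qed.

(** The mean value theorem is applied twice: to z |-> f (z + w) - f z along v, then to the
    derivative of f in the direction v along w. *)
Lemma second_difference A f x v w : open A -> Ck 2 A f ->
  (forall a b : R, 0 <= a <= 1 -> 0 <= b <= 1 -> A (x + a *: v + b *: w)) ->
  exists a b, [/\ 0 < a < 1, 0 < b < 1 &
    f (x + v + w) - f (x + v) - f (x + w) + f x = Dv w (Dv v f) (x + a *: v + b *: w)].
Proof.
move=> oA hf H; have df x0 : A x0 -> dif f x0 by exact: (Ck_dif hf).
have i0 : 0 <= (0 : R) <= 1 by rewrite lexx ler01.
have i1 : 0 <= (1 : R) <= 1 by rewrite lexx ler01.
have H0 a : 0 <= a <= 1 -> A (x + a *: v).
  by move=> ha; have := H a 0 ha i0; rewrite scale0r addr0.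
have H1 a : 0 <= a <= 1 -> A (x + a *: v + w).
  by move=> ha; have := H a 1 ha i1; rewrite scale1r.
pose g z := f (z + w) - f z.
have dg a : 0 <= a <= 1 -> dif g (x + a *: v).
  move=> ha; apply: difB; last by apply: df; exact: H0.
  by have [] := dif_trans (df _ (H1 _ ha)).
have lt_le (t : R) : 0 < t < 1 -> 0 <= t <= 1 by move=> /andP[/ltW -> /ltW ->].
have [||a a01 Ea] := @MVT_line _ _ g x v.
- by move=> t /lt_le; exact: dg.
- by move=> t t01; apply: dif_continuous; exact: dg.
have [||b b01 Eb] := @MVT_line _ _ (Dv v f) (x + a *: v) w.
- by move=> t /lt_le t01; apply: (Ck_dif (Ck_Dv v hf)); apply: H => //; exact: lt_le.
- move=> t t01; apply: dif_continuous.
  by apply: (Ck_dif (Ck_Dv v hf)); apply: H => //; exact: lt_le.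
exists a, b; split=> //; rewrite -Eb.
have ha := lt_le _ a01.
have [dt Et] := dif_trans (df _ (H1 _ ha)).
rewrite -Et -(DvB v dt (df _ (H0 _ ha))) -Ea /g.
by rewrite [x + v + w]addrAC; ring.
Qed.

(** The second difference of f is symmetric in v and w. By [second_difference] it is t^2 times
    either mixed derivative at some nearby point, so two different values at x contradict
    continuity. *)
Lemma Schwarz A f x v w : open A -> Ck 2 A f -> A x ->
  Dv v (Dv w f) x = Dv w (Dv v f) x.
Proof.
move=> oA hf Ax; have df x0 : A x0 -> dif f x0 by exact: (Ck_dif hf).
apply/eqP/negP => /negP; rewrite -subr_eq0 -normr_gt0 => D0.
set a := Dv v (Dv w f) x in D0 *; set b := Dv w (Dv v f) x in D0 *.
have e0 : 0 < `|a - b| / 2 by rewrite divr_gt0.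
have c1 : {for x, continuous (Dv v (Dv w f))}.
  by apply: (@Ck_cont 0 A) => //; apply: Ck_Dv; apply: Ck_Dv.
have c2 : {for x, continuous (Dv w (Dv v f))}.
  by apply: (@Ck_cont 0 A) => //; apply: Ck_Dv; apply: Ck_Dv.
have N : \forall y \near x, [/\ A y, `|a - Dv v (Dv w f) y| < `|a - b| / 2 &
    `|b - Dv w (Dv v f) y| < `|a - b| / 2].
  near=> y; split; near: y.
  - exact: open_nbhs_nbhs.
  - by move/cvgrPdist_lt : c1 => /(_ _ e0).
  - by move/cvgrPdist_lt : c2 => /(_ _ e0).
have /nbhs_ballP[r /= r0 H] := N.
pose M := `|v| + `|w| + 1.
have M0 : 0 < M by rewrite ltr_wpDl // addr_ge0.
(* This t keeps the parallelogram spanned by t v and t w in the ball on which both mixed derivatives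
   vary by less than half of |a - b|. *)
have [t t0 tM] : exists2 t, 0 < t & t * M = r.
  by exists (r / M); [rewrite divr_gt0 | rewrite mulfVK // gt_eqF].
have K p q : 0 <= p <= 1 -> 0 <= q <= 1 -> ball x r (x + p *: (t *: v) + q *: (t *: w)).
  move=> /andP[p0 p1] /andP[q0 q1]; rewrite -ball_normE /= -addrA opprD addrA subrr sub0r normrN.
  rewrite (le_lt_trans (ler_normD _ _)) // !normrZ (gtr0_norm t0) !(ger0_norm p0) (ger0_norm q0).
  have -> : r = t * `|v| + t * `|w| + t.
    by rewrite -tM /M; ring.
  apply: (@le_lt_trans _ _ (t * `|v| + t * `|w|)); last by rewrite ltrDl.
  by rewrite lerD // ler_piMl // mulr_ge0 // ltW.
have sc u1 u2 y : A y -> Dv (t *: u1) (Dv (t *: u2) f) y = t * t * Dv u1 (Dv u2 f) y.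
  move=> Ay; rewrite (@Dv_near _ _ _ _ (fun z => t * Dv u2 f z)); last first.
    by apply: (near_open oA Ay) => z Az; apply: Dv_scalev; apply: df.
  rewrite DvZ; last exact: (Ck_dif (Ck_Dv u2 hf)).
  by rewrite Dv_scalev ?mulrA //; exact: (Ck_dif (Ck_Dv u2 hf)).
have [p1 [q1 [hp1 hq1 E1]]] : exists a b, [/\ 0 < a < 1, 0 < b < 1 &
   f (x + t *: v + t *: w) - f (x + t *: v) - f (x + t *: w) + f x =
   Dv (t *: w) (Dv (t *: v) f) (x + a *: (t *: v) + b *: (t *: w))].
  by apply: (second_difference oA hf) => p q hp hq; have [] := H _ (K p q hp hq).
have [p2 [q2 [hp2 hq2 E2]]] : exists a b, [/\ 0 < a < 1, 0 < b < 1 &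
   f (x + t *: w + t *: v) - f (x + t *: w) - f (x + t *: v) + f x =
   Dv (t *: v) (Dv (t *: w) f) (x + a *: (t *: w) + b *: (t *: v))].
  apply: (second_difference oA hf) => p q hp hq.
  by rewrite addrAC; have [] := H _ (K q p hq hp).
have lt_le (s : R) : 0 < s < 1 -> 0 <= s <= 1 by move=> /andP[/ltW -> /ltW ->].
rewrite [x + p2 *: _ + _]addrAC in E2.
have [A1 _ B1] := H _ (K p1 q1 (lt_le _ hp1) (lt_le _ hq1)).
have [A2 B2 _] := H _ (K q2 p2 (lt_le _ hq2) (lt_le _ hp2)).
rewrite sc // in E1; rewrite sc // in E2.
have E : Dv w (Dv v f) (x + p1 *: (t *: v) + q1 *: (t *: w)) =
         Dv v (Dv w f) (x + q2 *: (t *: v) + p2 *: (t *: w)).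
  apply: (@mulfI _ (t * t)); first by rewrite gt_eqF // mulr_gt0.
  by rewrite -E1 -E2 [x + t *: w + _]addrAC; ring.
move: B1; rewrite E; set y := Dv v (Dv w f) _ => B1.
have : `|a - b| < `|a - b|; last by rewrite ltxx.
rewrite {1}(_ : a - b = (a - y) - (b - y)); last by ring.
rewrite (le_lt_trans (ler_normB _ _)) // [ltRHS]splitr ltrD //.
Unshelve. all: by end_near. Qed.

End Smooth.

(** * A positive functional in place of the integral *)

Section Space.
Context {R : realType}.
Notation P := (R * R * R)%type.
Implicit Types (f g : P -> R) (x y z v : P) (M : R).

Lemma norm3E x : `|x| = Num.max (Num.max `|x.1.1| `|x.1.2|) `|x.2|.
Proof. by rewrite !prod_normE. Qed.

Lemma norm3_le x M : (`|x| <= M) = [&& `|x.1.1| <= M, `|x.1.2| <= M & `|x.2| <= M].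
Proof. by rewrite norm3E !ge_max andbA. Qed.

Lemma coord_le x : [/\ `|x.1.1| <= `|x|, `|x.1.2| <= `|x| & `|x.2| <= `|x|].
Proof. by have := lexx `|x|; rewrite {1}norm3_le => /and3P[]. Qed.

Lemma compact_box M : compact [set x : P | `|x| <= M].
Proof.
have := @compact_setX _ _ _ _ (compact_setX (@segment_compact R (-M) M)
  (@segment_compact R (-M) M)) (@segment_compact R (-M) M).
congr compact; apply/seteqP; split=> x /=.
  move=> [[]]; rewrite !in_itv /= => h1 h2 h3.
  by rewrite norm3_le !ler_norml h1 h2 h3.
by rewrite norm3_le !ler_norml => /and3P[h1 h2 h3]; split; [split|]; rewrite /= in_itv.
Qed.

Lemma compact_le_bound (K : set P) f : compact K ->
  (forall x, K x -> {for x, continuous f}) ->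
  exists2 B, 0 <= B & forall x, K x -> `|f x| <= B.
Proof.
move=> cK cf; have [->|/set0P K0] := eqVneq K set0; first by exists 0.
have [|x xK H] := @compact_EVT_max _ R (fun y => `|f y|) K K0 cK.
  apply: continuous_in_subspaceT => y; rewrite inE => Ky.
  by apply: cvg_norm; apply: cf.
by exists `|f x| => // y Ky; apply: H; exact: mem_set.
Qed.

Lemma compact_subset_closed (K L : set P) : compact L -> closed K -> K `<=` L -> compact K.
Proof. by move=> cL cK KL; exact: (subclosed_compact cK cL KL). Qed.

Definition csupp M f := forall x, M < `|x| -> f x = 0.

(** Heine-Cantor on the box of radius M + 1. If x lies outside this box and |x - y| < 1, then f
    vanishes at both points. *)
Lemma csupp_ucont M f : (forall x, {for x, continuous f}) -> csupp M f ->
  forall e, 0 < e -> exists2 d, 0 < d & forall x y, `|x - y| < d -> `|f x - f y| < e.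
Proof.
move=> cf sf e e0.
have e20 : 0 < e / 2 by rewrite divr_gt0.
have [|d /= d0 H] := (compact_near_coveringP _).1 (@compact_box (M + 1)) R (0 : R)^'+
  (fun (d : R) x => forall y, `|x - y| < d -> `|f x - f y| < e).
  move=> x _.
  have /nbhs_ballP[r /= r0 H] : \forall y \near x, `|f x - f y| < e / 2.
    by have /cvgrPdist_lt/(_ _ e20) := cf x.
  have r20 : 0 < r / 2 by rewrite divr_gt0.
  exists (ball x (r / 2), [set d | 0 < d < r / 2]).
    split; first exact: nbhsx_ballx.
    by exists (r / 2) => // d /=; rewrite sub0r normrN => h d0; rewrite d0 (le_lt_trans (ler_norm d)).
  move=> [x' d] /= [xx' /andP[d0 dr]] y xy.
  have h1 : `|f x - f x'| < e / 2.
    by apply: H; apply: le_ball xx'; rewrite ler_pdivrMr // ler_pMr // ler1n.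
  have h2 : `|f x - f y| < e / 2.
    apply: H; rewrite -ball_normE /=; move: xx'; rewrite -ball_normE /= => xx'.
    rewrite -(subrK x' x) -addrA (le_lt_trans (ler_normD _ _)) // [ltRHS]splitr ltrD //.
    exact: lt_trans dr.
  rewrite (_ : f x' - f y = (f x - f y) - (f x - f x')); last by ring.
  by rewrite (le_lt_trans (ler_normB _ _)) // [ltRHS]splitr ltrD.
exists (Num.min (d / 2) 1); first by rewrite lt_min ltr01 divr_gt0.
move=> x y; rewrite lt_min => /andP[xyd xy1].
have [xM|xM] := leP `|x| (M + 1).
  apply: (H (d / 2) _ _ x xM y xyd); rewrite /= ?divr_gt0 //.
  rewrite sub0r normrN gtr0_norm ?divr_gt0 // ltr_pdivrMr // ltr_pMr // ltr1n //.
rewrite (sf x); last by apply: lt_trans xM; rewrite ltrDl.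
rewrite (sf y) ?subr0 ?normr0 //.
have : `|x| <= `|x - y| + `|y| by rewrite -{1}(subrK y x) ler_normD.
by lra.
Qed.

Lemma basis_decomp v : v = v.1.1 *: @e1 R + (v.1.2 *: @e2 R + v.2 *: @e3 R).
Proof.
move: v => [[a b] c]; rewrite /e1 /e2 /e3 /=.
rewrite -[RHS]/(a * 1 + (b * 0 + c * 0), a * 0 + (b * 1 + c * 0), a * 0 + (b * 0 + c * 1)).
by rewrite !mulr0 !mulr1 !add0r !addr0.
Qed.

Lemma Dv_coord f x v : dif f x ->
  Dv v f x = v.1.1 * Dv (@e1 R) f x + v.1.2 * Dv (@e2 R) f x + v.2 * Dv (@e3 R) f x.
Proof.
move=> df; rewrite {1}(basis_decomp v) Dv_lin // Dv_addv // !Dv_scalev //.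
by rewrite addrA.
Qed.

End Space.

(** * Ultralimits of Riemann sums over a cube *)

Section Integral.
Context {R : realType}.
Notation P := (R * R * R)%type.
Implicit Types (f g : P -> R) (x y z v : P).
Variable m : R.
Hypothesis m0 : 0 < m.

Definition bdd f := exists B, forall x, `|x| <= m -> `|f x| <= B.

Definition grid (n i : nat) : R := m / n.+1%:R * (i%:R - n.+1%:R).

Definition sum3 (n : nat) (F : nat -> nat -> nat -> R) : R :=
  \sum_(0 <= i < n) \sum_(0 <= j < n) \sum_(0 <= l < n) F i j l.

(** The sum is divided by (n + 1)^3 and not multiplied by the cell volume (m / (n + 1))^3. For
    Riemann integrable functions, [Int] is thus the usual integral over m^3, and the constant 1 has
    integral 8; this is the origin of the factors 8 below. *)
Definition Rsum f (n : nat) : R :=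
  sum3 n.+1.*2 (fun i j l => f (grid n i, grid n j, grid n l)) / n.+1%:R ^+ 3.

Definition UF : set_system nat := projT1 (cid (ultraFilterLemma eventually_filter)).

Lemma UF_ultra : UltraFilter UF.
Proof. by rewrite /UF; case: cid => G []. Qed.

Lemma UF_proper : ProperFilter UF. Proof. by apply: ultra_proper; exact: UF_ultra. Qed.

Lemma UF_eventually : \oo `<=` UF.
Proof. by rewrite /UF; case: cid => G []. Qed.

(* Limit, along an ultrafilter, of the Riemann sums over the cube |x| <= m: a positive linear functional
   on all bounded functions, which kills derivatives of functions supported inside the cube. *)
Definition Int f : R := lim (Rsum f @ UF).

Lemma grid_bound n i : (i <= n.+1.*2)%N -> `|grid n i| <= m.
Proof.
move=> hi; rewrite /grid normrM ger0_norm ?(divr_ge0 (ltW m0)) //.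
rewrite mulrAC ler_pdivrMr // ler_pM2l // ler_norml.
have : (i%:R : R) <= n.+1.*2%:R by rewrite ler_nat.
have : (0 : R) <= i%:R by [].
rewrite -addnn natrD; lra.
Qed.

Lemma eq_sum3 n F G : (forall i j l, (i < n)%N -> (j < n)%N -> (l < n)%N -> F i j l = G i j l) ->
  sum3 n F = sum3 n G.
Proof.
move=> E; rewrite /sum3 !big_mkord; apply: eq_bigr => i _; rewrite !big_mkord.
by apply: eq_bigr => j _; rewrite !big_mkord; apply: eq_bigr => l _; exact: E.
Qed.

Lemma ler_sum3 n F G : (forall i j l, (i < n)%N -> (j < n)%N -> (l < n)%N -> F i j l <= G i j l) ->
  sum3 n F <= sum3 n G.
Proof.
move=> E; rewrite /sum3 !big_mkord; apply: ler_sum => i _; rewrite !big_mkord.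
by apply: ler_sum => j _; rewrite !big_mkord; apply: ler_sum => l _; exact: E.
Qed.

Lemma sum3_lin n a F G : sum3 n (fun i j l => a * F i j l + G i j l) = a * sum3 n F + sum3 n G.
Proof.
rewrite /sum3 mulr_sumr -big_split; apply: eq_bigr => i _.
rewrite mulr_sumr -big_split; apply: eq_bigr => j _.
by rewrite mulr_sumr -big_split.
Qed.

Lemma sum3_cst n (a : R) : sum3 n (fun _ _ _ => a) = a * n%:R ^+ 3.
Proof.
by rewrite /sum3 !sumr_const_nat !subn0 -(mulr_natr a) -(mulr_natr (a * _)) -(mulr_natr (a * _ * _)) !exprS expr0 mulr1 !mulrA.
Qed.

Lemma grid_box n i j l : (i < n.+1.*2)%N -> (j < n.+1.*2)%N -> (l < n.+1.*2)%N ->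
  `|(grid n i, grid n j, grid n l)| <= m.
Proof. by move=> hi hj hl; rewrite norm3_le /= !grid_bound // ltnW. Qed.

Lemma Rsum_ext f g n : (forall x, `|x| <= m -> f x = g x) -> Rsum f n = Rsum g n.
Proof.
move=> fg; rewrite /Rsum; congr (_ / _); apply: eq_sum3 => i j l hi hj hl.
by apply: fg; exact: grid_box.
Qed.

Lemma Rsum_le f g n : (forall x, `|x| <= m -> f x <= g x) -> Rsum f n <= Rsum g n.
Proof.
move=> fg; rewrite /Rsum ler_pM2r ?invr_gt0 ?exprn_gt0 //.
by apply: ler_sum3 => i j l hi hj hl; apply: fg; exact: grid_box.
Qed.

Lemma Rsum_lin f g a n : Rsum (fun x => a * f x + g x) n = a * Rsum f n + Rsum g n.
Proof. by rewrite /Rsum sum3_lin; ring. Qed.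

Lemma Rsum_cst a n : Rsum (fun=> a) n = 8 * a.
Proof.
rewrite /Rsum sum3_cst -mul2n natrM exprMn.
have : n.+1%:R != 0 :> R by []. by move=> h; field; rewrite addrC natr1.
Qed.

Lemma Rsum_bound f n B : (forall x, `|x| <= m -> `|f x| <= B) -> `|Rsum f n| <= 8 * B.
Proof.
move=> fB; rewrite ler_norml -mulrN -!(Rsum_cst _ n).
by apply/andP; split; apply: Rsum_le => x /fB; rewrite ler_norml => /andP[].
Qed.

(** The sums stay in a compact segment, so they cluster at some p. An ultrafilter contains either a
    given set or its complement, hence a cluster point is a limit. *)
Lemma Int_cvg f : bdd f -> Rsum f @ UF --> Int f.
Proof.
move=> [B fB]; have UP := UF_proper; have UU := UF_ultra.
suff [p Hp] : exists p, Rsum f @ UF --> (p : R).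
  by rewrite /Int (cvg_lim _ Hp).
have [|p [_ clp]] := @segment_compact R (- (8 * B)) (8 * B) (Rsum f @ UF) _.
  have H n : `[- (8 * B), 8 * B]%classic (Rsum f n) by rewrite /= in_itv /= -ler_norml; exact: Rsum_bound.
  exact: (@filterE nat UF _ _ H).
exists p => A Ap.
have [//|UA] := in_ultra_setVsetC (Rsum f @^-1` A) UU.
have [q [/= qA Aq]] := clp (~` A) A UA Ap.
by case: qA.
Qed.

Lemma Int_ext f g : (forall x, `|x| <= m -> f x = g x) -> Int f = Int g.
Proof.
by move=> fg; rewrite /Int (_ : Rsum f = Rsum g) //; apply/funext => n; exact: Rsum_ext.
Qed.

Lemma Int_unique f (l : R) : Rsum f @ UF --> l -> Int f = l.
Proof. by move=> h; have UP := UF_proper; apply: cvg_lim. Qed.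

Lemma Int_lin f g a : bdd f -> bdd g -> Int (fun x => a * f x + g x) = a * Int f + Int g.
Proof.
move=> bf bg; apply: Int_unique; have UP := UF_proper.
rewrite (_ : Rsum _ = fun n => a * Rsum f n + Rsum g n); last first.
  by apply/funext => n; exact: Rsum_lin.
by apply: cvgD; [apply: cvgM; [exact: cvg_cst | exact: Int_cvg] | exact: Int_cvg].
Qed.

Lemma Int_cst a : Int (fun=> a) = 8 * a.
Proof.
apply: Int_unique; have UP := UF_proper.
by rewrite (_ : Rsum _ = fun=> 8 * a); [exact: cvg_cst | apply/funext => n; exact: Rsum_cst].
Qed.

Lemma Int_le f g : bdd f -> bdd g -> (forall x, `|x| <= m -> f x <= g x) -> Int f <= Int g.
Proof.
move=> bf bg fg; have UP := UF_proper; apply: (ler_cvg_to (Int_cvg bf) (Int_cvg bg)).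
by apply: filterE => n; exact: Rsum_le.
Qed.

Lemma Int_bound f B : (forall x, `|x| <= m -> `|f x| <= B) -> `|Int f| <= 8 * B.
Proof.
move=> fB; have UP := UF_proper.
have bf : bdd f by exists B.
have bc c : bdd (fun=> c) by exists `|c|.
rewrite ler_norml -mulrN -!Int_cst.
by apply/andP; split; apply: Int_le => // x /fB; rewrite ler_norml => /andP[].
Qed.

Lemma bdd_cst a : bdd (fun=> a). Proof. by exists `|a|. Qed.

Lemma bddD f g : bdd f -> bdd g -> bdd (fun x => f x + g x).
Proof.
move=> [B fB] [C gC]; exists (B + C) => x xm.
by rewrite (le_trans (ler_normD _ _)) // lerD ?fB ?gC.
Qed.

Lemma bddM f g : bdd f -> bdd g -> bdd (fun x => f x * g x).
Proof.
by move=> [B fB] [C gC]; exists (B * C) => x xm; rewrite normrM ler_pM ?fB ?gC.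
Qed.

Lemma bddN f : bdd f -> bdd (fun x => - f x).
Proof. by move=> [B fB]; exists B => x xm; rewrite normrN fB. Qed.

Lemma bddB f g : bdd f -> bdd g -> bdd (fun x => f x - g x).
Proof. by move=> bf bg; apply: bddD => //; exact: bddN. Qed.

Lemma bdd_norm f : bdd f -> bdd (fun x => `|f x|).
Proof. by move=> [B fB]; exists B => x xm; rewrite normr_id fB. Qed.

Lemma bdd_indic (A : set P) : bdd (\1_A : P -> R).
Proof. by exists 1 => x _; rewrite indicE; case: (_ \in _); rewrite ?normr1 ?normr0. Qed.

Lemma bdd_cont f : (forall x, {for x, continuous f}) -> bdd f.
Proof.
by move=> cf; have [x _|B _ H] := @compact_le_bound _ _ f (@compact_box R m); [exact: cf | exists B].
Qed.

Lemma bdd_dom f g : (forall x, `|f x| <= g x) -> bdd g -> bdd f.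
Proof.
move=> fg [B gB]; exists B => x xm.
exact: le_trans (fg x) (le_trans (ler_norm _) (gB _ xm)).
Qed.

Lemma IntD f g : bdd f -> bdd g -> Int (fun x => f x + g x) = Int f + Int g.
Proof.
move=> bf bg; rewrite -[Int f]mul1r -Int_lin //.
by apply: Int_ext => x _; rewrite mul1r.
Qed.

Lemma IntZ f a : bdd f -> Int (fun x => a * f x) = a * Int f.
Proof.
move=> bf; have := Int_lin a bf (bdd_cst 0); rewrite Int_cst mulr0 addr0 => <-.
by apply: Int_ext => x _; rewrite addr0.
Qed.

Lemma IntN f : bdd f -> Int (fun x => - f x) = - Int f.
Proof.
by move=> bf; rewrite -mulN1r -IntZ //; apply: Int_ext => x _; rewrite mulN1r.
Qed.

Lemma IntB f g : bdd f -> bdd g -> Int (fun x => f x - g x) = Int f - Int g.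
Proof. by move=> bf bg; rewrite IntD ?IntN //; exact: bddN. Qed.

Lemma Int_norm f : bdd f -> `|Int f| <= Int (fun x => `|f x|).
Proof.
move=> bf; have bn := bdd_norm bf.
rewrite ler_norml lerNl -IntN //; apply/andP; split; apply: Int_le => //; try exact: bddN.
  by move=> x _; rewrite -normrN ler_norm.
by move=> x _; exact: ler_norm.
Qed.

Lemma Int_le_norm f g : bdd f -> bdd g -> (forall x, `|x| <= m -> `|f x| <= g x) ->
  `|Int f| <= Int g.
Proof.
move=> bf bg fg; apply: (le_trans (Int_norm bf)); apply: Int_le => //; exact: bdd_norm.
Qed.

Lemma Rsum_cvg0 f : bdd f -> (forall e, 0 < e -> \forall n \near \oo, `|Rsum f n| <= e) ->
  Int f = 0.
Proof.
move=> bf H; have UP := UF_proper; apply: Int_unique.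
by apply/cvgrPdist_le => e e0; apply: UF_eventually; have := H e e0; apply: filterS => n; rewrite sub0r normrN.
Qed.

End Integral.

(** * Scalar products as differentials *)

Section LinearForm.
Context {R : realType}.
Notation P := (R * R * R)%type.

Lemma dot3_is_linear (c : P) : linear (dot3 c : P -> R^o).
Proof.
move=> a u v; rewrite /dot3.
rewrite -[(a *: u + v).1.1]/(a * u.1.1 + v.1.1) -[(a *: u + v).1.2]/(a * u.1.2 + v.1.2).
rewrite -[(a *: u + v).2]/(a * u.2 + v.2) -[a *: (_ : R^o)]/(a * _); ring.
Qed.

HB.instance Definition _ (c : P) :=
  GRing.isLinear.Build R P R^o _ (dot3 c : P -> R^o) (dot3_is_linear c).

Lemma cont_fst11 (x : P) : {for x, continuous (fun y : P => y.1.1)}.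
Proof. by apply: (@continuous_comp _ _ _ (fun y : P => y.1) fst); apply: cvg_fst. Qed.

Lemma cont_fst12 (x : P) : {for x, continuous (fun y : P => y.1.2)}.
Proof. by apply: (@continuous_comp _ _ _ (fun y : P => y.1) snd); [apply: cvg_fst | apply: cvg_snd]. Qed.

Lemma cont_snd2 (x : P) : {for x, continuous (fun y : P => y.2)}.
Proof. exact: cvg_snd. Qed.

Lemma dot3_cont (c : P) : continuous (dot3 c).
Proof.
move=> x; apply: cvgD; first apply: cvgD.
- by apply: cvgM; [exact: cvg_cst | exact: cont_fst11].
- by apply: cvgM; [exact: cvg_cst | exact: cont_fst12].
- by apply: cvgM; [exact: cvg_cst | exact: cont_snd2].
Qed.

Lemma dot3_le (c h : P) : `|dot3 c h| <= 3 * `|c| * `|h|.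
Proof.
have [c1 c2 c3] := coord_le c; have [h1 h2 h3] := coord_le h.
rewrite /dot3 (le_trans (ler_normD _ _)) // (_ : 3 * _ * _ = (`|c| * `|h| + `|c| * `|h|) + `|c| * `|h|); last by ring.
rewrite lerD ?normrM ?ler_pM // (le_trans (ler_normD _ _)) //.
by rewrite lerD // normrM ler_pM.
Qed.

Lemma dif3P (f : P -> R) (x c : P) :
  (forall e, 0 < e -> \forall h \near (0 : P), `|f (h + x) - f x - dot3 c h| <= e * `|h|) ->
  dif f x /\ forall v, Dv v f x = dot3 c v.
Proof. by move=> H; apply: (@difP _ _ f x (dot3 c : {linear P -> R^o})) => //; exact: dot3_cont. Qed.

Lemma dif_dot3 (c x : P) : dif (dot3 c) x /\ forall v, Dv v (dot3 c) x = dot3 c v.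
Proof.
apply: dif3P => e e0; near=> h.
have -> : dot3 c (h + x) = dot3 c h + dot3 c x by exact: (linearD (dot3 c : {linear P -> R^o})).
by rewrite addrK subrr normr0 mulr_ge0 // ltW.
Unshelve. all: by end_near. Qed.

End LinearForm.

(** * Integrals of derivatives and differentiation of convolutions *)

Section Divergence.
Context {R : realType}.
Notation P := (R * R * R)%type.
Implicit Types (f g : P -> R) (x y z v : P).
Variable m : R.
Hypothesis m0 : 0 < m.

Lemma near0_norm (d : R) : 0 < d -> \forall h \near (0 : P), `|h| < d.
Proof.
move=> d0; apply/nbhs_ballP; exists d => //= h.
by rewrite -ball_normE /= sub0r normrN.
Qed.

Lemma csupp_Dv M f v : csupp M f -> csupp M (Dv v f).
Proof.
move=> sf x Mx; rewrite (@Dv_near _ _ _ _ (fun=> 0)) ?Dv_cst //.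
have oN : open [set y : P | M < `|y|].
  by apply: (@open_comp _ _ (fun y : P => `|y|) [set z | M < z]);
    [move=> y _; exact: norm_continuous | exact: open_gt].
by apply: (near_open oN Mx) => y /= /sf.
Qed.

Lemma telescope_nat (G : nat -> R) n : \sum_(0 <= i < n) (G i.+1 - G i) = G n - G 0%N.
Proof.
elim: n => [|n IH]; first by rewrite big_geq // subrr.
by rewrite big_nat_recr //= IH; ring.
Qed.

Let step n := m / n.+1%:R.

Lemma gridS n i : grid m n i.+1 = grid m n i + step n.
Proof. by rewrite /grid /step -[i.+1]addn1 natrD; ring. Qed.

Lemma grid0 n : grid m n 0 = - m.
Proof. by rewrite /grid sub0r mulrN mulfVK. Qed.

Lemma grid_last n : grid m n n.+1.*2 = m.
Proof. by rewrite /grid -addnn natrD addrK mulfVK. Qed.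

Definition basis3 (v : P) := [\/ v = @e1 R, v = @e2 R | v = @e3 R].

Lemma basis3_norm v : basis3 v -> `|v| <= 1.
Proof. by case=> ->; rewrite norm3_le /= !normr1 !normr0 lexx ler01. Qed.

Lemma shift_e1 (p q r h : R) : (p, q, r) + h *: @e1 R = (p + h, q, r).
Proof. by rewrite -[LHS]/(p + h * 1, q + h * 0, r + h * 0) mulr1 !mulr0 !addr0. Qed.

Lemma shift_e2 (p q r h : R) : (p, q, r) + h *: @e2 R = (p, q + h, r).
Proof. by rewrite -[LHS]/(p + h * 0, q + h * 1, r + h * 0) mulr1 !mulr0 !addr0. Qed.

Lemma shift_e3 (p q r h : R) : (p, q, r) + h *: @e3 R = (p, q, r + h).
Proof. by rewrite -[LHS]/(p + h * 0, q + h * 0, r + h * 1) mulr1 !mulr0 !addr0. Qed.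

(** A shift by one mesh step makes the sum telescope in the direction v; the two end terms lie on
    faces of the cube, where f vanishes. *)
Lemma Rsum_shift f v n : basis3 v -> (forall x, m <= `|x| -> f x = 0) ->
  Rsum m (fun x => f (x + step n *: v) - f x) n = 0.
Proof.
move=> bv f0; rewrite /Rsum.
have nm : m <= `|m| by exact: ler_norm.
have nNm : m <= `|- m| by rewrite normrN.
suff -> : sum3 n.+1.*2 (fun i j l => f ((grid m n i, grid m n j, grid m n l) + step n *: v) -
    f (grid m n i, grid m n j, grid m n l)) = 0 by rewrite mul0r.
have big0 (p q r : R) : (m <= `|p|) || (m <= `|q|) || (m <= `|r|) -> f (p, q, r) = 0.
  move=> H; apply: f0; have [/= h1 h2 h3] := coord_le (p, q, r).
  by move: H => /orP[/orP[]|] h; apply: (le_trans h).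
case: bv => ->.
- rewrite /sum3 (eq_bigr (fun i => (fun i => \sum_(0 <= j < n.+1.*2) \sum_(0 <= l < n.+1.*2)
    f (grid m n i, grid m n j, grid m n l)) i.+1 - (fun i => \sum_(0 <= j < n.+1.*2) \sum_(0 <= l < n.+1.*2)
    f (grid m n i, grid m n j, grid m n l)) i)); last first.
    move=> i _; rewrite -sumrB; apply: eq_bigr => j _; rewrite -sumrB; apply: eq_bigr => l _.
    by rewrite shift_e1 gridS.
  rewrite telescope_nat grid0 grid_last -sumrB big1 // => j _.
  by rewrite -sumrB big1 // => l _; rewrite !big0 ?subrr ?nm ?nNm.
- rewrite /sum3 big1 // => i _.
  rewrite (eq_bigr (fun j => (fun j => \sum_(0 <= l < n.+1.*2)
    f (grid m n i, grid m n j, grid m n l)) j.+1 - (fun j => \sum_(0 <= l < n.+1.*2)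
    f (grid m n i, grid m n j, grid m n l)) j)); last first.
    move=> j _; rewrite -sumrB; apply: eq_bigr => l _.
    by rewrite shift_e2 gridS.
  rewrite telescope_nat grid0 grid_last -sumrB big1 // => l _.
  by rewrite !big0 ?subrr ?nm ?nNm ?orbT.
- rewrite /sum3 big1 // => i _; rewrite big1 // => j _.
  rewrite (eq_bigr (fun l => (fun l => f (grid m n i, grid m n j, grid m n l)) l.+1 -
    (fun l => f (grid m n i, grid m n j, grid m n l)) l)); last first.
    move=> l _.
    by rewrite shift_e3 gridS.
  by rewrite telescope_nat grid0 grid_last !big0 ?subrr ?nm ?nNm ?orbT.
Qed.

(** The Riemann sum of the difference quotient with increment equal to the mesh step is exactly 0.
    By the mean value theorem and uniform continuity, the derivative is uniformly close to this
    quotient once the mesh is fine. *)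
Lemma Int_Dv_basis M f v : M < m -> Ck 1 setT f -> csupp M f -> basis3 v ->
  Int m (Dv v f) = 0.
Proof.
move=> Mm hf sf bv.
have cD x : {for x, continuous (Dv v f)} by apply: (@Ck_cont _ _ 0 setT) => //; exact: Ck_Dv.
apply: Rsum_cvg0; first exact: bdd_cont.
move=> e e0.
have e80 : 0 < e / 8 by rewrite divr_gt0.
have [d d0 H] := csupp_ucont cD (csupp_Dv (v) sf) e80.
have [N _ HN] : \forall n \near \oo, step n < d.
  have : (fun n => step n) @ \oo --> (0 : R).
    rewrite -(mulr0 m); apply: cvgM; [exact: cvg_cst | exact: cvg_harmonic].
  move/cvgrPdist_lt => /(_ _ d0); apply: filterS => n.
  by rewrite sub0r normrN => h; apply: le_lt_trans h; exact: ler_norm.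
exists N => // n /= Nn.
have s0 : 0 < step n by rewrite divr_gt0.
pose q x := (step n)^-1 * (f (x + step n *: v) - f x).
have q0 : Rsum m q n = 0.
  have := Rsum_lin m (fun x => f (x + step n *: v) - f x) (fun=> 0) (step n)^-1 n.
  rewrite Rsum_cst (Rsum_shift n bv); last by move=> x h; apply: sf; apply: lt_le_trans h.
  by rewrite !mulr0 addr0 => <-; apply: (Rsum_ext m0) => x _; rewrite addr0.
have -> : Rsum m (Dv v f) n = Rsum m (fun x => (-1) * q x + Dv v f x) n.
  by rewrite Rsum_lin q0 mulr0 add0r.
rewrite (_ : e = 8 * (e / 8)); last by rewrite mulrC divfK.
apply: (Rsum_bound m0) => x _.
have [||t t01 E] := @MVT_line _ _ f x (step n *: v).
- by move=> t _; exact: (Ck_dif hf).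
- by move=> t _; apply: dif_continuous; exact: (Ck_dif hf).
rewrite /q E Dv_scalev; last exact: (Ck_dif hf).
rewrite mulKf ?gt_eqF // mulN1r addrC distrC ltW // H //.
rewrite addrC addKr (normrZ t) (normrZ (step n)) (gtr0_norm s0).
apply: le_lt_trans (HN n Nn).
have /andP[/ltW t0 /ltW t1] := t01; rewrite (ger0_norm t0).
have sv : step n * `|v| <= step n by rewrite ler_piMr ?(ltW s0) ?basis3_norm.
by apply: le_trans sv; rewrite ler_piMl // mulr_ge0 // ltW.
Qed.

Lemma Int_Dv M f v : M < m -> Ck 1 setT f -> csupp M f -> Int m (Dv v f) = 0.
Proof.
move=> Mm hf sf.
have cD w x : {for x, continuous (Dv w f)} by apply: (@Ck_cont _ _ 0 setT) => //; exact: Ck_Dv.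
have bD w : bdd m (Dv w f) by exact: bdd_cont.
have bZ a w : bdd m (fun x => a * Dv w f x) by apply: bddM; [exact: bdd_cst | exact: bD].
rewrite (@Int_ext _ _ m0 _ (fun x => v.1.1 * Dv (@e1 R) f x + v.1.2 * Dv (@e2 R) f x + v.2 * Dv (@e3 R) f x)); last first.
  by move=> x _; apply: Dv_coord; exact: (Ck_dif hf).
rewrite (IntD m0) ?(IntD m0) ?(IntZ m0) //; last exact: bddD.
rewrite !(Int_Dv_basis Mm hf sf) ?mulr0 ?addr0 //.
by apply: Or33. by apply: Or32. by apply: Or31.
Qed.

Lemma sum3_prod n (a : nat -> R) B :
  sum3 n (fun i j l => B * (a i * a j * a l)) = B * (\sum_(0 <= i < n) a i) ^+ 3.
Proof.
set S := \sum_(0 <= i < n) a i; rewrite /sum3.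
rewrite (eq_bigr (fun i => (B * S * S) * a i)) => [|i _]; first by rewrite -mulr_sumr -/S; ring.
rewrite (eq_bigr (fun j => (B * S * a i) * a j)) => [|j _].
  by rewrite -mulr_sumr -/S; ring.
rewrite (eq_bigr (fun l => (B * a i * a j) * a l)) => [|l _]; last by ring.
by rewrite -mulr_sumr -/S; ring.
Qed.

(** A lower bound obtained by counting the grid points in [0, d]^3. It serves to show that the mass
    of the Dirac limit is not 0. *)
Lemma Int_cube f B d : 0 < d < m -> 0 <= B -> bdd m f ->
  (forall x, `|x| <= m -> 0 <= f x) ->
  (forall p q r : R, 0 <= p <= d -> 0 <= q <= d -> 0 <= r <= d -> B <= f (p, q, r)) ->
  B * (d / m) ^+ 3 <= Int m f.
Proof.
move=> /andP[d0 dm] B0 bf f0 fB; have UP := UF_proper.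
apply: (ler_cvg_to (cvg_cst _) (Int_cvg m0 bf)); apply: filterE => n.
pose N := n.+1; have N0 : 0 < N%:R :> R by [].
(* [grid] takes the value 0 at the index N, so its values at N, ..., N + T lie in [0, d]; there are
   T + 1 > d N / m of them on each axis. *)
pose T := Num.trunc (d * N%:R / m).
have a0 : 0 <= d * N%:R / m by rewrite divr_ge0 ?mulr_ge0 // ltW.
have /andP[T1 T2] := truncn_itv a0; rewrite -/T in T1 T2.
have TN : (T < N)%N.
  rewrite -(ltr_nat R); apply: le_lt_trans T1 _.
  by rewrite ltr_pdivrMr // mulrC ltr_pM2l.
pose a (i : nat) : R := ((N <= i < N + T.+1)%N)%:R.
have a01 i : 0 <= a i by [].
have suma : \sum_(0 <= i < N.*2) a i = T.+1%:R.
  rewrite (@big_cat_nat _ _ _ N) //=; last by rewrite -addnn leq_addr.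
  rewrite (@big_cat_nat _ _ _ (N + T.+1) N) //=; [|by rewrite leq_addr|by rewrite -addnn leq_add2l].
  rewrite big_nat big1 ?add0r; last by move=> i /andP[_ iN]; rewrite /a leqNgt iN.
  rewrite [X in _ + X]big_nat [X in _ + X]big1 ?addr0; last first.
    by move=> i /andP[iN _]; rewrite /a [(i < _)%N]ltnNge iN andbF.
  rewrite big_nat (eq_bigr (fun=> 1)); last by move=> i h; rewrite /a h.
  by rewrite -big_nat sumr_const_nat addKn.
apply: (@le_trans _ _ (sum3 N.*2 (fun i j l => B * (a i * a j * a l)) / N%:R ^+ 3)).
  have -> : sum3 N.*2 (fun i j l => B * (a i * a j * a l)) = B * T.+1%:R ^+ 3.
    by rewrite -suma; exact: sum3_prod.
  have h : d / m <= T.+1%:R / N%:R.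
    by rewrite ler_pdivlMr // mulrAC ltW.
  rewrite -mulrA ler_wpM2l // -expr_div_n.
  by apply: lerXn2r h; rewrite nnegrE divr_ge0 // ltW.
rewrite /Rsum ler_wpM2r ?invr_ge0 ?exprn_ge0 //; apply: ler_sum3 => i j l hi hj hl.
have ai k : a k = 0 \/ (a k = 1 /\ 0 <= grid m n k <= d).
  rewrite /a; case: (boolP (N <= k < N + T.+1)%N); last by left.
  move=> /andP[k1 k2]; right; split=> //.
  rewrite /grid -/N; have -> : k = (N + (k - N))%N by rewrite subnKC.
  rewrite natrD addrAC subrr add0r.
  have kT : (k - N <= T)%N by rewrite leq_subLR -ltnS -addnS.
  rewrite mulr_ge0 ?divr_ge0 ?(ltW m0) //=.
  rewrite mulrAC ler_pdivrMr // mulrC -ler_pdivlMr // (le_trans _ T1) // ler_nat //.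
have fg : 0 <= f (grid m n i, grid m n j, grid m n l) by apply: f0; exact: grid_box.
have [->|[-> gi]] := ai i; first by rewrite !mul0r mulr0.
have [->|[-> gj]] := ai j; first by rewrite mulr0 mul0r mulr0.
have [->|[-> gl]] := ai l; first by rewrite !mulr0.
by rewrite !mulr1; exact: fB.
Qed.

Lemma cont_refl f x : (forall y, {for y, continuous f}) -> forall y, {for y, continuous (fun z => f (x - z))}.
Proof.
move=> cf y; have := @Ck_refl _ _ 0 setT f x openT (fun z _ => cf z).
exact.
Qed.

Lemma Ck_refl_all k f x : Ck k setT f -> Ck k setT (fun z => f (x - z)).
Proof. by move=> hf; have := @Ck_refl _ _ k setT f x openT hf; apply: Ck_sub. Qed.

Lemma bdd_conv W f x : bdd m W -> (forall y, {for y, continuous f}) ->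
  bdd m (fun y => W y * f (x - y)).
Proof. by move=> bW cf; apply: bddM => //; apply: bdd_cont; exact: cont_refl. Qed.

(** All the regularity comes from f, since W is merely bounded: the mean value theorem and the
    uniform continuity of the partial derivatives of f give a first-order expansion of f (z - y)
    uniform in y. *)
Lemma Int_conv_dif M W f x : bdd m W -> Ck 1 setT f -> csupp M f ->
  dif (fun z => Int m (fun y => W y * f (z - y))) x /\
  forall v, Dv v (fun z => Int m (fun y => W y * f (z - y))) x =
            Int m (fun y => W y * Dv v f (x - y)).
Proof.
move=> bW hf sf.
have [B WB] := bW.
have cf y : {for y, continuous f} by exact: (Ck_cont hf).
have cD v y : {for y, continuous (Dv v f)} by apply: (@Ck_cont _ _ 0 setT) => //; exact: Ck_Dv.
pose c v := Int m (fun y => W y * Dv v f (x - y)).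
have cE v : c v = dot3 (c (@e1 R), c (@e2 R), c (@e3 R)) v.
  have b1 w a : bdd m (fun y => a * (W y * Dv w f (x - y))).
    by apply: bddM; [exact: bdd_cst | exact: bdd_conv].
  have b2 w : bdd m (fun y => W y * Dv w f (x - y)) by exact: bdd_conv.
  rewrite /dot3 /= [c _ * _]mulrC [c (@e2 R) * _]mulrC [c (@e3 R) * _]mulrC /c.
  rewrite -!(IntZ m0) // -!(IntD m0) //; last exact: bddD.
  apply: (Int_ext m0) => y _; rewrite Dv_coord; last exact: (Ck_dif hf).
  ring.
suff : dif (fun z => Int m (fun y => W y * f (z - y))) x /\
  forall v, Dv v (fun z => Int m (fun y => W y * f (z - y))) x =
    dot3 (c (@e1 R), c (@e2 R), c (@e3 R)) v.
  by move=> [d1 D1]; split=> // v; rewrite D1 -cE.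
apply: dif3P => e e0.
have B1 : 0 < `|B| + 1 by rewrite ltr_wpDl.
(* Here 24 = 8 * 3, the mass of the cube times the number of partial derivatives. *)
have e'0 : 0 < e / (24 * (`|B| + 1)) by rewrite divr_gt0 // mulr_gt0.
have [d1 d10 H1] := csupp_ucont (cD (@e1 R)) (csupp_Dv (@e1 R) sf) e'0.
have [d2 d20 H2] := csupp_ucont (cD (@e2 R)) (csupp_Dv (@e2 R) sf) e'0.
have [d3 d30 H3] := csupp_ucont (cD (@e3 R)) (csupp_Dv (@e3 R) sf) e'0.
near=> h.
have hd : [/\ `|h| < d1, `|h| < d2 & `|h| < d3].
  split.
  - by near: h; exact: near0_norm.
  - by near: h; exact: near0_norm.
  - by near: h; exact: near0_norm.
rewrite -cE /c -!(IntB m0); try (by apply: bdd_conv); try (by apply: bddB; apply: bdd_conv).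
rewrite (_ : e * `|h| = 8 * ((`|B| + 1) * (3 * (e / (24 * (`|B| + 1))) * `|h|))); last first.
  by field; rewrite gt_eqF.
apply: (Int_bound m0) => // y ym.
rewrite -!mulrBr normrM ler_pM //; first by rewrite (le_trans (WB _ ym)) // (le_trans (ler_norm _)) // lerDl.
have [||t t01 E] := @MVT_line _ _ f (x - y) h.
- by move=> t _; exact: (Ck_dif hf).
- by move=> t _; exact: cf.
have -> : h + x - y = x - y + h by rewrite -addrA addrC.
have dA z : dif f z by exact: (Ck_dif hf).
rewrite E !(Dv_coord h) //.
have th : `|x - y + t *: h - (x - y)| <= `|h|.
  rewrite addrC addKr normrZ; have /andP[/ltW t0 /ltW t1] := t01.
  by rewrite (ger0_norm t0) ler_piMl.
have [k1 k2 k3] := hd; have [l1 l2 l3] := coord_le h.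
have G1 := ltW (H1 _ _ (le_lt_trans th k1)).
have G2 := ltW (H2 _ _ (le_lt_trans th k2)).
have G3 := ltW (H3 _ _ (le_lt_trans th k3)).
set e' := e / _ in G1 G2 G3 *.
have -> : forall a1 a2 a3 b1 b2 b3 p q r : R, p * a1 + q * a2 + r * a3 - (p * b1 + q * b2 + r * b3) =
   p * (a1 - b1) + q * (a2 - b2) + r * (a3 - b3) by move=> *; ring.
rewrite (le_trans (ler_normD _ _)) // (_ : 3 * _ * _ = (`|h| * e' + `|h| * e') + `|h| * e'); last by ring.
by rewrite lerD ?normrM ?ler_pM // (le_trans (ler_normD _ _)) // lerD // normrM ler_pM.
Unshelve. all: by end_near. Qed.

Lemma Int_conv_Ck k M W f : bdd m W -> Ck k.+1 setT f -> csupp M f ->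
  Ck k.+1 setT (fun z => Int m (fun y => W y * f (z - y))).
Proof.
move=> bW; elim: k f => [|k IH] f hf sf.
  split=> [x _|v x _]; first by have [] := Int_conv_dif x bW hf sf.
  suff : {for x, continuous (fun z => Int m (fun y => W y * Dv v f (z - y)))}.
    move=> H; rewrite (_ : Dv v _ = fun z => Int m (fun y => W y * Dv v f (z - y))) //.
    by apply/funext => z; have [_ ->] := Int_conv_dif z bW hf sf.
  have cD y : {for y, continuous (Dv v f)} by apply: (@Ck_cont _ _ 0 setT) => //; exact: Ck_Dv.
  have [B WB] := bW.
  apply/cvgrPdist_le => e e0.
  have B1 : 0 < `|B| + 1 by rewrite ltr_wpDl.
  have e'0 : 0 < e / (8 * (`|B| + 1)) by rewrite divr_gt0 // mulr_gt0.
  have [d d0 H] := csupp_ucont cD (csupp_Dv (v) sf) e'0.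
  near=> z.
  have zd : `|x - z| < d by near: z; exact: cvgr_dist_lt.
  rewrite -(IntB m0); [|exact: bdd_conv|exact: bdd_conv].
  rewrite (_ : e = 8 * ((`|B| + 1) * (e / (8 * (`|B| + 1))))); last by field; rewrite gt_eqF.
  apply: (Int_bound m0) => // y ym.
  rewrite -!mulrBr normrM ler_pM //; first by rewrite (le_trans (WB _ ym)) // (le_trans (ler_norm _)) // lerDl.
  by apply/ltW/H; rewrite opprB addrA subrK.
have h1 : Ck 1 setT f by exact: (@Ck_le _ _ k.+2 1).
split=> [x _|v]; first by have [] := Int_conv_dif x bW h1 sf.
rewrite (_ : Dv v _ = fun z => Int m (fun y => W y * Dv v f (z - y))).
  by apply: IH; [exact: Ck_Dv | exact: csupp_Dv].
by apply/funext => z; have [_ ->] := Int_conv_dif z bW h1 sf.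
Unshelve. all: by end_near. Qed.

End Divergence.

(** * One-variable functions: truncated powers, inverse roots, a step *)

Section OneVariable.
Context {R : realType}.
Implicit Types (t d : R) (h : R -> R) (B : set R).

Lemma is_derive_near h t d :
  (forall e, 0 < e -> \forall s \near t, `|h s - h t - d * (s - t)| <= e * `|s - t|) ->
  is_derive t 1 h d.
Proof.
move=> H.
have cv : (fun s => s^-1 *: (h (s *: 1 + t) - h t)) @ 0^' --> d.
  apply/cvgrPdist_le => e e0.
  have N : \forall s \near (0 : R), `|h (s + t) - h t - d * s| <= e * `|s|.
    have T : (fun s : R => s + t) @ (0 : R) --> t.
      by rewrite -[X in _ --> X]add0r; apply: cvgD; [exact: cvg_id | exact: cvg_cst].
    have N0 : \forall s \near (0 : R), `|h (s + t) - h t - d * (s + t - t)| <= e * `|s + t - t|.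
      by have := T _ (H e e0).
    by near=> s; have := near N0 s; rewrite addrK; apply.
  near=> s.
  have s0 : s != 0 by near: s; exact: nbhs_dnbhs_neq.
  have Ns : `|h (s + t) - h t - d * s| <= e * `|s|.
    by near: s; apply: nbhs_dnbhs; exact: N.
  rewrite [s *: 1]mulr1 -[s^-1 *: _]/(s^-1 * _).
  rewrite distrC (_ : s^-1 * _ - d = s^-1 * (h (s + t) - h t - d * s)); last by field.
  by rewrite normrM normfV mulrC ler_pdivrMr ?normr_gt0.
have dh : derivable h t 1 by apply/cvg_ex; exists d.
by split=> //; apply: cvg_lim.
Unshelve. all: by end_near. Qed.

Lemma is_derive_quadratic h t d : (forall s, `|h s - h t - d * (s - t)| <= (s - t) ^+ 2) ->
  is_derive t 1 h d.
Proof.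
move=> H; apply: is_derive_near => e e0; near=> s.
apply: (le_trans (H s)); rewrite -[(s - t) ^+ 2]real_normK ?num_real // expr2.
rewrite ler_wpM2r // ltW // distrC; near: s; exact: cvgr_dist_lt.
Unshelve. all: by end_near. Qed.

Lemma is_derive_local h g t d : (\forall s \near t, g s = h s) -> is_derive t 1 h d -> is_derive t 1 g d.
Proof.
move=> E; have N : \forall s \near t, h s = g s by apply: filterS E.
exact: (near_eq_is_derive N).
Qed.

Lemma SC_cst n B d : SC n B (fun=> d).
Proof.
elim: n d => [|n IH] d /=; first by move=> t _; exact: cvg_cst.
by exists (fun=> 0); split=> // t _; exact: is_derive_cst.
Qed.

Lemma SCZ n B h d : SC n B h -> SC n B (fun t => d * h t).
Proof.
elim: n h => [|n IH] h /=; first by move=> ch t Bt; apply: cvgM; [exact: cvg_cst | exact: ch].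
move=> [h' [dh sh]]; exists (fun t => d * h' t); split; last exact: IH.
by move=> t Bt; apply: (is_deriveZ d); exact: dh.
Qed.

Lemma SC_le n m B h : (m <= n)%N -> SC n B h -> SC m B h.
Proof.
elim: n m h => [|n IH] m h; first by rewrite leqn0 => /eqP ->.
case: m => [_ sh|m]; first by move=> t Bt; exact: (SC_cont sh).
by rewrite ltnS => mn [h' [dh sh]]; exists h'; split=> //; exact: IH mn sh.
Qed.

Lemma continuous_max0 (T : topologicalType) (f : T -> R) (x : T) :
  {for x, continuous f} -> {for x, continuous (fun y => Num.max (f y) 0)}.
Proof.
move=> cf; rewrite (_ : (fun y => _) = fun y => 2^-1 * (f y + `|f y|)); last first.
  apply/funext => y; have [y0|y0] := leP 0 (f y); last by rewrite ltr0_norm // subrr mulr0.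
  by rewrite ger0_norm //; field.
apply: cvgM; [exact: cvg_cst | apply: cvgD => //; exact: cvg_norm].
Qed.

Lemma continuousXn n t : {for t, continuous (fun s : R => s ^+ n)}.
Proof.
elim: n => [|n IH]; first by rewrite (_ : (fun _ => _) = fun=> 1); [exact: cvg_cst | apply/funext => s; rewrite expr0].
rewrite (_ : (fun _ => _) = fun s => s * s ^+ n); last by apply/funext => s; rewrite exprS.
by apply: cvgM; [exact: cvg_id | exact: IH].
Qed.

(** The truncated power t_+^(n+1), of class C^n, from which both cutoffs [step] and [chi] are
    built. *)
Definition ppf (n : nat) t : R := t ^+ n * Num.max t 0.

Lemma ppf_gt0 n t : 0 <= t -> ppf n t = t ^+ n.+1.
Proof. by move=> t0; rewrite /ppf max_l // exprSr. Qed.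

Lemma ppf_le0 n t : t <= 0 -> ppf n t = 0.
Proof. by move=> t0; rewrite /ppf max_r // mulr0. Qed.

Lemma ppf_ge0 n t : 0 <= ppf n t.
Proof.
by case: (leP 0 t) => t0; [rewrite ppf_gt0 // exprn_ge0 | rewrite ppf_le0 // ltW].
Qed.

Lemma ppf_cont n t : {for t, continuous (ppf n)}.
Proof.
apply: cvgM; first exact: continuousXn.
by apply: continuous_max0; exact: cvg_id.
Qed.

Lemma ppf_derive n t : is_derive t 1 (ppf n.+1) (n.+2%:R * ppf n t).
Proof.
elim: n => [|n IH].
  apply: is_derive_quadratic => s; rewrite /ppf !expr1 expr0 mul1r ler_norml.
  have sq := sqr_ge0 (s - t).
  by have [t0|t0] := leP 0 t; have [s0|s0] := leP 0 s; apply/andP; split; nra.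
have -> : ppf n.+2 = (fun s => s * ppf n.+1 s).
  by apply/funext => s; rewrite /ppf exprS mulrA.
have D := @is_deriveM _ _ id (ppf n.+1) t 1 1 (n.+2%:R * ppf n t) (is_derive_id _ _) IH.
apply: (is_derive_eq D).
rewrite -![_ *: _]/(_ * _) mulr1 /ppf [t ^+ n.+1]exprS -[n.+3%:R]natr1; ring.
Qed.

Lemma SC_ppf n B : SC n B (ppf n).
Proof.
apply: (@SC_le n n) => //.
elim: n => [|n IH]; first by move=> t _; exact: ppf_cont.
by exists (fun t => n.+2%:R * ppf n t); split=> [t _|]; [exact: ppf_derive | exact: SCZ].
Qed.

(** The power t^(-n/2), that is |z|^-n at t = |z|^2. *)
Definition isq (n : nat) t : R := (Num.sqrt t)^-1 ^+ n.

Lemma isq_derive n t : 0 < t -> is_derive t 1 (isq n) (- (n%:R / 2) * isq n.+2 t).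
Proof.
move=> t0; have s0 : Num.sqrt t != 0 by rewrite gt_eqF // sqrtr_gt0.
have D1 := is_derive1_sqrt t0.
have D2 := @is_deriveV _ (@Num.sqrt R) t _ 1 s0 D1.
have D3 := @is_deriveX _ _ (fun x : R => (Num.sqrt x)^-1) n t 1 _ D2.
rewrite exprfctE in D3; apply: (is_derive_eq D3).
rewrite -![_ *: _]/(_ * _) /isq.
case: n {D3} => [|n]; first by rewrite mulr0n !mul0r oppr0 mul0r.
rewrite -mulr_natl /= !exprS; field; exact: s0.
Qed.

Lemma SC_isq n k : SC n (fun t => 0 < t) (isq k).
Proof.
elim: n k => [|n IH] k.
  move=> t t0; have [dd _] := isq_derive k t0.
  by apply: differentiable_continuous; apply/derivable1_diffP.
by exists (fun t => - (k%:R / 2) * isq k.+2 t); split=> [t t0|]; [exact: isq_derive | exact: SCZ].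
Qed.

Lemma SC_atan : SC 1 setT (@atan R).
Proof.
exists (fun t => (1 + t ^+ 2)^-1); split=> [t _|t _]; first exact: is_derive1_atan.
apply: cvgV; first by rewrite gt_eqF // ltr_wpDr // sqr_ge0.
by apply: cvgD; [exact: cvg_cst | exact: continuousXn].
Qed.

Lemma atan_bound t : `|atan t| <= 2.
Proof.
have h1 := atan_gtNpi2 t; have h2 := atan_ltpi2 t.
have h3 : pi / 2 < 2 :> R by exact: pihalf_lt2.
rewrite ler_norml; lra.
Qed.

(** The C^1 function (1 - (t + 2)_+^2)_+^2, equal to 1 for t <= -2 and to 0 for t >= -1. It is
    evaluated at n phi, so that the transition takes place strictly inside D. *)
Definition step t : R := ppf 1 (1 - ppf 1 (t + 2)).
Definition step' t : R := 2 * Num.max (1 - ppf 1 (t + 2)) 0 * - (2 * Num.max (t + 2) 0).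

Lemma step_derive t : is_derive t 1 step (step' t).
Proof.
have D0 : is_derive t 1 (fun s : R => s + 2) 1.
  by have := @is_deriveD _ _ _ id (cst (2 : R)) t 1 1 0 (is_derive_id _ _) (is_derive_cst _ _ _); rewrite addr0.
have D1 : is_derive t 1 (fun s : R => ppf 1 (s + 2)) (2 * ppf 0 (t + 2) * 1).
  exact: (@is_derive1_comp R (ppf 1) (fun s : R => s + 2) t _ _ (ppf_derive 0 (t + 2)) D0).
have D2 : is_derive t 1 (fun s : R => 1 - ppf 1 (s + 2)) (0 - 2 * ppf 0 (t + 2) * 1).
  have := @is_deriveB _ _ _ (cst (1 : R)) (fun s : R => ppf 1 (s + 2)) t 1 0 _ (is_derive_cst _ _ _) D1.
  exact.
have D3 := @is_derive1_comp R (ppf 1) (fun s : R => 1 - ppf 1 (s + 2)) t _ _ (ppf_derive 0 (1 - ppf 1 (t + 2))) D2.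
by apply: (is_derive_eq D3); rewrite /step' /ppf !expr0 !mul1r mulr1 sub0r.
Qed.

Lemma step_lo t : t <= -2 -> step t = 1 /\ step' t = 0.
Proof.
move=> t2; have h : t + 2 <= 0 by lra.
by rewrite /step /step' (ppf_le0 1 h) (max_r h) subr0 ppf_gt0 // expr1n mulr0 oppr0 mulr0.
Qed.

Lemma step_hi t : -1 <= t -> step t = 0 /\ step' t = 0.
Proof.
move=> t1; have h : 0 <= t + 2 by lra.
have h1 : 1 - ppf 1 (t + 2) <= 0 by rewrite ppf_gt0 //; nra.
by rewrite /step /step' (ppf_le0 1 h1) (max_r h1) mulr0 mul0r.
Qed.

Lemma step_mid t : -2 <= t <= -1 -> 0 <= step t <= 1 /\ `|step' t| <= 4.
Proof.
move=> /andP[t2 t1]; have h : 0 <= t + 2 by lra.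
have h1 : 0 <= 1 - (t + 2) ^+ 2 by nra.
rewrite /step /step' ppf_gt0 // ppf_gt0 // (max_l h1) (max_l h) ler_norml.
set a := t + 2 in h h1 *; have a1 : a <= 1 by rewrite /a; lra.
by split; apply/andP; split; nra.
Qed.

Lemma SC_step : SC 1 setT step.
Proof.
exists step'; split=> [t _|t _]; first exact: step_derive.
have c2 : {for t, continuous (fun s : R => s + 2)} by apply: cvgD; [exact: cvg_id | exact: cvg_cst].
have c3 : {for t, continuous (fun s : R => 1 - ppf 1 (s + 2))}.
  by apply: cvgB; [exact: cvg_cst | apply: (continuous_comp c2); exact: ppf_cont].
apply: cvgM; [apply: cvgM; [exact: cvg_cst|] | apply: cvgN; apply: cvgM; [exact: cvg_cst|]].
  exact: (@continuous_max0 R (fun s : R => 1 - ppf 1 (s + 2)) t c3).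
exact: (@continuous_max0 R (fun s : R => s + 2) t c2).
Qed.

End OneVariable.

(** * Weak form of the Helmholtz equation *)

Section Gluing.
Context {R : realType}.
Notation P := (R * R * R)%type.
Implicit Types (f g : P -> R) (x y z v : P) (A B K D : set P).

Definition lapD f x : R := Dv (@e1 R) (Dv (@e1 R) f) x + Dv (@e2 R) (Dv (@e2 R) f) x +
  Dv (@e3 R) (Dv (@e3 R) f) x.

Lemma Dv_off K f v x : closed K -> (forall y, ~ K y -> f y = 0) -> ~ K x -> Dv v f x = 0.
Proof.
move=> cK f0 Kx; rewrite (@Dv_near _ _ _ _ (fun=> 0)) ?Dv_cst //.
by apply: (near_open (closed_openC cK) Kx) => y; exact: f0.
Qed.

Lemma Ck_glue j B K f : open B -> closed K -> K `<=` B -> Ck j B f ->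
  (forall x, ~ K x -> f x = 0) -> Ck j setT f.
Proof.
move=> oB cK KB hf f0.
have hK : Ck j (~` K) f.
  by apply: (Ck_ext (closed_openC cK) _ (@Ck_cst _ _ j (~` K) 0)) => x /f0.
apply: (Ck_sub _ (Ck_union hf hK)) => x _.
by have [/KB|] := pselect (K x); [left|right].
Qed.

Lemma csupp_sub K M f : K `<=` [set x | `|x| <= M] -> (forall x, ~ K x -> f x = 0) -> csupp M f.
Proof. by move=> KM f0 x Mx; apply: f0 => /KM /=; rewrite leNgt Mx. Qed.

Lemma open_gt_on B f (a : R) : open B -> (forall x, B x -> {for x, continuous f}) ->
  open [set x | B x /\ a < f x].
Proof.
move=> oB cf; rewrite openE => x [Bx ax].
have N1 : \forall y \near x, B y by exact: open_nbhs_nbhs.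
have N2 : \forall y \near x, a < f y by have := cf x Bx; move/cvgr_gt => /(_ a ax).
by apply: filterS2 N1 N2 => y.
Qed.

Lemma indicT D x : D x -> \1_D x = 1 :> R.
Proof. by move=> Dx; rewrite indicE mem_set. Qed.

Lemma indicF D x : ~ D x -> \1_D x = 0 :> R.
Proof. by move=> Dx; rewrite indicE memNset. Qed.

Lemma compact_bound3 K f g (h : P -> R) : compact K -> (forall x, K x -> {for x, continuous f}) ->
  (forall x, K x -> {for x, continuous g}) -> (forall x, K x -> {for x, continuous h}) ->
  exists2 C, 0 <= C & forall x, K x -> [/\ `|f x| <= C, `|g x| <= C & `|h x| <= C].
Proof.
move=> cK cf cg ch.
have [C1 C10 H1] := compact_le_bound cK cf.
have [C2 C20 H2] := compact_le_bound cK cg.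
have [C3 C30 H3] := compact_le_bound cK ch.
exists (C1 + C2 + C3); first by rewrite !addr_ge0.
move=> x Kx; have := H1 x Kx; have := H2 x Kx; have := H3 x Kx.
by split; lra.
Qed.

End Gluing.

(** * Green's identity up to a C^1 boundary *)

Section WeakIdentity.
Context {R : realType}.
Notation P := (R * R * R)%type.
Variables (m M k c : R) (D B K : set P) (V phi zeta t : P -> R) (w : P) (m1 : R).
Hypotheses (m0 : 0 < m) (Mm : M < m) (oD : open D) (oB : open B) (cK : closed K).
Hypotheses (KB : K `<=` B) (KM : K `<=` [set x | `|x| <= M]).
Hypotheses (V0 : forall x, ~ D x -> V x = 0) (DV0 : forall x v, ~ D x -> Dv v V x = 0).
Hypotheses (V1 : Ck 1 setT V) (V2 : Ck 2 D V).
Hypothesis V_eq : forall x, D x -> lapD V x + k ^+ 2 * V x = c.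
Hypotheses (phi1 : Ck 1 B phi) (phiD : forall x, B x -> (D x <-> phi x < 0)).
Hypotheses (m10 : 0 < m1) (phiw : forall x, K x -> m1 <= Dv w phi x).
Hypotheses (zeta1 : Ck 1 setT zeta) (zetaK : forall x, ~ K x -> zeta x = 0).
Hypotheses (zeta0 : forall x, 0 <= zeta x) (t2 : Ck 2 setT t) (tz : forall x, `|t x| <= zeta x).

Let compK : compact K.
Proof. exact: (compact_subset_closed (@compact_box R M) cK KM). Qed.

Let tK x : ~ K x -> t x = 0.
Proof. by move=> /zetaK z0; apply/eqP; rewrite -normr_le0 -z0. Qed.

Let t1 : Ck 1 setT t. Proof. exact: CkS. Qed.

Let contDt e x : {for x, continuous (Dv e t)}.
Proof. by apply: (@Ck_cont _ _ 1 setT) => //; exact: Ck_Dv. Qed.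

Let contDV e x : {for x, continuous (Dv e V)}.
Proof. by apply: (@Ck_cont _ _ 0 setT) => //; exact: Ck_Dv. Qed.

Let contV x : {for x, continuous V}. Proof. exact: (Ck_cont V1). Qed.
Let contt x : {for x, continuous t}. Proof. exact: (Ck_cont t1). Qed.
Let contz x : {for x, continuous zeta}. Proof. exact: (Ck_cont zeta1). Qed.

(** Multiplied by the derivative of phi, this is the derivative of atan (n phi): an approximate
    surface measure on phi = 0. It is integrated against [zeta], a C^1 majorant of |t|, because |t|
    itself need not be differentiable. *)
Let q (n : R) x := n / (1 + (n * phi x) ^+ 2).

Let den_gt0 (n : R) x : 0 < 1 + (n * phi x) ^+ 2.
Proof. by rewrite ltr_wpDr // sqr_ge0. Qed.

Let q_ge0 n x : 0 < n -> 0 <= q n x.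
Proof. by move=> n0; rewrite /q divr_ge0 // ltW. Qed.

Let q_le n x : 0 < n -> q n x <= n.
Proof. by move=> n0; rewrite /q ler_pdivrMr // ler_peMr ?(ltW n0) // lerDl sqr_ge0. Qed.

Let bdd_zq n : 0 < n -> bdd m (fun x => zeta x * q n x).
Proof.
move=> n0; apply: (@bdd_dom _ _ _ (fun x => zeta x * n)).
  by move=> x; rewrite normrM !ger0_norm ?q_ge0 ?zeta0 // ler_wpM2l ?q_le.
by apply: bddM; [exact: bdd_cont | exact: bdd_cst].
Qed.

Let nphi1 (n : R) : Ck 1 B (fun x => n * phi x).
Proof. exact: CkZ. Qed.

(* The layer |phi| <~ 1/n has mass O(1/n): test the divergence of zeta * atan (n phi). *)
Lemma layer_mass : exists2 C, 0 <= C & forall n, 0 < n ->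
  Int m (fun x => zeta x * q n x) <= C.
Proof.
have cz x : {for x, continuous (Dv w zeta)} by apply: (@Ck_cont _ _ 0 setT) => //; exact: Ck_Dv.
have [Bz Bz0 HBz] := compact_le_bound (@compact_box R m) (fun x _ => cz x).
exists (m1^-1 * (8 * (2 * Bz))).
  by rewrite mulr_ge0 ?invr_ge0 ?(ltW m10) // !mulr_ge0.
move=> n n0; pose f x := zeta x * atan (n * phi x).
have fK x : ~ K x -> f x = 0 by move=> /zetaK; rewrite /f => ->; rewrite mul0r.
have f1 : Ck 1 setT f.
  apply: (Ck_glue oB cK KB _ fK); apply: CkM => //; first exact: (Ck_sub _ zeta1).
  by apply: (Ck_comp oB SC_atan) => //; exact: nphi1.
have Df x : Dv w f x = zeta x * (q n x * Dv w phi x) + atan (n * phi x) * Dv w zeta x.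
  have [Kx|Kx] := pselect (K x); last first.
    by rewrite (Dv_off w cK fK Kx) (Dv_off w cK zetaK Kx) zetaK // mul0r mulr0 addr0.
  have dp : dif phi x by apply: (Ck_dif phi1); exact: KB.
  have dnp : dif (fun y => n * phi y) x by exact: difZ.
  have da := is_derive1_atan (n * phi x).
  rewrite /f DvM; [|exact: (Ck_dif zeta1)|exact: (dif_comp (f := fun y => n * phi y) da dnp)].
  by rewrite (Dv_comp (f := fun y => n * phi y) w da dnp) DvZ // /q; ring.
have ba : bdd m (fun x => atan (n * phi x) * Dv w zeta x).
  exists (2 * Bz) => x xm; rewrite normrM ler_pM ?atan_bound //; exact: HBz.
have cf x : {for x, continuous (Dv w f)} by apply: (@Ck_cont _ _ 0 setT) => //; exact: Ck_Dv.
have If : Int m (Dv w f) = 0 by apply: (Int_Dv m0 w Mm f1); exact: (csupp_sub KM fK).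
pose g x := Dv w f x - atan (n * phi x) * Dv w zeta x.
have bg : bdd m g by apply: bddB => //; exact: bdd_cont.
have Ig : Int m g <= 8 * (2 * Bz).
  rewrite /g (IntB m0) //; last exact: bdd_cont.
  rewrite If sub0r (le_trans (ler_norm _)) // normrN; apply: (Int_bound m0) => x xm.
  by rewrite normrM ler_pM ?atan_bound //; exact: HBz.
apply: (@le_trans _ _ (m1^-1 * Int m g)); last by rewrite ler_wpM2l // invr_ge0 ltW.
rewrite -(IntZ m0) //; apply: (Int_le m0); [exact: bdd_zq|by apply: bddM => //; exact: bdd_cst|].
move=> x _; rewrite /g Df addrK.
have [Kx|Kx] := pselect (K x); last by rewrite zetaK // !mul0r mulr0.
rewrite (mulrCA m1^-1) ler_wpM2l // (mulrCA m1^-1) ler_peMr ?q_ge0 //.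
by rewrite mulrC ler_pdivlMr // mul1r phiw.
Qed.

(** The factor step (n phi) vanishes where phi >= - 1/n, so [F] is C^1 on the whole space although
    the second derivatives of V are controlled inside D only. *)
Let F (e : P) (n : R) x := step (n * phi x) * Dv e V x * t x.

Let F_Ck e n : 0 < n -> Ck 1 setT (F e n).
Proof.
move=> n0.
have FK x : ~ K x -> F e n x = 0 by rewrite /F => /tK ->; rewrite mulr0.
apply: (Ck_glue oB cK KB _ FK); apply: CkM => //; last exact: (Ck_sub _ t1).
have o1 : open [set x | B x /\ - n^-1 < phi x].
  by apply: open_gt_on => // x Bx; exact: (Ck_cont phi1).
have oBD : open (B `&` D) by exact: openI.
have h1 : Ck 1 (B `&` D) (fun x => step (n * phi x) * Dv e V x).
  apply: CkM => //; last by apply: (Ck_sub _ (Ck_Dv e V2)) => x [].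
  by apply: (Ck_comp oBD SC_step) => //; apply: (Ck_sub _ (nphi1 n)) => x [].
have h2 : Ck 1 [set x | B x /\ - n^-1 < phi x] (fun x => step (n * phi x) * Dv e V x).
  apply: (Ck_ext o1 _ (@Ck_cst _ _ 1 _ 0)) => x [Bx /= hx].
  have [-> _] : step (n * phi x) = 0 /\ step' (n * phi x) = 0; last by rewrite mul0r.
  by apply: step_hi; rewrite mulrC -ler_pdivrMr // mulN1r ltW.
apply: (Ck_sub _ (Ck_union h1 h2)) => x Bx.
have [px|px] := ltP (phi x) 0; first by left; split=> //; apply/phiD.
by right; split=> //; apply: lt_le_trans px; rewrite oppr_lt0 invr_gt0.
Qed.

Let F_Dv e n x : 0 < n -> Dv e (F e n) x =
  step (n * phi x) * (Dv e V x * Dv e t x) + step (n * phi x) * t x * Dv e (Dv e V) x +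
  n * step' (n * phi x) * Dv e phi x * Dv e V x * t x.
Proof.
move=> n0.
have FK y : ~ K y -> F e n y = 0 by rewrite /F => /tK ->; rewrite mulr0.
have [Kx|Kx] := pselect (K x); last first.
  by rewrite (Dv_off e cK FK Kx) (Dv_off e cK tK Kx) tK // !mulr0 !mul0r !addr0.
have Bx := KB Kx.
have [Dx|Dx] := pselect (D x); last first.
  have px : 0 <= phi x by rewrite leNgt; apply/negP => /(phiD Bx).
  have [s0 s0'] : step (n * phi x) = 0 /\ step' (n * phi x) = 0.
    apply: step_hi; apply: (@le_trans _ _ 0); first by rewrite oppr_le0.
    by rewrite mulr_ge0 // ltW.
  rewrite s0 s0' !mulr0 !mul0r !addr0.
  rewrite (@Dv_near _ _ _ _ (fun=> 0)) ?Dv_cst //.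
  have o1 : open [set x | B x /\ - n^-1 < phi x].
    by apply: open_gt_on => // y By; exact: (Ck_cont phi1).
  have x1 : [set x | B x /\ - n^-1 < phi x] x.
    by split=> //; apply: lt_le_trans px; rewrite oppr_lt0 invr_gt0.
  apply: (near_open o1 x1) => y [By hy]; rewrite /F.
  have [-> _] : step (n * phi y) = 0 /\ step' (n * phi y) = 0; last by rewrite !mul0r.
  by apply: step_hi; rewrite mulrC -ler_pdivrMr // mulN1r ltW.
have dp : dif phi x by exact: (Ck_dif phi1).
have dnp : dif (fun y => n * phi y) x by exact: difZ.
have ds := step_derive (n * phi x).
have dDV : dif (Dv e V) x by exact: (Ck_dif (Ck_Dv e V2)).
have dt : dif t x by exact: (Ck_dif t1).
have dsp := dif_comp (f := fun y => n * phi y) ds dnp.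
rewrite /F (DvM e (difM dsp dDV) dt) (DvM e dsp dDV).
have -> : Dv e (fun y => step (n * phi y)) x = step' (n * phi x) * Dv e (fun y => n * phi y) x.
  exact: (Dv_comp (f := fun y => n * phi y) e ds dnp).
by rewrite DvZ //; ring.
Qed.

Let F_Int e n : 0 < n -> Int m (Dv e (F e n)) = 0.
Proof.
move=> n0; apply: (Int_Dv m0 e Mm (F_Ck e n0)).
by apply: (csupp_sub KM) => x Kx; rewrite /F tK // mulr0.
Qed.

(** The points of K where the derivative is at least ep in absolute value form a compact set,
    contained in D because the derivative vanishes outside D. The maximum of phi on this set is thus
    negative. *)
Let small_grad e (ep : R) : 0 < ep -> exists2 mu, 0 < mu &
  forall x, K x -> - mu < phi x -> `|Dv e V x| <= ep.
Proof.
move=> ep0; pose K' := K `&` [set x | ep <= `|Dv e V x|].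
have cK' : closed K'.
  apply: closedI => //; apply: (@closed_comp _ _ (fun x => `|Dv e V x|) [set y | ep <= y]).
    by move=> x _; apply: cvg_norm; exact: contDV.
  exact: closed_ge.
have kK' : compact K' by apply: (subclosed_compact cK' compK) => x [].
have [K0|/set0P K0] := eqVneq K' set0.
  exists 1 => // x Kx _; rewrite leNgt; apply/negP => h.
  suff : K' x by rewrite K0.
  by split=> //; exact: ltW.
have [|x0 + H] := @compact_EVT_max _ R phi K' K0 kK'.
  apply: continuous_in_subspaceT => y; rewrite inE => -[Ky _].
  by apply: (Ck_cont phi1); exact: KB.
rewrite inE => -[Kx0 /= hx0].
have p0 : phi x0 < 0.
  apply/(phiD (KB Kx0)); apply: contrapT => nD.
  by move: hx0; rewrite DV0 // normr0 leNgt ep0.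
exists (- phi x0); first by rewrite oppr_gt0.
move=> x Kx; rewrite opprK => hx; rewrite leNgt; apply/negP => h.
have : phi x <= phi x0 by apply: H; rewrite inE; split=> //; exact: ltW.
by rewrite leNgt hx.
Qed.

Let G x := Dv (@e1 R) V x * Dv (@e1 R) t x + Dv (@e2 R) V x * Dv (@e2 R) t x +
  Dv (@e3 R) V x * Dv (@e3 R) t x.
Let Q x : R := \1_D x * (t x * (c - k ^+ 2 * V x)).
Let H n x := Dv (@e1 R) (F (@e1 R) n) x + Dv (@e2 R) (F (@e2 R) n) x + Dv (@e3 R) (F (@e3 R) n) x.

Let bG : bdd m G.
Proof.
have b e : bdd m (fun x => Dv e V x * Dv e t x) by apply: bddM; apply: bdd_cont.
by apply: bddD; [apply: bddD|].
Qed.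

Let bQ : bdd m Q.
Proof.
apply: bddM; first exact: bdd_indic.
apply: bddM; first exact: bdd_cont.
apply: bddB; first exact: bdd_cst.
by apply: bddM; [exact: bdd_cst | exact: bdd_cont].
Qed.

Let H_Int n : 0 < n -> bdd m (H n) /\ Int m (H n) = 0.
Proof.
move=> n0.
have b e : bdd m (Dv e (F e n)).
  by apply: bdd_cont => x; apply: (@Ck_cont _ _ 0 setT) => //; exact: (Ck_Dv e (F_Ck e n0)).
split; first by apply: bddD => //; exact: bddD.
by rewrite /H (IntD m0 (bddD (b _) (b _)) (b _)) (IntD m0 (b _) (b _)) !F_Int // !addr0.
Qed.

Let HE n x : 0 < n -> H n x = step (n * phi x) * G x + step (n * phi x) * t x * lapD V x +
  n * step' (n * phi x) * t x * (Dv (@e1 R) phi x * Dv (@e1 R) V x +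
    Dv (@e2 R) phi x * Dv (@e2 R) V x + Dv (@e3 R) phi x * Dv (@e3 R) V x).
Proof. by move=> n0; rewrite /H !F_Dv // /G /lapD; ring. Qed.

(** Green's identity. [H n] is the divergence of the fields [F], hence has integral 0, and it
    differs from G + Q only in the layer -2/n < phi < 0. There the gradient of V is at most ep, and
    n times the mass of the layer stays bounded by [layer_mass], so even the term with n step' is
    O(ep). *)
Let GQ : Int m G + Int m Q = 0.
Proof.
have [Cm Cm0 HCm] := layer_mass.
have contDp e x : K x -> {for x, continuous (Dv e phi)}.
  by move=> Kx; apply: (@Ck_cont _ _ 0 B); [exact: Ck_Dv | exact: KB].
have [C1 C10 HC1] := compact_bound3 compK (fun x _ => @contDt (@e1 R) x)
  (fun x _ => @contDt (@e2 R) x) (fun x _ => @contDt (@e3 R) x).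
have [C3 C30 HC3] := compact_bound3 compK (@contDp (@e1 R)) (@contDp (@e2 R)) (@contDp (@e3 R)).
have cV2 x : K x -> {for x, continuous (fun x => c - k ^+ 2 * V x)}.
  by move=> _; apply: cvgB; [exact: cvg_cst | apply: cvgM; [exact: cvg_cst | exact: contV]].
have [C2 C20 HC2] := compact_le_bound compK cV2.
suff main ep : 0 < ep -> `|Int m G + Int m Q| <= (24 * C1 + (5 * C2 + 60 * C3) * Cm) * ep.
  set Z := _ + _ in main *; set CC := _ + _ in main; apply/eqP; rewrite -normr_le0 leNgt.
  apply/negP => Z0.
  have CC0 : 0 <= CC by rewrite addr_ge0 ?mulr_ge0 // addr_ge0 ?mulr_ge0.
  have CC1 : 0 < CC + 1 by rewrite ltr_wpDl.
  have := main (`|Z| / (2 * (CC + 1))); rewrite divr_gt0 // ?mulr_gt0 // => /(_ isT).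
  rewrite mulrA ler_pdivlMr ?mulr_gt0 //; apply/negP; rewrite -ltNge.
  by rewrite mulrC ltr_pM2l //; lra.
move=> ep0.
have [u1 u10 U1] := small_grad (@e1 R) ep0.
have [u2 u20 U2] := small_grad (@e2 R) ep0.
have [u3 u30 U3] := small_grad (@e3 R) ep0.
(* This n puts the layer inside the three regions where the partial derivatives of V are at most ep,
   and makes 1/n at most ep. *)
pose n := ep^-1 + 2 / u1 + 2 / u2 + 2 / u3.
have i0 : 0 < ep^-1 by rewrite invr_gt0.
have i1 : 0 < 2 / u1 by rewrite divr_gt0.
have i2 : 0 < 2 / u2 by rewrite divr_gt0.
have i3 : 0 < 2 / u3 by rewrite divr_gt0.
have n0 : 0 < n by rewrite /n; lra.
have nep : 1 <= n * ep.
  by rewrite -ler_pdivrMr // mul1r /n; lra.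
have nu1 : 2 <= n * u1 by rewrite -ler_pdivrMr // /n; lra.
have nu2 : 2 <= n * u2 by rewrite -ler_pdivrMr // /n; lra.
have nu3 : 2 <= n * u3 by rewrite -ler_pdivrMr // /n; lra.
have [bH IH] := H_Int n0.
have -> : Int m G + Int m Q = Int m (fun x => G x + Q x - H n x).
  by rewrite (IntB m0 (bddD bG bQ) bH) (IntD m0 bG bQ) IH subr0.
pose C4 := (5 * C2 + 60 * C3) * ep.
have C40 : 0 <= C4 by rewrite mulr_ge0 ?(ltW ep0) // addr_ge0 // mulr_ge0.
apply: (@le_trans _ _ (Int m (fun x => 3 * C1 * ep + C4 * (zeta x * q n x)))); last first.
  rewrite (IntD m0); [|exact: bdd_cst|by apply: bddM; [exact: bdd_cst | exact: bdd_zq]].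
  rewrite Int_cst (IntZ m0); last exact: bdd_zq.
  have := ler_wpM2l C40 (HCm n n0); rewrite /C4; lra.
apply: (Int_le_norm m0).
- by apply: bddB => //; exact: bddD.
- by apply: bddD; [exact: bdd_cst | apply: bddM; [exact: bdd_cst | exact: bdd_zq]].
move=> x _.
have rhs0 : 0 <= 3 * C1 * ep + C4 * (zeta x * q n x).
  apply: addr_ge0; first by apply: mulr_ge0; [exact: mulr_ge0 | exact: ltW].
  by apply: mulr_ge0 => //; apply: mulr_ge0; [exact: zeta0 | exact: q_ge0].
have [Kx|Kx] := pselect (K x); last first.
  rewrite HE // /G /Q !(Dv_off _ cK tK Kx) tK //.
  by rewrite !(mulr0, mul0r, addr0, subr0) normr0.
have Bx := KB Kx.
have [Dx|Dx] := pselect (D x); last first.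
  have px : 0 <= phi x by rewrite leNgt; apply/negP => /(phiD Bx).
  have [s0 s0'] : step (n * phi x) = 0 /\ step' (n * phi x) = 0.
    apply: step_hi; apply: (@le_trans _ _ 0); first by rewrite oppr_le0.
    by rewrite mulr_ge0 // ltW.
  rewrite HE // s0 s0' /G /Q !DV0 // (indicF Dx).
  by rewrite !(mulr0, mul0r, addr0, subr0) normr0.
have px : phi x < 0 by apply/phiD.
rewrite /Q (indicT Dx) mul1r HE // (_ : lapD V x = c - k ^+ 2 * V x); last by rewrite -(V_eq Dx); ring.
set a := c - _ in HC2 *.
have [far|near] := leP (n * phi x) (-2).
  have [-> ->] := step_lo far.
  by rewrite !(mulr0, mul0r, mul1r, addr0) subrr normr0.
have phin u : 2 <= n * u -> - u < phi x.
  move=> h; rewrite -(ltr_pM2l n0) mulrN; apply: le_lt_trans near.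
  by rewrite lerNl opprK.
have g1 := U1 x Kx (phin _ nu1); have g2 := U2 x Kx (phin _ nu2); have g3 := U3 x Kx (phin _ nu3).
have [d1 d2 d3] := HC1 x Kx; have [p1 p2 p3] := HC3 x Kx; have ha : `|a| <= C2 := HC2 x Kx.
have np0 : n * phi x <= 0 by rewrite pmulr_rle0 // ltW.
have [s01 s4] : 0 <= step (n * phi x) <= 1 /\ `|step' (n * phi x)| <= 4.
  have [h|h] := leP (n * phi x) (-1); first by apply: step_mid; rewrite (ltW near).
  by have [-> ->] := step_hi (ltW h); rewrite normr0 lexx ler01.
(* In the layer |n phi| <= 2, and 5 = 1 + 2^2. The factor n coming from the derivative of the step
   is thus paid for by the density q, whose integral against [zeta] is bounded independently of
   n. *)
have q5 : n <= 5 * q n x.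
  rewrite /q mulrA ler_pdivlMr // mulrC ler_wpM2r ?(ltW n0) //.
  have : (n * phi x) ^+ 2 <= 2 ^+ 2 by rewrite -[_ ^+ 2]sqrrN lerXn2r ?nnegrE ?oppr_ge0 //; lra.
  by lra.
have sm3 (a1 a2 a3 b1 b2 b3 p r : R) : `|a1| <= p -> `|a2| <= p -> `|a3| <= p ->
   `|b1| <= r -> `|b2| <= r -> `|b3| <= r -> `|a1 * b1 + a2 * b2 + a3 * b3| <= 3 * (p * r).
  move=> *; rewrite (_ : 3 * _ = p * r + p * r + p * r); last by ring.
  rewrite (le_trans (ler_normD _ _)) // lerD // ?normrM ?ler_pM //.
  by rewrite (le_trans (ler_normD _ _)) // lerD // normrM ler_pM.
have gG : `|G x| <= 3 * (ep * C1) by exact: sm3.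
have gS : `|Dv (@e1 R) phi x * Dv (@e1 R) V x + Dv (@e2 R) phi x * Dv (@e2 R) V x + Dv (@e3 R) phi x * Dv (@e3 R) V x| <= 3 * (C3 * ep) by exact: sm3.
set S := _ + _ + _ in gS.
move: (step (n * phi x)) (step' (n * phi x)) s01 s4 => s s' s01 s4.
rewrite (_ : _ - _ = (1 - s) * G x + (1 - s) * (t x * a) - n * s' * t x * S); last by rewrite /S; ring.
have /andP[s0 s1] := s01.
have os : `|1 - s| <= 1 by rewrite ger0_norm; lra.
have T1 : `|(1 - s) * G x| <= 3 * C1 * ep.
  by rewrite normrM -[leRHS]mul1r ler_pM // (le_trans gG) //; lra.
have zq : zeta x <= ep * 5 * (zeta x * q n x).
  have : n * zeta x * ep <= 5 * q n x * zeta x * ep.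
    by rewrite ler_wpM2r ?(ltW ep0) // ler_wpM2r.
  have : zeta x * 1 <= zeta x * (n * ep) by rewrite ler_wpM2l.
  lra.
have T2 : `|(1 - s) * (t x * a)| <= 5 * C2 * ep * (zeta x * q n x).
  rewrite normrM -[leRHS]mul1r ler_pM // normrM.
  apply: (@le_trans _ _ (zeta x * C2)); first by rewrite ler_pM.
  have := ler_wpM2r C20 zq; lra.
have T3 : `|n * s' * t x * S| <= 60 * C3 * ep * (zeta x * q n x).
  rewrite !normrM (gtr0_norm n0).
  apply: (@le_trans _ _ (n * 4 * zeta x * (3 * (C3 * ep)))).
    have n0' := ltW n0.
    have h1 : n * `|s'| <= n * 4 by rewrite ler_wpM2l.
    have h2 : n * `|s'| * `|t x| <= n * 4 * zeta x by apply: ler_pM => //; first exact: mulr_ge0.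
    by apply: ler_pM => //; apply: mulr_ge0 => //; exact: mulr_ge0.
  have h : 0 <= zeta x * (12 * (C3 * ep)) by rewrite !mulr_ge0 // ltW.
  have := ler_wpM2r h q5; lra.
rewrite (le_trans (ler_normB _ _)) // (le_trans (lerD (ler_normD _ _) (lexx _))) //.
rewrite /C4; lra.
Qed.

(** One derivative of each second derivative of t is moved onto V, which is C^1 on the whole space;
    moving the other one, across the boundary of D, is the content of [GQ]. *)
Lemma weak_identity : Int m (fun x => V x * (lapD t x + k ^+ 2 * t x)) = c * Int m (fun x => \1_D x * t x).
Proof.
have bD e : bdd m (fun x => V x * Dv e (Dv e t) x).
  apply: bddM; first exact: bdd_cont.
  by apply: bdd_cont => x; apply: (@Ck_cont _ _ 0 setT) => //; apply: Ck_Dv; exact: Ck_Dv.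
have bD' e : bdd m (fun x => Dv e V x * Dv e t x) by apply: bddM; apply: bdd_cont.
have IP e : Int m (fun x => V x * Dv e (Dv e t) x) = - Int m (fun x => Dv e V x * Dv e t x).
  apply/eqP; rewrite -addr_eq0 -(IntD m0) //; apply/eqP.
  have h1 : Ck 1 setT (fun x => V x * Dv e t x) by apply: CkM => //; [exact: openT | exact: Ck_Dv].
  rewrite -(Int_Dv m0 e Mm h1); last first.
    by apply: (csupp_sub KM) => x Kx; rewrite (Dv_off e cK tK Kx) mulr0.
  apply: (Int_ext m0) => x _; rewrite DvM; [by rewrite [Dv e t x * _]mulrC | exact: (Ck_dif V1) | ].
  exact: (Ck_dif (Ck_Dv e t2)).
have bVt : bdd m (fun x => V x * t x) by apply: bddM; exact: bdd_cont.
have bZ : bdd m (fun x => k ^+ 2 * (V x * t x)) by apply: bddM => //; exact: bdd_cst.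
have bDt : bdd m (fun x => \1_D x * t x) by apply: bddM; [exact: bdd_indic | exact: bdd_cont].
have EQ : Int m Q = c * Int m (fun x => \1_D x * t x) - k ^+ 2 * Int m (fun x => V x * t x).
  rewrite -!(IntZ m0) // -(IntB m0) //; last by apply: bddM => //; exact: bdd_cst.
  apply: (Int_ext m0) => x _; rewrite /Q.
  have [Dx|Dx] := pselect (D x); first by rewrite (indicT Dx); ring.
  by rewrite (indicF Dx) V0 //; ring.
have EG : Int m G = Int m (fun x => Dv (@e1 R) V x * Dv (@e1 R) t x) +
   Int m (fun x => Dv (@e2 R) V x * Dv (@e2 R) t x) + Int m (fun x => Dv (@e3 R) V x * Dv (@e3 R) t x).
  by rewrite /G (IntD m0) ?(IntD m0) //; exact: bddD.
rewrite (@Int_ext _ _ m0 _ (fun x => V x * Dv (@e1 R) (Dv (@e1 R) t) x + V x * Dv (@e2 R) (Dv (@e2 R) t) x +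
   V x * Dv (@e3 R) (Dv (@e3 R) t) x + k ^+ 2 * (V x * t x))); last first.
  by move=> x _; rewrite /lapD; ring.
rewrite !(IntD m0) ?(IntZ m0) ?IP //; try (by do 2?apply: bddD).
have := GQ; rewrite EQ EG; lra.
Qed.

End WeakIdentity.

(** * Radial functions and the kernel *)

Section SmoothOneVariable.
Context {R : realType}.
Implicit Types (t d : R) (f g h : R -> R) (A B : set R).

Lemma SC_sub n A B h : (forall t, B t -> A t) -> SC n A h -> SC n B h.
Proof.
move=> BA; elim: n h => [|n IH] h /=; first by move=> ch t /BA; exact: ch.
by move=> [h' [dh sh]]; exists h'; split; [move=> t /BA; exact: dh | exact: IH].
Qed.

Lemma SCS n B h : SC n.+1 B h -> SC n B h.
Proof. by apply: SC_le. Qed.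

Lemma SCD n B g h : SC n B g -> SC n B h -> SC n B (fun t => g t + h t).
Proof.
elim: n g h => [|n IH] g h /=; first by move=> cg ch t Bt; apply: cvgD; [exact: cg | exact: ch].
move=> [g' [dg sg]] [h' [dh sh]]; exists (fun t => g' t + h' t); split; last exact: IH.
by move=> t Bt; apply: (is_deriveD (dg t Bt) (dh t Bt)).
Qed.

Lemma is_deriveMt g h t (g' h' : R) : is_derive t 1 g g' -> is_derive t 1 h h' ->
  is_derive t 1 (fun s => g s * h s) (g t * h' + h t * g').
Proof. by move=> dg dh; exact: (is_deriveM dg dh). Qed.

Lemma is_deriveZt d h t (h' : R) : is_derive t 1 h h' -> is_derive t 1 (fun s => d * h s) (d * h').
Proof. by move=> dh; exact: (is_deriveZ d dh). Qed.

Lemma is_deriveDt g h t (g' h' : R) : is_derive t 1 g g' -> is_derive t 1 h h' ->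
  is_derive t 1 (fun s => g s + h s) (g' + h').
Proof. by move=> dg dh; exact: (is_deriveD dg dh). Qed.

Lemma is_deriveNt h t (h' : R) : is_derive t 1 h h' -> is_derive t 1 (fun s => - h s) (- h').
Proof. by move=> dh; exact: (is_deriveN dh). Qed.

Lemma SCM n B g h : SC n B g -> SC n B h -> SC n B (fun t => g t * h t).
Proof.
elim: n g h => [|n IH] g h; first by move=> cg ch t Bt; apply: cvgM; [exact: cg | exact: ch].
move=> hg hh; have [g' [dg sg]] := hg; have [h' [dh sh]] := hh.
exists (fun t => g t * h' t + h t * g' t); split.
  by move=> t Bt; apply: is_deriveMt; [exact: dg | exact: dh].
by apply: SCD; apply: IH => //; exact: SCS.
Qed.

Lemma is_derive_compt g h t (g' h' : R) : is_derive (h t) 1 g g' -> is_derive t 1 h h' ->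
  is_derive t 1 (fun s => g (h s)) (g' * h').
Proof. by move=> dg dh; exact: (is_derive1_comp dg dh). Qed.

Lemma SC_comp n A B g h : SC n B g -> SC n A h -> (forall t, A t -> B (h t)) ->
  SC n A (fun t => g (h t)).
Proof.
move=> + + AB; elim: n g => [|n IH] g.
  by move=> cg ch t At; apply: (continuous_comp (ch t At)); apply: cg; exact: AB.
move=> [g' [dg sg]] hh; have [h' [dh sh]] := hh.
exists (fun t => g' (h t) * h' t); split.
  by move=> t At; apply: is_derive_compt; [apply: dg; exact: AB | exact: dh].
by apply: SCM => //; apply: IH => //; exact: SCS.
Qed.

Lemma SC_id n B : SC n B (fun t => t).
Proof.
case: n => [|n]; first by move=> t _; exact: cvg_id.
by exists (fun=> 1); split=> [t _|]; [exact: is_derive_id | exact: SC_cst].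
Qed.

Lemma SC_shift n B d : SC n B (fun t => t + d).
Proof. by apply: SCD; [exact: SC_id | exact: SC_cst]. Qed.

Lemma is_derive_uniq h t d d' : is_derive t 1 h d -> is_derive t 1 h d' -> d = d'.
Proof. by move=> [_ <-] [_ <-]. Qed.

Lemma is_derive_const_near h t d c : (\forall s \near t, h s = c) -> is_derive t 1 h d -> d = 0.
Proof.
move=> hc dh; apply: (is_derive_uniq dh); exact: (is_derive_local (h := fun=> c)).
Qed.

End SmoothOneVariable.

(** * Derivatives of radial functions and of functions of one linear form *)

Section Radial.
Context {R : realType}.
Notation P := (R * R * R)%type.
Implicit Types (f g : P -> R) (x y z u v w : P) (F : R -> R).

(** The squared Euclidean norm, whereas the norm of the product space is the maximum norm: balls for
    |.| are cubes, and [norm_rho] relates the two. *)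
Definition rho z : R := dot3 z z.

Lemma dot3C u v : dot3 u v = dot3 v u.
Proof. by rewrite /dot3; ring. Qed.

Lemma dot3Dl u v w : dot3 (u + v) w = dot3 u w + dot3 v w.
Proof.
rewrite /dot3 -[(u + v).1.1]/(u.1.1 + v.1.1) -[(u + v).1.2]/(u.1.2 + v.1.2).
by rewrite -[(u + v).2]/(u.2 + v.2); ring.
Qed.

Lemma dot3Nl u w : dot3 (- u) w = - dot3 u w.
Proof.
rewrite /dot3 -[(- u).1.1]/(- u.1.1) -[(- u).1.2]/(- u.1.2).
by rewrite -[(- u).2]/(- u.2); ring.
Qed.

Lemma dot3Zl (a : R) u w : dot3 (a *: u) w = a * dot3 u w.
Proof.
rewrite /dot3 -[(a *: u).1.1]/(a * u.1.1) -[(a *: u).1.2]/(a * u.1.2).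
by rewrite -[(a *: u).2]/(a * u.2); ring.
Qed.

Lemma rho_ge0 z : 0 <= rho z.
Proof. by rewrite /rho /dot3 !addr_ge0 // -expr2 sqr_ge0. Qed.

Lemma norm_rho z : `|z| ^+ 2 <= rho z.
Proof.
rewrite /rho /dot3.
have h (a : R) : `|a| ^+ 2 = a * a by rewrite real_normK ?num_real // expr2.
have g1 := sqr_ge0 z.1.1; have g2 := sqr_ge0 z.1.2; have g3 := sqr_ge0 z.2.
rewrite !expr2 in g1 g2 g3.
rewrite norm3E; case: (leP _ `|z.2|) => _; first by rewrite h; lra.
by case: (leP `|z.1.1| `|z.1.2|) => _; rewrite h; lra.
Qed.

Lemma rho_gt0 z : z != 0 -> 0 < rho z.
Proof. by move=> z0; apply: lt_le_trans (norm_rho z); rewrite exprn_gt0 // normr_gt0. Qed.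

Lemma Cauchy3 u v : (dot3 u v) ^+ 2 <= rho u * rho v.
Proof.
move: u v => [[a b] c] [[d e] f]; rewrite /rho /dot3 /= -subr_ge0.
rewrite (_ : _ - _ = (a * e - b * d) ^+ 2 + (a * f - c * d) ^+ 2 + (b * f - c * e) ^+ 2); last by ring.
by rewrite !addr_ge0 // sqr_ge0.
Qed.

Lemma rho_dif z : dif rho z /\ forall v, Dv v rho z = 2 * dot3 v z.
Proof.
suff [d D] : dif rho z /\ forall v, Dv v rho z = dot3 (2 *: z) v.
  by split=> // v; rewrite D dot3Zl dot3C.
apply: dif3P => e e0; near=> h.
rewrite /rho dot3Dl !(dot3C _ (h + z)) !dot3Dl dot3Zl (dot3C z h).
rewrite (_ : _ - _ = dot3 h h); last by ring.
apply: (le_trans (dot3_le h h)); rewrite ler_wpM2r //.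
have : `|h| < e / 3 by near: h; apply: near0_norm; rewrite divr_gt0.
by lra.
Unshelve. all: by end_near. Qed.

Lemma Ck_dot3 n (c : P) (A : set P) : Ck n A (dot3 c).
Proof.
case: n => [|n]; first by move=> x _; exact: dot3_cont.
split=> [x _|v]; first by have [] := dif_dot3 c x.
rewrite (_ : Dv v _ = fun=> dot3 c v); first exact: Ck_cst.
by apply/funext => x; have [_ ->] := dif_dot3 c x.
Qed.

Lemma Ck_rho n (A : set P) : Ck n A rho.
Proof.
apply: (@Ck_sub _ _ n setT) => //.
have e v : (dot3 v : P -> R) = dot3 v by [].
apply: (@Ck_ext _ _ n setT (fun z => dot3 (@e1 R) z * dot3 (@e1 R) z +
   dot3 (@e2 R) z * dot3 (@e2 R) z + dot3 (@e3 R) z * dot3 (@e3 R) z)); first exact: openT.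
  by move=> z _; rewrite /rho /dot3 /= ; ring.
by apply: CkD; [exact: openT | apply: CkD; [exact: openT| |] |]; apply: CkM; try exact: openT;
  exact: Ck_dot3.
Qed.

Lemma rho_cont z : {for z, continuous rho}.
Proof. exact: (@Ck_cont _ _ 0 setT rho z (Ck_rho 0 setT)). Qed.

Lemma open_rho (B : set R) : open B -> open [set z | B (rho z)].
Proof.
by move=> oB; apply: (@open_comp _ _ rho B) => // z _; exact: rho_cont.
Qed.

Lemma Dv_radial F (F' : R) z v : is_derive (rho z) 1 F F' ->
  dif (fun y => F (rho y)) z /\ Dv v (fun y => F (rho y)) z = F' * (2 * dot3 v z).
Proof.
move=> dF; have [dr Dr] := rho_dif z.
by rewrite (Dv_comp v dF dr) Dr; split=> //; exact: (dif_comp dF dr).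
Qed.

Lemma Dv2_radial (B : set R) F F1 F2 z v w : open B ->
  (forall s, B s -> is_derive s 1 F (F1 s)) -> (forall s, B s -> is_derive s 1 F1 (F2 s)) ->
  B (rho z) -> dif (Dv w (fun y => F (rho y))) z /\
  Dv v (Dv w (fun y => F (rho y))) z =
    4 * F2 (rho z) * (dot3 v z * dot3 w z) + 2 * F1 (rho z) * dot3 v w.
Proof.
move=> oB d1 d2 Bz.
have N : \forall y \near z, F1 (rho y) * (2 * dot3 w y) = Dv w (fun y => F (rho y)) y.
  by apply: (near_open (open_rho oB) Bz) => y By; have [_ ->] := Dv_radial w (d1 _ By).
have [e1' E1] := Dv_radial v (d2 _ Bz).
have [dw Dw] := dif_dot3 w z.
have dw2 : dif (fun y => 2 * dot3 w y) z by exact: difZ.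
split; first by apply: (dif_near N); exact: difM.
have N' : \forall y \near z, Dv w (fun y => F (rho y)) y = F1 (rho y) * (2 * dot3 w y) by apply: filterS N.
by rewrite (Dv_near v N') DvM // E1 DvZ // Dw (dot3C w v); ring.
Qed.

Lemma Dv3_radial (B : set R) F F1 F2 F3 z u v w : open B ->
  (forall s, B s -> is_derive s 1 F (F1 s)) -> (forall s, B s -> is_derive s 1 F1 (F2 s)) ->
  (forall s, B s -> is_derive s 1 F2 (F3 s)) ->
  B (rho z) -> dif (Dv v (Dv w (fun y => F (rho y)))) z /\
  Dv u (Dv v (Dv w (fun y => F (rho y)))) z =
    8 * F3 (rho z) * (dot3 u z * dot3 v z * dot3 w z) +
    4 * F2 (rho z) * (dot3 u v * dot3 w z + dot3 u w * dot3 v z + dot3 v w * dot3 u z).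
Proof.
move=> oB d1 d2 d3 Bz.
have N : \forall y \near z, 4 * F2 (rho y) * (dot3 v y * dot3 w y) + 2 * F1 (rho y) * dot3 v w =
    Dv v (Dv w (fun y => F (rho y))) y.
  by apply: (near_open (open_rho oB) Bz) => y By; have [_ ->] := Dv2_radial v w oB d1 d2 By.
have [e3' E3] := Dv_radial u (d3 _ Bz).
have [e2' E2] := Dv_radial u (d2 _ Bz).
have [dw Dw] := dif_dot3 w z; have [dv Dv'] := dif_dot3 v z.
have a1 : dif (fun y => 4 * F2 (rho y)) z by exact: difZ.
have a2 : dif (fun y => dot3 v y * dot3 w y) z by exact: difM.
have a3 : dif (fun y => 2 * F1 (rho y)) z by exact: difZ.
have a4 : dif (fun y : P => dot3 v w) z by exact: dif_cst.
have b1 := difM a1 a2; have b2 := difM a3 a4.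
split; first by apply: (dif_near N); exact: (difD b1 b2).
have N' : \forall y \near z, Dv v (Dv w (fun y => F (rho y))) y =
  4 * F2 (rho y) * (dot3 v y * dot3 w y) + 2 * F1 (rho y) * dot3 v w by apply: filterS N.
rewrite (Dv_near u N') (DvD u b1 b2) (DvM u a1 a2) (DvM u a3 a4) (DvZ u 4 e3') E3.
rewrite (DvZ u 2 e2') E2 (DvM u dv dw) Dw Dv' Dv_cst (dot3C w u) (dot3C v u); ring.
Qed.

Lemma lapD_radial (B : set R) F F1 F2 z : open B ->
  (forall s, B s -> is_derive s 1 F (F1 s)) -> (forall s, B s -> is_derive s 1 F1 (F2 s)) ->
  B (rho z) -> lapD (fun y => F (rho y)) z = 4 * rho z * F2 (rho z) + 6 * F1 (rho z).
Proof.
move=> oB d1 d2 Bz; rewrite /lapD.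
have [_ ->] := Dv2_radial (@e1 R) (@e1 R) oB d1 d2 Bz.
have [_ ->] := Dv2_radial (@e2 R) (@e2 R) oB d1 d2 Bz.
have [_ ->] := Dv2_radial (@e3 R) (@e3 R) oB d1 d2 Bz.
by rewrite [in X in _ = 4 * X * _ + _]/rho /dot3 /=; ring.
Qed.

Lemma Dv_ridge F (F' : R) n (b : R) z v : is_derive (dot3 n z + b) 1 F F' ->
  dif (fun y => F (dot3 n y + b)) z /\ Dv v (fun y => F (dot3 n y + b)) z = F' * dot3 n v.
Proof.
move=> dF; have [dn Dn] := dif_dot3 n z.
have dc : dif (fun _ : P => b) z by exact: dif_cst.
have d1 : dif (fun y => dot3 n y + b) z by exact: (difD dn dc).
split; first exact: (dif_comp (f := fun y => dot3 n y + b) dF d1).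
rewrite (Dv_comp (f := fun y => dot3 n y + b) v dF d1) (DvD v dn dc).
by rewrite Dn Dv_cst addr0.
Qed.

Lemma open_ridge (B : set R) n b : open B -> open [set z | B (dot3 n z + b)].
Proof.
move=> oB; apply: (@open_comp _ _ (fun z => dot3 n z + b) B) => // z _.
by apply: cvgD; [exact: dot3_cont | exact: cvg_cst].
Qed.

Lemma Dv2_ridge (B : set R) F F1 F2 n b z v w : open B ->
  (forall s, B s -> is_derive s 1 F (F1 s)) -> (forall s, B s -> is_derive s 1 F1 (F2 s)) ->
  B (dot3 n z + b) -> dif (Dv w (fun y => F (dot3 n y + b))) z /\
  Dv v (Dv w (fun y => F (dot3 n y + b))) z = F2 (dot3 n z + b) * (dot3 n v * dot3 n w).
Proof.
move=> oB d1 d2 Bz.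
have N : \forall y \near z, F1 (dot3 n y + b) * dot3 n w = Dv w (fun y => F (dot3 n y + b)) y.
  by apply: (near_open (@open_ridge B n b oB) Bz) => y By; have [_ ->] := Dv_ridge w (d1 _ By).
have [e1' E1] := Dv_ridge v (d2 _ Bz).
have a4 : dif (fun y : P => dot3 n w) z by exact: dif_cst.
split; first by apply: (dif_near N); exact: difM.
have N' : \forall y \near z, Dv w (fun y => F (dot3 n y + b)) y = F1 (dot3 n y + b) * dot3 n w by apply: filterS N.
by rewrite (Dv_near v N') DvM // E1 Dv_cst; ring.
Qed.

Lemma lapD_ridge (B : set R) F F1 F2 n b z : open B ->
  (forall s, B s -> is_derive s 1 F (F1 s)) -> (forall s, B s -> is_derive s 1 F1 (F2 s)) ->
  B (dot3 n z + b) -> lapD (fun y => F (dot3 n y + b)) z = rho n * F2 (dot3 n z + b).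
Proof.
move=> oB d1 d2 Bz; rewrite /lapD.
have [_ ->] := Dv2_ridge (@e1 R) (@e1 R) oB d1 d2 Bz.
have [_ ->] := Dv2_ridge (@e2 R) (@e2 R) oB d1 d2 Bz.
have [_ ->] := Dv2_ridge (@e3 R) (@e3 R) oB d1 d2 Bz.
by rewrite /rho; set F2z := F2 _; rewrite /dot3 /=; ring.
Qed.

Lemma lapD_refl f x y : Ck 2 setT f -> lapD (fun y => f (x - y)) y = lapD f (x - y).
Proof.
move=> hf; have df z : dif f z by exact: (Ck_dif hf).
have E v : Dv v (Dv v (fun y => f (x - y))) y = Dv v (Dv v f) (x - y).
  rewrite (_ : Dv v (fun y => f (x - y)) = fun y => - Dv v f (x - y)); last first.
    by apply/funext => z; have [_ ->] := dif_refl (df (x - z)).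
  have [d D] := dif_refl (Ck_dif (Ck_Dv v hf) (I : setT (x - y))).
  by rewrite DvN // D opprK.
by rewrite /lapD !E.
Qed.

Lemma SC_cos_sin n (B : set R) : SC n B (@cos R) /\ SC n B (@sin R).
Proof.
elim: n => [|n [IHc IHs]]; first by split=> t _; [exact: continuous_cos | exact: continuous_sin].
split; last by exists cos; split=> [t _|//]; exact: is_derive_sin.
exists (fun t => (-1) * sin t); split=> [t _|]; last exact: SCZ.
by rewrite mulN1r; exact: is_derive_cos.
Qed.

End Radial.

(** * The kernel cos (k r) / r and a smooth cutoff *)

Section Kernel.
Context {R : realType}.
Variable k : R.
Hypothesis k0 : 0 < k.
Implicit Types (s t e S : R) (j n : nat).

(* gam 0 rho = cos (k r) / r at rho = r^2; the other ones are its derivatives in rho,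
   obtained from the ODE 4 s g'' + 6 g' + k^2 g = 0, that is the Helmholtz equation for radial functions. *)
Fixpoint gam j s : R :=
  match j with
  | 0 => cos (k * Num.sqrt s) * isq 1 s
  | 1 => - (2^-1 * (k * sin (k * Num.sqrt s) * isq 2 s + cos (k * Num.sqrt s) * isq 3 s))
  | (j'.+1 as j1).+1 => - (4^-1 * (((6 + 4 * j'%:R) * gam j1 s + k ^+ 2 * gam j' s) * s^-1))
  end.

Lemma gam_rec j s : gam j.+2 s = - (4^-1 * (((6 + 4 * j%:R) * gam j.+1 s + k ^+ 2 * gam j s) * s^-1)).
Proof. by []. Qed.

(** Each differentiation of 4 s g'' + 6 g' + k^2 g = 0 adds 4 to the coefficient of the middle
    term. *)
Lemma gam_ode j s : 0 < s -> 4 * s * gam j.+2 s + (6 + 4 * j%:R) * gam j.+1 s + k ^+ 2 * gam j s = 0.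
Proof. by move=> s0; rewrite gam_rec; field; rewrite gt_eqF. Qed.

Lemma isqE n s : isq n s = (Num.sqrt s)^-1 ^+ n.
Proof. by []. Qed.

Lemma isqD n j s : isq n s * isq j s = isq (n + j) s.
Proof. by rewrite /isq exprD. Qed.

Lemma isq2 s : 0 < s -> isq 2 s = s^-1.
Proof. by move=> s0; rewrite /isq exprVn sqr_sqrtr // ltW. Qed.

Lemma isq_gt0 n s : 0 < s -> 0 < isq n s.
Proof. by move=> s0; rewrite /isq exprn_gt0 // invr_gt0 sqrtr_gt0. Qed.

Lemma isq_le n s t : 0 < s -> s <= t -> isq n t <= isq n s.
Proof.
move=> s0 st; have t0 := lt_le_trans s0 st.
by rewrite /isq lerXn2r ?nnegrE ?invr_ge0 ?sqrtr_ge0 // lef_pV2 ?posrE ?sqrtr_gt0 // ler_wsqrtr.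
Qed.

(** Only the orders 0 and 1 require the trigonometric formulas. Beyond them, differentiating the
    recursion gives the recursion of the next order, by strong induction on j. *)
Lemma gam_derive j s : 0 < s -> is_derive s 1 (gam j) (gam j.+1 s).
Proof.
have dsq t : 0 < t -> is_derive t 1 (fun x : R => k * Num.sqrt x) (k * (2^-1 * isq 1 t)).
  move=> t0; have D := is_deriveZ k (is_derive1_sqrt t0).
  by apply: (is_derive_eq D); rewrite -[_ *: _]/(_ * _) /isq expr1 invfM.
have dcos t : 0 < t -> is_derive t 1 (fun x : R => cos (k * Num.sqrt x))
    (- sin (k * Num.sqrt t) * (k * (2^-1 * isq 1 t))).
  by move=> t0; apply: is_derive_compt (dsq t t0); exact: is_derive_cos.
have dsin t : 0 < t -> is_derive t 1 (fun x : R => sin (k * Num.sqrt x))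
    (cos (k * Num.sqrt t) * (k * (2^-1 * isq 1 t))).
  by move=> t0; apply: is_derive_compt (dsq t t0); exact: is_derive_sin.
have d0 t : 0 < t -> is_derive t 1 (gam 0) (gam 1 t).
  move=> t0; apply: (is_derive_eq (is_deriveMt (dcos t t0) (isq_derive 1 t0))).
  by rewrite /= /isq !exprS expr0; field; rewrite gt_eqF // sqrtr_gt0.
have d1 t : 0 < t -> is_derive t 1 (gam 1) (gam 2 t).
  move=> t0.
  have D1 := is_deriveMt (is_deriveZt k (dsin t t0)) (isq_derive 2 t0).
  have D2 := is_deriveMt (dcos t t0) (isq_derive 3 t0).
  have D3 := is_deriveNt (is_deriveZt 2^-1 (is_deriveDt D1 D2)).
  apply: (is_derive_eq D3); rewrite /=.
  rewrite -(isq2 t0) /isq !exprS expr0; field.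
  by rewrite gt_eqF // sqrtr_gt0.
elim: j {-2}j (leqnn j) s => [|N IH] j; first by rewrite leqn0 => /eqP -> s; exact: d0.
case: j => [|[|j]] jN s s0; [exact: d0 | exact: d1 |].
have D1 := IH j.+1 jN s s0; have D2 := IH j (ltnW jN) s s0.
have Di : is_derive s 1 (fun x : R => x^-1) (- s^-1 * s^-1).
  have D := @is_deriveV _ id s 1 1 (lt0r_neq0 s0) (is_derive_id _ _).
  by apply: (is_derive_eq D); rewrite -[_ *: _]/(_ * _) mulr1 -exprVn expr2 mulNr.
have D3 := is_deriveNt (is_deriveZt 4^-1 (is_deriveMt (is_deriveDt (is_deriveZt (6 + 4 * j%:R) D1)
   (is_deriveZt (k ^+ 2) D2)) Di)).
apply: (is_derive_eq D3).
rewrite [gam j.+3 s]gam_rec [gam j.+2 s]gam_rec -[j.+1%:R]natr1; field.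
by rewrite gt_eqF.
Qed.

Lemma SC_gam n j : SC n (fun s => 0 < s) (gam j).
Proof.
elim: n j => [|n IH] j; last by exists (gam j.+1); split=> // s; exact: gam_derive.
move=> s s0; have [dd _] := gam_derive j s0.
by apply: differentiable_continuous; apply/derivable1_diffP.
Qed.

Lemma isq_shift n s S : 0 < s -> s <= S -> isq n s <= Num.sqrt S * isq n.+1 s.
Proof.
move=> s0 sS; have h : 1 <= Num.sqrt S * (Num.sqrt s)^-1.
  by rewrite ler_pdivlMr ?sqrtr_gt0 // mul1r ler_wsqrtr.
rewrite [isq n.+1 s]/isq exprS mulrA -/(isq n s) ler_peMl //.
exact: (ltW (isq_gt0 _ s0)).
Qed.

(** The function [gam j] has the singularity |z|^(-2j-1). Less singular terms are brought to this
    power with factors sqrt S, which is why s is bounded above. *)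
Lemma gam_bound j S : exists2 C, 0 <= C & forall s, 0 < s -> s <= S -> `|gam j s| <= C * isq (j.*2.+1) s.
Proof.
have b0 : exists2 C, 0 <= C & forall s, 0 < s -> s <= S -> `|gam 0 s| <= C * isq 1 s.
  exists 1 => // s s0 sS; rewrite /= normrM (gtr0_norm (isq_gt0 _ s0)) ler_wpM2r ?(ltW (isq_gt0 _ s0)) //.
  by rewrite ler_norml cos_geN1 cos_le1.
have b1 : exists2 C, 0 <= C & forall s, 0 < s -> s <= S -> `|gam 1 s| <= C * isq 3 s.
  exists (2^-1 * (k * Num.sqrt S + 1)).
    by rewrite mulr_ge0 // addr_ge0 // mulr_ge0 ?sqrtr_ge0 // ltW.
  move=> s s0 sS; rewrite /= normrN normrM gtr0_norm ?invr_gt0 // -(mulrA 2^-1) ler_wpM2l ?invr_ge0 //.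
  have i2 := isq_gt0 2 s0; have i3 := isq_gt0 3 s0.
  rewrite mulrDl mul1r (le_trans (ler_normD _ _)) // lerD //.
    rewrite (normrM (k * _)) (normrM k) (gtr0_norm k0) (gtr0_norm i2) -!mulrA ler_wpM2l ?(ltW k0) //.
    apply: le_trans (isq_shift 2 s0 sS); by rewrite ler_piMl ?(ltW i2) // ler_norml sin_geN1 sin_le1.
  by rewrite normrM (gtr0_norm i3) ler_piMl ?(ltW i3) // ler_norml cos_geN1 cos_le1.
elim: j {-2}j (leqnn j) => [|N IH] j; first by rewrite leqn0 => /eqP ->.
case: j => [|[|j]] jN //.
have [C1 C10 H1] := IH j.+1 jN; have [C0 C00 H0] := IH j (ltnW jN).
exists ((6 + 4 * j%:R) * C1 + k ^+ 2 * (C0 * (Num.sqrt S * Num.sqrt S))).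
  by rewrite addr_ge0 // mulr_ge0 ?sqr_ge0 // ?addr_ge0 ?mulr_ge0 ?sqrtr_ge0.
move=> s s0 sS; rewrite gam_rec normrN normrM gtr0_norm ?invr_gt0 // normrM -(isq2 s0).
have i2 := isq_gt0 2 s0; rewrite (gtr0_norm i2).
set a := _ + k ^+ 2 * _.
have h : `|a| <= ((6 + 4 * j%:R) * C1 + k ^+ 2 * (C0 * (Num.sqrt S * Num.sqrt S))) * isq (j.*2.+3) s.
  rewrite mulrDl (le_trans (ler_normD _ _)) // lerD //.
    have j0 : 0 <= 6 + 4 * j%:R :> R by rewrite addr_ge0 // mulr_ge0.
    by rewrite normrM (ger0_norm j0) -(mulrA (6 + _)) ler_wpM2l //; exact: H1.
  rewrite normrM (ger0_norm (sqr_ge0 k)) -(mulrA (k ^+ 2)) ler_wpM2l ?sqr_ge0 //.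
  apply: (le_trans (H0 s s0 sS)); rewrite -mulrA ler_wpM2l //.
  apply: (le_trans (isq_shift _ s0 sS)); rewrite -mulrA ler_wpM2l ?sqrtr_ge0 //.
  exact: isq_shift.
have b : 0 <= `|a| * isq 2 s by rewrite mulr_ge0 // ltW.
apply: (@le_trans _ _ (`|a| * isq 2 s)); first by lra.
have -> : (j.+2).*2.+1 = (j.*2.+3 + 2)%N by rewrite !doubleS addn2.
by rewrite -(isqD (j.*2.+3) 2) [leRHS]mulrA; apply: ler_wpM2r => //; exact: ltW.
Qed.

(** A lower bound for cos (k r) when k r <= 1/2. The condition 20 k^2 a <= 1 ensures k r <= 1/2 for
    r^2 <= 5 a, the largest value of |z|^2 + e when |z|^2 <= 4 a and e <= a. *)
Definition c0 : R := cos (2^-1).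

Lemma c0_gt0 : 0 < c0.
Proof.
apply: cos_gt0_pihalf; have := @pihalf_ge1 R.
by move=> h; apply/andP; split; lra.
Qed.

Lemma cos_ge_c0 (x : R) : `|x| <= 2^-1 -> c0 <= cos x.
Proof.
have h := @pihalf_ge1 R.
have hp : 2^-1 <= pi :> R by lra.
move=> x2; rewrite -cos_norm /c0 leNgt ltr_cos ?in_itv /= -?leNgt //.
  by apply/andP; split; lra.
by apply/andP; split=> //; lra.
Qed.

(** With q = sqrt s one has gam 2 s = (3 k q sin (k q) + (3 - (k q)^2) cos (k q)) / (4 q^5). The
    bound gives [psi] a sign, so that its mass controls its absolute integral, and it bounds this
    mass away from 0. *)
Lemma gam2_lower s : 0 < s -> 4 * k ^+ 2 * s <= 1 -> c0 / 2 * isq 5 s <= gam 2 s.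
Proof.
move=> s0 ks.
have sE : s = Num.sqrt s * Num.sqrt s by rewrite -expr2 sqr_sqrtr // ltW.
have q0 : 0 < Num.sqrt s by rewrite sqrtr_gt0.
set q := Num.sqrt s in sE q0 *.
have kq0 : 0 < k * q by rewrite mulr_gt0.
have kq : k * q <= 2^-1.
  rewrite leNgt; apply/negP => h.
  have : 2^-1 * 2^-1 < (k * q) * (k * q) by rewrite ltr_pM.
  rewrite (_ : _ * _ = k ^+ 2 * s); last by rewrite sE; ring.
  by lra.
have cc : c0 <= cos (k * q) by apply: cos_ge_c0; rewrite gtr0_norm.
have ss : 0 <= sin (k * q).
  apply: sin_ge0_pi; have := @pihalf_ge1 R => h; apply/andP; split; lra.
have -> : gam 2 s = 4^-1 * (3 * (k * q) * sin (k * q) + (3 - (k * q) ^+ 2) * cos (k * q)) * isq 5 s.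
  rewrite /= -(isq2 s0) /isq -/q !exprS expr0; field.
  by rewrite gt_eqF.
rewrite ler_wpM2r ?(ltW (isq_gt0 _ s0)) //.
have h1 : (k * q) ^+ 2 <= 1 by nra.
have h2 : 0 <= k * q * sin (k * q) by rewrite mulr_ge0 // ltW.
have := c0_gt0; nra.
Qed.

Variable a : R.
Hypothesis a0 : 0 < a.

(** With x_+ for the positive part this is (1 - ((s - a) / (3 a))_+^6)_+^6, of class C^5; as a
    function of s = |z|^2 it cuts off between the radii sqrt a and 2 sqrt a. *)
Definition chi s : R := ppf 5 (1 - ppf 5 ((3 * a)^-1 * (s - a))).

Lemma SC_chi (B : set R) : SC 5 B chi.
Proof.
apply: (SC_comp (B := setT)) => //; first exact: SC_ppf.
apply: SCD; first exact: SC_cst.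
apply: (SC_sub (A := setT)) => //.
rewrite (_ : (fun t => - ppf 5 _) = fun t => (-1) * ppf 5 ((3 * a)^-1 * (t - a))); last first.
  by apply/funext => t; rewrite mulN1r.
apply: SCZ; apply: (SC_comp (B := setT)) => //; first exact: SC_ppf.
by apply: SCZ; exact: SC_shift.
Qed.

Lemma chi_in s : s <= a -> chi s = 1.
Proof.
move=> sa; rewrite /chi (ppf_le0 5 (t := _ * _)) ?subr0 ?ppf_gt0 ?expr1n //.
by rewrite mulr_ge0_le0 ?invr_ge0 ?mulr_ge0 ?subr_le0 // ltW.
Qed.

Lemma chi_out s : 4 * a <= s -> chi s = 0.
Proof.
move=> sa; have h : 1 <= (3 * a)^-1 * (s - a).
  by rewrite mulrC ler_pdivlMr ?mulr_gt0 // mul1r; lra.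
by rewrite /chi ppf_le0 // subr_le0 ppf_gt0 ?exprn_ege1 // (le_trans _ h).
Qed.

Lemma chi01 s : 0 <= chi s <= 1.
Proof.
rewrite /chi ppf_ge0 /=; set x := 1 - _.
have x1 : x <= 1 by rewrite /x lerBlDr lerDl ppf_ge0.
have [x0|x0] := leP 0 x; last by rewrite ppf_le0 // ltW.
by rewrite ppf_gt0 // exprn_ile1.
Qed.

End Kernel.

(** * Representation formula *)

(** An interface that hides the formula of [chi]: X1, X2, X3 are the successive derivatives of the
    cutoff X0. The C^3 regularity of X2 is what makes the remainder [kap] of class C^3. *)
Record cutoff (R : realType) (a : R) (X0 X1 X2 X3 : R -> R) : Prop := Cutoff {
  cutoff_d0 : forall t : R, is_derive t 1 X0 (X1 t);
  cutoff_d1 : forall t : R, is_derive t 1 X1 (X2 t);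
  cutoff_d2 : forall t : R, is_derive t 1 X2 (X3 t);
  cutoff_smooth : SC 3 setT X2;
  cutoff_in : forall s, s <= a -> X0 s = 1;
  cutoff_out : forall s, 4 * a <= s -> X0 s = 0;
  cutoff_01 : forall s, 0 <= X0 s <= 1 }.

Lemma cutoff_exists (R : realType) (a : R) : 0 < a -> exists X0 X1 X2 X3, @cutoff R a X0 X1 X2 X3.
Proof.
move=> a0; have [X1 [d0 [X2 [d1 s2]]]] := @SC_chi R a setT.
have [X3 [d2 _]] := s2; exists (chi a), X1, X2, X3.
exact: (Cutoff (fun t => d0 t I) (fun t => d1 t I) (fun t => d2 t I) s2 (chi_in a0) (chi_out a0) (chi01 a)).
Qed.

Section Representation.
Context {R : realType}.
Notation P := (R * R * R)%type.
Variables (k a m : R) (X0 X1 X2 X3 : R -> R).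
Hypotheses (k0 : 0 < k) (a0 : 0 < a) (m0 : 0 < m) (ka : 20 * k ^+ 2 * a <= 1).
Hypothesis HX : cutoff a X0 X1 X2 X3.
Let dX0 := cutoff_d0 HX.
Let dX1 := cutoff_d1 HX.
Let dX2 := cutoff_d2 HX.
Let SX2 := cutoff_smooth HX.
Let X0in := cutoff_in HX.
Let X0out := cutoff_out HX.
Let X001 := cutoff_01 HX.
Implicit Types (x y z v w : P) (e s t : R) (W g : P -> R).
#[local] Opaque gam isq.
Local Notation gam := (gam k).

Lemma near_lt s t : s < t -> \forall u \near s, u < t.
Proof. exact: lt_nbhsl. Qed.

Lemma near_gt s t : t < s -> \forall u \near s, t < u.
Proof. exact: lt_nbhsr. Qed.

Lemma X1in s : s < a -> X1 s = 0.
Proof.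
move=> sa; apply: (is_derive_const_near (c := 1) _ (dX0 s)).
by apply: filterS (near_lt sa) => u /ltW; exact: X0in.
Qed.

Lemma X1out s : 4 * a < s -> X1 s = 0.
Proof.
move=> sa; apply: (is_derive_const_near (c := 0) _ (dX0 s)).
by apply: filterS (near_gt sa) => u /ltW; exact: X0out.
Qed.

Lemma X2in s : s < a -> X2 s = 0.
Proof.
move=> sa; apply: (is_derive_const_near (c := 0) _ (dX1 s)).
by apply: filterS (near_lt sa) => u; exact: X1in.
Qed.

Lemma X2out s : 4 * a < s -> X2 s = 0.
Proof.
move=> sa; apply: (is_derive_const_near (c := 0) _ (dX1 s)).
by apply: filterS (near_gt sa) => u; exact: X1out.
Qed.

Lemma SX1 : SC 4 setT X1. Proof. by exists X2; split. Qed.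
Lemma SX0 : SC 5 setT X0. Proof. by exists X1; split=> //; exact: SX1. Qed.

Lemma dgam j e s : 0 < s + e -> is_derive s 1 (fun s => gam j (s + e)) (gam j.+1 (s + e)).
Proof.
move=> se; have D : is_derive s 1 (fun u : R => u + e) (1 + 0).
  exact: (is_deriveDt (is_derive_id _ _) (is_derive_cst _ _ _)).
have C := is_derive_compt (g := gam j) (h := fun u : R => u + e) (gam_derive k j se) D.
by apply: (is_derive_eq C); rewrite addr0 mulr1.
Qed.

(** The truncated kernel as a function of s = |z|^2, regularised by e; [F1], [F2], [F3] are its
    derivatives, in the very form that the product rule produces. *)
Definition F0 e s := X0 s * gam 0 (s + e).
Definition F1 e s := X0 s * gam 1 (s + e) + gam 0 (s + e) * X1 s.
Definition F2 e s := (X0 s * gam 2 (s + e) + gam 1 (s + e) * X1 s) +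
  (gam 0 (s + e) * X2 s + X1 s * gam 1 (s + e)).
Definition F3 e s := (X0 s * gam 3 (s + e) + gam 2 (s + e) * X1 s + (gam 1 (s + e) * X2 s + X1 s * gam 2 (s + e))) +
  (gam 0 (s + e) * X3 s + X2 s * gam 1 (s + e) + (X1 s * gam 2 (s + e) + gam 1 (s + e) * X2 s)).

Lemma dF0 e s : 0 < s + e -> is_derive s 1 (F0 e) (F1 e s).
Proof. by move=> se; exact: (is_deriveMt (dX0 s) (dgam 0 se)). Qed.

Lemma dF1 e s : 0 < s + e -> is_derive s 1 (F1 e) (F2 e s).
Proof.
by move=> se; exact: (is_deriveDt (is_deriveMt (dX0 s) (dgam 1 se)) (is_deriveMt (dgam 0 se) (dX1 s))).
Qed.

Lemma dF2 e s : 0 < s + e -> is_derive s 1 (F2 e) (F3 e s).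
Proof.
move=> se; exact: (is_deriveDt
  (is_deriveDt (is_deriveMt (dX0 s) (dgam 2 se)) (is_deriveMt (dgam 1 se) (dX1 s)))
  (is_deriveDt (is_deriveMt (dgam 0 se) (dX2 s)) (is_deriveMt (dX1 s) (dgam 1 se)))).
Qed.

(* (Lap + k^2) (Gm e) = psi e + kap e: as e tends to 0, psi e tends to a multiple of the Dirac mass, and kap e,
   which comes from the cutoff, stays smooth. *)
Definition Gm e z := F0 e (rho z).
Definition psi e z := X0 (rho z) * (- (4 * e * gam 2 (rho z + e))).
Definition Ke e s := 8 * s * X1 s * gam 1 (s + e) + gam 0 (s + e) * (4 * s * X2 s + 6 * X1 s).
Definition kap e z := Ke e (rho z).

Lemma SC_gams n j e : SC n (fun s => 0 < s + e) (fun s => gam j (s + e)).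
Proof. by apply: (SC_comp (SC_gam k n j)) => //; exact: SC_shift. Qed.

Lemma open_ds e : open [set s | 0 < s + e].
Proof.
rewrite (_ : [set s | _] = [set s | - e < s]); first exact: open_gt.
by apply/seteqP; split=> s /=; rewrite -ltrBlDr sub0r.
Qed.

Lemma open_pos e : open [set z : P | 0 < rho z + e].
Proof. exact: (open_rho (@open_ds e)). Qed.

Lemma Gm_Ck e : Ck 5 [set z | 0 < rho z + e] (Gm e).
Proof.
apply: (Ck_comp (h := F0 e) (f := rho) (B := fun s => 0 < s + e) (@open_pos e)) => //; last exact: Ck_rho.
by apply: SCM; [apply: (SC_sub _ SX0) | exact: SC_gams].
Qed.

Lemma psi_Ck e : Ck 5 [set z | 0 < rho z + e] (psi e).
Proof.
apply: (Ck_comp (h := fun s => X0 s * - (4 * e * gam 2 (s + e))) (f := rho) (B := fun s => 0 < s + e) (@open_pos e)) => //; last exact: Ck_rho.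
apply: SCM; first by apply: (SC_sub _ SX0).
rewrite (_ : (fun t => - _) = fun t => (- (4 * e)) * gam 2 (t + e)); last by apply/funext => t; rewrite mulNr.
by apply: SCZ; exact: SC_gams.
Qed.

Lemma kap_Ck_off e : Ck 3 [set z | 0 < rho z + e] (kap e).
Proof.
apply: (Ck_comp (h := Ke e) (f := rho) (B := fun s => 0 < s + e) (@open_pos e)) => //; last exact: Ck_rho.
have s1 : SC 3 (fun s => 0 < s + e) X1 by apply: (SC_sub _ (SCS SX1)).
have s2 : SC 3 (fun s => 0 < s + e) X2 by apply: (SC_sub _ SX2).
have si : SC 3 (fun s => 0 < s + e) (fun s => s) by exact: SC_id.
apply: SCD; apply: SCM; try exact: SC_gams.
  by apply: SCM => //; exact: SCZ.
by apply: SCD; [apply: SCM => //; exact: SCZ | exact: SCZ].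
Qed.

Lemma kap_in e z : rho z < a -> kap e z = 0.
Proof. by move=> za; rewrite /kap /Ke X1in // X2in // !(mulr0, mul0r, addr0). Qed.

Lemma kap_out e z : 4 * a < rho z -> kap e z = 0.
Proof. by move=> za; rewrite /kap /Ke X1out // X2out // !(mulr0, mul0r, addr0). Qed.

(** Smoothness persists at e = 0 because X1 and X2 vanish for s < a, away from the singularity of
    the kernel. *)
Lemma kap_Ck e : 0 <= e -> Ck 3 setT (kap e).
Proof.
move=> e0; have o1 : open [set z : P | rho z < a] by exact: (open_rho (@open_lt R a)).
have h1 : Ck 3 [set z | rho z < a] (kap e).
  by apply: (Ck_ext o1 _ (@Ck_cst _ _ 3 _ 0)) => z za; rewrite kap_in.
apply: (Ck_sub _ (Ck_union h1 (kap_Ck_off e))) => z _.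
have [za|za] := ltP (rho z) a; [by left | right].
by rewrite /=; apply: ltr_wpDr => //; exact: lt_le_trans za.
Qed.

Lemma setT_pos e : 0 < e -> forall z, [set z | 0 < rho z + e] z.
Proof. by move=> e0 z; rewrite /= ltr_wpDl // rho_ge0. Qed.

Lemma Gm_Ck2 e : 0 < e -> Ck 2 setT (Gm e).
Proof.
move=> e0; have h : Ck 2 [set z | 0 < rho z + e] (Gm e) by apply: (Ck_le _ (Gm_Ck e)).
by apply: (Ck_sub _ h) => z _; exact: setT_pos.
Qed.

Lemma psi_cont e z : 0 < e -> {for z, continuous (psi e)}.
Proof. by move=> e0; apply: (Ck_cont (psi_Ck e)); exact: setT_pos. Qed.

Lemma kap_cont e z : 0 <= e -> {for z, continuous (kap e)}.
Proof. by move=> e0; apply: (Ck_cont (kap_Ck e0)). Qed.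

Lemma Gm_cont e z : 0 < e -> {for z, continuous (Gm e)}.
Proof. by move=> e0; apply: (Ck_cont (Gm_Ck2 e0)). Qed.

(** The radial Laplacian has the coefficient 4 s, while the profile solves its ODE at s + e. The
    discrepancy 4 e gam 2 is [psi], and the terms with derivatives of the cutoff make up [kap]. *)
Lemma helmholtz_Gm e z : 0 < e -> lapD (Gm e) z + k ^+ 2 * Gm e z = psi e z + kap e z.
Proof.
move=> e0; have se := setT_pos e0 z.
rewrite (lapD_radial (@open_ds e) (@dF0 e) (@dF1 e) se) /Gm /psi /kap /Ke /F0 /F1 /F2.
set s := rho z in se *.
have := gam_ode k 0 se; rewrite mulr0 addr0 => E.
have -> : X0 s * - (4 * e * gam 2 (s + e)) = X0 s * (4 * s * gam 2 (s + e) + 6 * gam 1 (s + e) + k ^+ 2 * gam 0 (s + e)).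
  by congr (_ * _); rewrite -[LHS]addr0 -E; ring.
ring.
Qed.

Lemma Gm_out e z : 4 * a <= rho z -> Gm e z = 0.
Proof. by move=> za; rewrite /Gm /F0 X0out // mul0r. Qed.

Lemma psi_out e z : 4 * a <= rho z -> psi e z = 0.
Proof. by move=> za; rewrite /psi X0out // mul0r. Qed.

Lemma psi_le0 e z : 0 < e -> e <= a -> psi e z <= 0.
Proof.
move=> e0 ea; have [za|za] := leP (4 * a) (rho z); first by rewrite psi_out.
have se : 0 < rho z + e by exact: setT_pos.
have k1 : 4 * k ^+ 2 * (rho z + e) <= 1.
  have h := sqr_ge0 k; have h1 : rho z + e <= 5 * a by lra.
  by move: ka (ler_wpM2l h h1); lra.
have g2 : 0 <= gam 2 (rho z + e).
  apply: le_trans (gam2_lower k0 se k1); rewrite mulr_ge0 //.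
    by rewrite divr_ge0 // ltW // c0_gt0.
  by rewrite ltW // isq_gt0.
have /andP[x0 _] := X001 (rho z).
by rewrite /psi mulrN oppr_le0 !mulr_ge0 // ltW.
Qed.

Lemma gam_lip j d : 0 < d -> exists2 L, 0 <= L & forall s e, d <= s -> s <= 4 * a -> 0 <= e -> e <= a ->
  `|gam j (s + e) - gam j s| <= L * e.
Proof.
move=> d0; have [C C0 HC] := gam_bound k0 j.+1 (5 * a).
exists (C * isq (j.+1).*2.+1 d); first by rewrite mulr_ge0 // ltW // isq_gt0.
move=> s e ds sa; rewrite le_eqVlt => /predU1P[<- _|e0 ea]; first by rewrite addr0 subrr normr0 mulr0.
have [|||c + E] := @MVT R (gam j) (gam j.+1) s (s + e).
- by rewrite ltrDl.
- by move=> t; rewrite in_itv /= => /andP[st _]; apply: gam_derive => //; lra.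
- apply: continuous_in_subspaceT => t; rewrite inE /= in_itv /= => /andP[st _].
  by apply: (SC_cont (SC_gam k 0 j)); lra.
rewrite in_itv /= => /andP[sc ce]; rewrite E addrC addKr normrM (gtr0_norm e0).
rewrite ler_wpM2r ?(ltW e0) //.
have c1 : 0 < c by lra.
have c2 : c <= 5 * a by lra.
apply: (le_trans (HC c c1 c2)); rewrite ler_wpM2l // isq_le //; lra.
Qed.

Lemma bound_on_interval (h : R -> R) : (forall t, {for t, continuous h}) ->
  exists2 B, 0 <= B & forall s, 0 <= s -> s <= 4 * a -> `|h s| <= B.
Proof.
move=> ch; have h4 : 0 <= 4 * a by rewrite mulr_ge0 // ltW.
have [||c _ H] := @EVT_max R (fun s => `|h s|) 0 (4 * a).
- exact: h4.
- by apply: continuous_in_subspaceT => t _; apply: cvg_norm; exact: ch.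
exists `|h c| => // s s0 s4; apply: H; by rewrite in_itv /= s0.
Qed.

Lemma X1_cont t : {for t, continuous X1}. Proof. exact: (SC_cont SX1). Qed.
Lemma X2_cont t : {for t, continuous X2}. Proof. exact: (SC_cont SX2). Qed.

Lemma kap_unif : exists2 L, 0 <= L & forall e z, 0 <= e -> e <= a -> `|kap e z - kap 0 z| <= L * e.
Proof.
have [L0 L00 H0] := gam_lip 0 a0; have [L1 L10 H1] := gam_lip 1 a0.
have [B1 B10 HB1] := bound_on_interval X1_cont.
have [B2 B20 HB2] := bound_on_interval X2_cont.
exists (32 * a * B1 * L1 + (16 * a * B2 + 6 * B1) * L0).
  have := ltW a0 => a0'.
  by apply: addr_ge0; apply: mulr_ge0 => //; [|apply: addr_ge0]; apply: mulr_ge0 => //; exact: mulr_ge0.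
move=> e z e0 ea.
have L_ge0 : 0 <= (32 * a * B1 * L1 + (16 * a * B2 + 6 * B1) * L0) * e.
  have := ltW a0 => a0'; apply: mulr_ge0 => //.
  by apply: addr_ge0; apply: mulr_ge0 => //; [|apply: addr_ge0]; apply: mulr_ge0 => //; exact: mulr_ge0.
have [za|za] := ltP (rho z) a; first by rewrite !kap_in // subrr normr0.
have [z4|z4] := ltP (4 * a) (rho z); first by rewrite !kap_out // subrr normr0.
rewrite /kap /Ke addr0; set s := rho z in za z4 *.
have s0 : 0 <= s by exact: rho_ge0.
have g0 := H0 s e za z4 e0 ea; have g1 := H1 s e za z4 e0 ea.
have b1 := HB1 s s0 z4; have b2 := HB2 s s0 z4.
rewrite (_ : _ - _ = 8 * s * X1 s * (gam 1 (s + e) - gam 1 s) + (4 * s * X2 s + 6 * X1 s) * (gam 0 (s + e) - gam 0 s)); last by ring.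
have h1 : `|8 * s * X1 s| <= 32 * a * B1.
  by rewrite normrM ler_pM // ger0_norm; [lra | rewrite mulr_ge0].
have h2 : `|4 * s * X2 s + 6 * X1 s| <= 16 * a * B2 + 6 * B1.
  rewrite (le_trans (ler_normD _ _)) // lerD // normrM ler_pM // ger0_norm; [lra|by rewrite mulr_ge0|lra|by []].
rewrite (le_trans (ler_normD _ _)) // [leRHS]mulrDl lerD //.
  by rewrite normrM -[leRHS]mulrA ler_pM.
by rewrite normrM -[leRHS]mulrA ler_pM.
Qed.

Lemma Gm_unif d : 0 < d -> exists2 L, 0 <= L & forall e z, 0 <= e -> e <= a -> d <= rho z ->
  `|Gm e z - Gm 0 z| <= L * e.
Proof.
move=> d0; have [L L0 H] := gam_lip 0 d0; exists L => // e z e0 ea dz.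
have [z4|z4] := leP (4 * a) (rho z); first by rewrite !Gm_out // subrr normr0 mulr_ge0.
rewrite /Gm /F0 addr0 -mulrBr normrM.
have /andP[x0 x1] := X001 (rho z); rewrite ger0_norm //.
apply: le_trans (H _ _ dz (ltW z4) e0 ea); by rewrite ler_piMl.
Qed.

Lemma psi_unif d : 0 < d -> exists2 L, 0 <= L & forall e z, 0 < e -> e <= a -> d <= rho z ->
  `|psi e z| <= L * e.
Proof.
move=> d0; have [C C0 HC] := gam_bound k0 2 (5 * a); exists (4 * (C * isq 5 d)).
  by rewrite !mulr_ge0 // ltW // isq_gt0.
move=> e z e0 ea dz.
have i0 := isq_gt0 5 d0.
have [z4|z4] := leP (4 * a) (rho z).
  by rewrite psi_out // normr0 !mulr_ge0 // ltW.
have /andP[x0 x1] := X001 (rho z).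
have p1 : 0 < rho z + e by lra.
have p2 : rho z + e <= 5 * a by lra.
have g : `|gam 2 (rho z + e)| <= C * isq 5 d.
  by apply: (le_trans (HC _ p1 p2)); rewrite ler_wpM2l // isq_le //; lra.
rewrite /psi normrM (ger0_norm x0) normrN -mulrA (normrM 4) (normrM e) (gtr0_norm e0) ger0_norm //.
rewrite -[leRHS]mul1r; apply: ler_pM => //; first by rewrite !mulr_ge0 // ltW.
by rewrite -mulrA ler_wpM2l // mulrC ler_wpM2r // ltW.
Qed.

Definition M0 := 2 * Num.sqrt a.

Lemma M0_rho z : M0 < `|z| -> 4 * a < rho z.
Proof.
move=> h; apply: lt_le_trans (norm_rho z).
have q0 : 0 <= Num.sqrt a by exact: sqrtr_ge0.
have E : a = Num.sqrt a * Num.sqrt a by rewrite -expr2 sqr_sqrtr // ltW.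
have h' : 2 * Num.sqrt a < `|z| by exact: h.
rewrite {1}E; set q := Num.sqrt a in q0 h' *; nra.
Qed.

Lemma csupp_kap e : csupp M0 (kap e).
Proof. by move=> z /M0_rho; exact: kap_out. Qed.

Lemma csupp_refl M f x : csupp M f -> csupp (`|x| + M) (fun y => f (x - y)).
Proof.
move=> sf y h; apply: sf; have : `|y| <= `|x - y| + `|x|.
  by rewrite distrC -{1}(subrK x y) ler_normD.
by lra.
Qed.

(** A smooth solution of the homogeneous equation on the whole space, equal to 1 at 0 and at least
    [c0] on the support of the kernel. It takes the place of the constant 1, which is not a
    solution. *)
Definition wave z := cos (k * (dot3 (@e1 R) z + 0)).

Lemma dwave0 s : is_derive s 1 (fun u : R => cos (k * u)) (- (k * sin (k * s))).
Proof.
have D : is_derive s 1 (fun u : R => k * u) (k * 1) by exact: (is_deriveZt k (is_derive_id s 1)).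
have C := is_derive_compt (g := cos) (h := fun u : R => k * u) (is_derive_cos (k * s)) D.
by apply: (is_derive_eq C); ring.
Qed.

Lemma dwave1 s : is_derive s 1 (fun u : R => - (k * sin (k * u))) (- (k ^+ 2 * cos (k * s))).
Proof.
have D : is_derive s 1 (fun u : R => k * u) (k * 1) by exact: (is_deriveZt k (is_derive_id s 1)).
have C := is_derive_compt (g := sin) (h := fun u : R => k * u) (is_derive_sin (k * s)) D.
by apply: (is_derive_eq (is_deriveNt (is_deriveZt k C))); ring.
Qed.

Lemma wave_Ck n : Ck n setT wave.
Proof.
have h : Ck n setT (fun z : P => k * (dot3 (@e1 R) z + 0)).
  apply: CkZ; first exact: openT.
  by apply: CkD; [exact: openT | exact: Ck_dot3 | exact: Ck_cst].
by apply: (Ck_comp (h := cos) (f := fun z : P => k * (dot3 (@e1 R) z + 0)) (B := setT) openT) => //; have [] := @SC_cos_sin R n setT.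
Qed.

Lemma wave_helmholtz z : lapD wave z + k ^+ 2 * wave z = 0.
Proof.
have E : lapD wave z = rho (@e1 R) * (- (k ^+ 2 * cos (k * (dot3 (@e1 R) z + 0)))).
  exact: (lapD_ridge (B := setT) (F := fun u => cos (k * u)) (F1 := fun u => - (k * sin (k * u)))
    (F2 := fun u => - (k ^+ 2 * cos (k * u))) (n := @e1 R) (b := 0) (z := z) openT
    (fun s _ => dwave0 s) (fun s _ => dwave1 s) I).
by rewrite E /wave /rho {1}/dot3 /=; ring.
Qed.

Lemma rho_cut x y : rho (x - y) <= 4 * a -> `|y| <= `|x| + M0.
Proof.
move=> h; have : `|x - y| <= M0 by rewrite leNgt; apply/negP => /M0_rho; rewrite ltNge h.
have : `|y| <= `|x - y| + `|x| by rewrite distrC -{1}(subrK x y) ler_normD.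
lra.
Qed.

Lemma gam0_bound e : 0 < e -> exists2 C, 0 <= C & forall z, rho z <= 4 * a -> `|gam 0 (rho z + e)| <= C.
Proof.
move=> e0; have [C C0 H] := gam_bound k0 0 (4 * a + e).
exists (C * isq 1 e); first by rewrite mulr_ge0 // ltW // isq_gt0.
move=> z za; have h1 : 0 < rho z + e by exact: setT_pos.
have h2 : rho z + e <= 4 * a + e by rewrite lerD2r.
have h3 : e <= rho z + e by rewrite lerDr rho_ge0.
by apply: (le_trans (H _ h1 h2)); rewrite ler_wpM2l // isq_le.
Qed.

(** The case of [weak_identity] with the test function Gm e (x - y), a multiple of the cutoff as
    majorant, and for K the Euclidean ball of radius 2 sqrt a about x: a boundary function is
    required around this ball only. *)
Lemma weak_identity_kernel (c m1 e : R) (D B : set P) (V phi : P -> R) w x :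
  `|x| + M0 < m -> 0 < e -> open D -> open B ->
  (forall y, rho (x - y) <= 4 * a -> B y) ->
  (forall y, ~ D y -> V y = 0) -> (forall y v, ~ D y -> Dv v V y = 0) ->
  Ck 1 setT V -> Ck 2 D V -> (forall y, D y -> lapD V y + k ^+ 2 * V y = c) ->
  Ck 1 B phi -> (forall y, B y -> (D y <-> phi y < 0)) -> 0 < m1 ->
  (forall y, rho (x - y) <= 4 * a -> m1 <= Dv w phi y) ->
  Int m (fun y => V y * (psi e (x - y) + kap e (x - y))) = c * Int m (fun y => \1_D y * Gm e (x - y)).
Proof.
move=> xm e0 oD oB KB V0 DV0 V1 V2 V_eq phi1 phiD m10 phiw.
have [C C0 HC] := gam0_bound e0.
have cl : closed [set y | rho (x - y) <= 4 * a].
  apply: (@closed_comp _ _ (fun y => rho (x - y)) [set s | s <= 4 * a]); last exact: closed_le.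
  by move=> y _; apply: cont_refl => z; exact: rho_cont.
have Xc : Ck 1 setT (fun z => C * X0 (rho z)).
  apply: CkZ; first exact: openT.
  apply: (Ck_comp (h := X0) (f := rho) (B := setT) openT) => //; last exact: Ck_rho.
  exact: (SC_le _ SX0).
have := @weak_identity R m (`|x| + M0) k c D B [set y | rho (x - y) <= 4 * a] V phi
  (fun y => C * X0 (rho (x - y))) (fun y => Gm e (x - y)) w m1 m0 xm oD oB cl KB _ V0 DV0 V1 V2
  V_eq phi1 phiD m10 phiw (Ck_refl_all x Xc) _ _ (Ck_refl_all x (Gm_Ck2 e0)) _.
move=> H; rewrite -H.
- apply: (Int_ext m0) => y _; rewrite lapD_refl; last exact: Gm_Ck2.
  by rewrite helmholtz_Gm.
- by move=> y /= /rho_cut.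
- move=> y /= /negP; rewrite -ltNge => h; rewrite X0out ?mulr0 //; exact: ltW.
- by move=> y; have /andP[h _] := X001 (rho (x - y)); rewrite mulr_ge0.
- move=> y; have /andP[h _] := X001 (rho (x - y)).
  have [far|near] := leP (4 * a) (rho (x - y)); first by rewrite Gm_out // normr0 mulr_ge0.
  rewrite /Gm /F0 normrM ger0_norm // mulrC ler_wpM2r //; apply: HC; exact: ltW.
Qed.

Lemma weak_identity_all (c e : R) (V : P -> R) x :
  `|x| + M0 < m -> 0 < e -> Ck 2 setT V -> (forall y, lapD V y + k ^+ 2 * V y = c) ->
  Int m (fun y => V y * (psi e (x - y) + kap e (x - y))) = c * Int m (fun y => Gm e (x - y)).
Proof.
move=> xm e0 V2 VE; have [df Df] := dif_dot3 (@e1 R) x.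
pose phi y : R := dot3 (@e1 R) y - (m + 1).
have phiC : Ck 1 setT phi by apply: CkB; [exact: openT | exact: Ck_dot3 | exact: Ck_cst].
have oB : open [set y | phi y < 0].
  apply: (@open_comp _ _ phi [set s | s < 0]); last exact: open_lt.
  by move=> y _; exact: (Ck_cont phiC).
have KB y : rho (x - y) <= 4 * a -> phi y < 0.
  move=> /rho_cut h; rewrite /phi subr_lt0.
  have [h1 _ _] := coord_le y; have := ler_norm y.1.1; rewrite /dot3 /=.
  by move: xm; lra.
have phiw y : rho (x - y) <= 4 * a -> 1 <= Dv (@e1 R) phi y.
  move=> _; have [d1 D1] := dif_dot3 (@e1 R) y; rewrite /phi.
  have dc : dif (fun _ : P => m + 1) y by exact: dif_cst.
  by rewrite (DvB _ d1 dc) D1 Dv_cst subr0 /dot3 /=; lra.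
have phiB : Ck 1 [set y | phi y < 0] phi by exact: (Ck_sub _ phiC).
have E := @weak_identity_kernel c 1 e setT [set y | phi y < 0] V phi (@e1 R) x xm e0 openT oB KB
  (fun y h => False_ind _ (h I)) (fun y v h => False_ind _ (h I)) (CkS V2) V2 (fun y _ => VE y)
  phiB (fun y h => conj (fun=> h) (fun=> I)) ltr01 phiw.
rewrite E; congr (_ * _); apply: (Int_ext m0) => y _; by rewrite indicT // mul1r.
Qed.

Let waveK x y := wave (x - y).

Lemma waveK_helmholtz x y : lapD (waveK x) y + k ^+ 2 * waveK x y = 0.
Proof. by rewrite /waveK lapD_refl ?wave_helmholtz //; exact: wave_Ck. Qed.

Lemma wave_identity x e : `|x| + M0 < m -> 0 < e ->
  Int m (fun y => wave (x - y) * (psi e (x - y) + kap e (x - y))) = 0.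
Proof.
move=> xm e0; rewrite -[RHS](mul0r (Int m (fun y => Gm e (x - y)))).
apply: (weak_identity_all (V := waveK x)) => //; last exact: waveK_helmholtz.
by apply: Ck_refl_all; exact: wave_Ck.
Qed.

Lemma wave_le1 z : `|wave z| <= 1.
Proof. exact: cos_max. Qed.

Lemma wave_ge z : rho z <= 4 * a -> c0 <= wave z.
Proof.
move=> za; apply: cos_ge_c0; rewrite addr0 normrM (gtr0_norm k0).
have -> : dot3 (@e1 R) z = z.1.1 by rewrite /dot3 /=; ring.
have [h1 _ _] := coord_le z; have h2 := norm_rho z.
have h3 : (k * `|z.1.1|) ^+ 2 <= 5^-1.
  have : `|z.1.1| ^+ 2 <= `|z| ^+ 2 by rewrite lerXn2r ?nnegrE.
  move=> h; have h4 : `|z.1.1| ^+ 2 <= 4 * a by lra.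
  have := ler_wpM2l (sqr_ge0 k) h4; rewrite exprMn; move: ka; lra.
rewrite leNgt; apply/negP => h.
have : 2^-1 * 2^-1 < (k * `|z.1.1|) * (k * `|z.1.1|) by rewrite ltr_pM.
rewrite -[X in _ < X]expr2; lra.
Qed.

(* The mass of the Dirac limit of psi e, read off by testing against a plane wave. *)
Definition C0 : R := - Int m (fun y => wave (0 - y) * kap 0 (0 - y)).

Let wk z := wave z * kap 0 z.

Let wk_Ck : Ck 3 setT wk.
Proof. by apply: CkM; [exact: openT | exact: wave_Ck | exact: kap_Ck]. Qed.

Let wk_supp : csupp M0 wk.
Proof. by move=> z h; rewrite /wk (csupp_kap 0 h) mulr0. Qed.

Lemma M0_ge0 : 0 <= M0. Proof. by rewrite mulr_ge0 // sqrtr_ge0. Qed.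

(** A translation does not preserve the grids. However, the derivative of the left side in x is the
    integral of a derivative of a function supported inside the cube, hence 0 along the segment from
    0 to x. *)
Lemma translation_invariance f x M : 0 <= M -> `|x| + M < m -> Ck 1 setT f -> csupp M f ->
  Int m (fun y => f (x - y)) = Int m (fun y => f (0 - y)).
Proof.
move=> M00 xm hf sf.
have b1 : bdd m (fun _ : P => 1 : R) by exact: bdd_cst.
have D z v : `|z| + M < m -> Dv v (fun z => Int m (fun y => 1 * f (z - y))) z = 0.
  move=> zm; have [_ ->] := Int_conv_dif m0 z b1 hf sf.
  have h := Int_Dv m0 v zm (Ck_refl_all z hf) (csupp_refl (x := z) sf).
  apply/eqP; rewrite -oppr_eq0 -(IntN m0); last first.
    apply: bddM => //; apply: bdd_cont; apply: cont_refl => y.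
    by apply: (@Ck_cont _ _ 0 setT) => //; exact: Ck_Dv.
  rewrite -[X in _ == X]h; apply/eqP; apply: (Int_ext m0) => y _.
  by have [_ ->] := dif_refl (Ck_dif hf (I : setT (z - y))); rewrite mul1r.
have dI z : dif (fun z => Int m (fun y => 1 * f (z - y))) z by have [] := Int_conv_dif m0 z b1 hf sf.
have [||t /andP[t0 t1] E] := @MVT_line _ _ (fun z => Int m (fun y => 1 * f (z - y))) 0 x.
- by move=> t _; exact: dI.
- by move=> t _; apply: dif_continuous; exact: dI.
have E1 z : Int m (fun y => f (z - y)) = Int m (fun y => 1 * f (z - y)).
  by apply: (Int_ext m0) => y _; rewrite mul1r.
rewrite !E1; apply/eqP; rewrite -subr_eq0; move: E; rewrite !add0r => ->.
rewrite D // normrZ (gtr0_norm t0); apply: le_lt_trans xm.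
by rewrite lerD2r ler_piMl // ltW.
Qed.

Lemma C0E x : `|x| + M0 < m -> C0 = - Int m (fun y => wave (x - y) * kap 0 (x - y)).
Proof.
move=> xm; have h1 : Ck 1 setT wk by exact: (Ck_le _ wk_Ck).
by rewrite /C0 -(translation_invariance M0_ge0 xm h1 wk_supp).
Qed.

Lemma bdd_psi x e : 0 < e -> bdd m (fun y => psi e (x - y)).
Proof. by move=> e0; apply: bdd_cont; apply: cont_refl => z; exact: psi_cont. Qed.

Lemma bdd_kap x e : 0 <= e -> bdd m (fun y => kap e (x - y)).
Proof. by move=> e0; apply: bdd_cont; apply: cont_refl => z; exact: kap_cont. Qed.

Lemma bdd_Gm x e : 0 < e -> bdd m (fun y => Gm e (x - y)).
Proof. by move=> e0; apply: bdd_cont; apply: cont_refl => z; exact: Gm_cont. Qed.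

Lemma bdd_wave x : bdd m (fun y => wave (x - y)).
Proof. by apply: bdd_cont; apply: cont_refl => z; exact: (Ck_cont (wave_Ck 0)). Qed.

Lemma bdd_gGm0 (g : P -> R) x d : bdd m g -> 0 < d -> (forall y, rho (x - y) < d -> g y = 0) ->
  bdd m (fun y => g y * Gm 0 (x - y)).
Proof.
move=> [Bg HB] d0 g0; have [C C0' HC] := gam_bound k0 0 (4 * a).
exists (Bg * (C * isq 1 d)) => y ym.
have i0 := isq_gt0 1 d0.
have Bg0 : 0 <= Bg by exact: le_trans (HB y ym).
have [near|far] := ltP (rho (x - y)) d; first by rewrite g0 // mul0r normr0 !mulr_ge0 // ltW.
rewrite normrM ler_pM //; first exact: HB.
have [out|ins] := leP (4 * a) (rho (x - y)); first by rewrite Gm_out // normr0 !mulr_ge0 // ltW.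
rewrite /Gm /F0 addr0 normrM; have /andP[h0 h1] := X001 (rho (x - y)); rewrite ger0_norm //.
have p0 : 0 < rho (x - y) by exact: lt_le_trans far.
apply: (@le_trans _ _ `|gam 0 (rho (x - y))|); first by rewrite ler_piMl.
by apply: (le_trans (HC _ p0 (ltW ins))); rewrite ler_wpM2l // isq_le.
Qed.

(** Testing against the plane wave turns the integral of - psi into that of [kap], which is bounded
    uniformly in e. This controls the mass because - psi >= 0 and the wave is at least [c0] on the
    support. *)
Lemma psi_mass x : `|x| + M0 < m -> exists2 C, 0 <= C & forall e, 0 < e -> e <= a ->
  Int m (fun y => - psi e (x - y)) <= C.
Proof.
move=> xm; have [L L0 HL] := kap_unif.
have [B HB] := bdd_kap x (lexx 0).
have B0 : 0 <= B by apply: le_trans (HB 0 _); rewrite ?normr0 // ltW.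
have c00 := @c0_gt0 R.
exists (c0^-1 * (8 * (B + L * a))).
  have La : 0 <= L * a by rewrite mulr_ge0 // ltW.
  by rewrite !mulr_ge0 ?invr_ge0 ?(ltW c00) // addr_ge0.
move=> e e0 ea; have e0' := ltW e0.
have bp := bdd_psi x e0; have bk := bdd_kap x e0'; have bw := bdd_wave x.
have b1 : bdd m (fun y => wave (x - y) * - psi e (x - y)) by apply: bddM => //; exact: bddN.
have b2 : bdd m (fun y => wave (x - y) * kap e (x - y)) by apply: bddM.
have E : Int m (fun y => wave (x - y) * - psi e (x - y)) = Int m (fun y => wave (x - y) * kap e (x - y)).
  apply/eqP; rewrite eq_sym -subr_eq0 -(IntB m0) // -[X in _ == X](wave_identity xm e0); apply/eqP.
  by apply: (Int_ext m0) => y _; ring.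
have h : Int m (fun y => c0 * - psi e (x - y)) <= Int m (fun y => wave (x - y) * - psi e (x - y)).
  apply: (Int_le m0) => //; first by apply: bddM; [exact: bdd_cst | exact: bddN].
  move=> y _; have [far|near] := leP (4 * a) (rho (x - y)); first by rewrite psi_out // oppr0 !mulr0.
  by rewrite ler_wpM2r ?oppr_ge0 ?psi_le0 // wave_ge // ltW.
rewrite (IntZ m0) in h; last exact: bddN.
rewrite mulrC ler_pdivlMr // mulrC (le_trans h) // E (le_trans (ler_norm _)) //.
apply: (Int_bound m0) => y ym; rewrite normrM -[leRHS]mul1r ler_pM ?wave_le1 //.
rewrite (_ : kap e (x - y) = (kap e (x - y) - kap 0 (x - y)) + kap 0 (x - y)); last by ring.
rewrite addrC (le_trans (ler_normD _ _)) // lerD ?HB //.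
by apply: (le_trans (HL e (x - y) e0' ea)); rewrite ler_wpM2l.
Qed.

(** Passage to the limit e -> 0: psi e (x - y) concentrates at y = x with mass [C0], kap e converges
    uniformly, and Gm e converges uniformly where g is nonzero, since g vanishes near x. *)
Lemma representation W g x d : `|x| + M0 < m -> bdd m W -> {for x, continuous W} -> bdd m g ->
  0 < d -> (forall y, rho (x - y) < d -> g y = 0) ->
  (forall e, 0 < e -> e <= a ->
    Int m (fun y => W y * (psi e (x - y) + kap e (x - y))) = Int m (fun y => g y * Gm e (x - y))) ->
  C0 * W x = Int m (fun y => g y * Gm 0 (x - y)) - Int m (fun y => W y * kap 0 (x - y)).
Proof.
move=> xm bW cW bg d0 g0 HWI.
have [Bm Bm0 Hm] := psi_mass xm.
have [Lk Lk0 HLk] := kap_unif.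
have [Lg Lg0 HLg] := Gm_unif d0.
have [BW HBW] := bW; have [Bg HBg] := bg.
have BW0 : 0 <= BW by apply: le_trans (HBW 0 _); rewrite ?normr0 // ltW.
have Bg0 : 0 <= Bg by apply: le_trans (HBg 0 _); rewrite ?normr0 // ltW.
(* The mass of [psi] is known against the wave, so the value W x is carried by W x * wave (x - y).
   The remainder h vanishes at x, and its integral against [psi] is small by [psi_mass] near x and
   by [psi_unif] elsewhere. *)
pose h y := W y - W x * wave (x - y).
have bw := bdd_wave x.
have bh : bdd m h by apply: bddB => //; apply: bddM => //; exact: bdd_cst.
have [Bh HBh] := bh.
have Bh0 : 0 <= Bh by apply: le_trans (HBh 0 _); rewrite ?normr0 // ltW.
have wave0 : wave 0 = 1.
  by rewrite /wave (_ : dot3 _ 0 = 0) ?addr0 ?mulr0 ?cos0 // /dot3 /=; ring.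
have hx : h x = 0 by rewrite /h subrr wave0 mulr1 subrr.
have ch : {for x, continuous h}.
  apply: cvgB; first exact: cW.
  by apply: cvgM; [exact: cvg_cst | apply: cont_refl => z; exact: (Ck_cont (wave_Ck 0))].
set Y := _ - _; set CC := Bm + 8 * Bh + 8 * `|W x| + 8 * BW + 8 * Bg.
suff main ep : 0 < ep -> `|C0 * W x - Y| <= CC * ep.
  apply/eqP; rewrite -subr_eq0 -normr_le0 leNgt; apply/negP => Z0.
  have CC0 : 0 <= CC by rewrite !addr_ge0 // mulr_ge0.
  have CC1 : 0 < CC + 1 by rewrite ltr_wpDl.
  have := main (`|C0 * W x - Y| / (2 * (CC + 1))); rewrite divr_gt0 // ?mulr_gt0 // => /(_ isT).
  rewrite mulrA ler_pdivlMr ?mulr_gt0 //; apply/negP; rewrite -ltNge.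
  by rewrite mulrC ltr_pM2l //; lra.
move=> ep0.
have [r r0 Hr] : exists2 r, 0 < r & forall y, `|x - y| < r -> `|h y| <= ep.
  have /cvgrPdist_le/(_ _ ep0)/nbhs_ballP[r /= r0 H] := ch; exists r => // y xy.
  have := H y; rewrite -ball_normE /= => /(_ xy); by rewrite hx sub0r normrN.
have r20 : 0 < r ^+ 2 by rewrite exprn_gt0.
have [Lp Lp0 HLp] := psi_unif r20.
pose e := Num.min a (ep / (1 + Lk + Lg + Lp)).
have LL0 : 0 < 1 + Lk + Lg + Lp by lra.
have e0 : 0 < e by rewrite lt_min a0 divr_gt0.
have e0' := ltW e0.
have ea : e <= a by rewrite ge_min lexx.
have eL : e * (1 + Lk + Lg + Lp) <= ep by rewrite -ler_pdivlMr // ge_min lexx orbT.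
have eLk : Lk * e <= ep by have : 0 <= Lg * e /\ 0 <= Lp * e by [split; exact: mulr_ge0]; lra.
have eLg : Lg * e <= ep by have : 0 <= Lk * e /\ 0 <= Lp * e by [split; exact: mulr_ge0]; lra.
have eLp : Lp * e <= ep by have : 0 <= Lg * e /\ 0 <= Lk * e by [split; exact: mulr_ge0]; lra.
have bp := bdd_psi x e0; have bk := bdd_kap x e0'; have bk0 := bdd_kap x (lexx 0).
have bG := bdd_Gm x e0; have bG0 := bdd_gGm0 bg d0 g0.
have bWp : bdd m (fun y => W y * psi e (x - y)) by exact: bddM.
have bWk : bdd m (fun y => W y * kap e (x - y)) by exact: bddM.
have bWk0 : bdd m (fun y => W y * kap 0 (x - y)) by exact: bddM.
have bgG : bdd m (fun y => g y * Gm e (x - y)) by exact: bddM.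
have bwp : bdd m (fun y => wave (x - y) * psi e (x - y)) by exact: bddM.
have bwk : bdd m (fun y => wave (x - y) * kap e (x - y)) by exact: bddM.
have bwk0 : bdd m (fun y => wave (x - y) * kap 0 (x - y)) by exact: bddM.
have bhp : bdd m (fun y => h y * psi e (x - y)) by exact: bddM.
pose A := Int m (fun y => wave (x - y) * psi e (x - y)).
have EA : C0 - A = Int m (fun y => wave (x - y) * kap e (x - y) - wave (x - y) * kap 0 (x - y)).
  rewrite (IntB m0) // (C0E xm); have := wave_identity xm e0.
  rewrite (@Int_ext _ _ m0 _ (fun y => wave (x - y) * psi e (x - y) + wave (x - y) * kap e (x - y))); last by move=> y _; rewrite mulrDr.
  by rewrite (IntD m0) // -/A => E; rewrite -[LHS]addr0 -E; ring.
have T1 : `|C0 - A| <= 8 * ep.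
  rewrite EA; apply: (Int_bound m0) => y _; rewrite -mulrBr normrM -[leRHS]mul1r ler_pM ?wave_le1 //.
  exact: le_trans (HLk e _ e0' ea) eLk.
have T2 : `|Int m (fun y => h y * psi e (x - y))| <= ep * Bm + 8 * (Bh * ep).
  apply: (@le_trans _ _ (Int m (fun y => ep * - psi e (x - y) + Bh * ep))).
    apply: (Int_le_norm m0) => //.
      by apply: bddD; [apply: bddM; [exact: bdd_cst | exact: bddN] | exact: bdd_cst].
    move=> y ym; have p0 := psi_le0 (x - y) e0 ea.
    have q1 : 0 <= ep * - psi e (x - y) by rewrite mulr_ge0 ?oppr_ge0 // ltW.
    have q2 : 0 <= Bh * ep by rewrite mulr_ge0 // ltW.
    rewrite normrM; have [near|far] := ltP (rho (x - y)) (r ^+ 2).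
      rewrite (ler0_norm p0); have : `|h y| <= ep.
        apply: Hr; rewrite -(ltr_pXn2r (n := 2)) ?nnegrE //; last exact: ltW.
        exact: le_lt_trans (norm_rho _) near.
      by move=> hy; apply: (@le_trans _ _ (ep * - psi e (x - y))); [rewrite ler_wpM2r // oppr_ge0 | rewrite lerDl].
    apply: (@le_trans _ _ (Bh * ep)); last by rewrite lerDr.
    by rewrite ler_pM ?HBh // (le_trans (HLp e _ e0 ea far)).
  rewrite (IntD m0); [|by apply: bddM; [exact: bdd_cst | exact: bddN]|exact: bdd_cst].
  rewrite Int_cst (IntZ m0); last exact: bddN.
  by rewrite lerD2r ler_wpM2l ?(ltW ep0) //; exact: Hm.
have T3 : `|Int m (fun y => W y * kap e (x - y)) - Int m (fun y => W y * kap 0 (x - y))| <= 8 * (BW * ep).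
  rewrite -(IntB m0) //; apply: (Int_bound m0) => y ym; rewrite -mulrBr normrM ler_pM ?HBW //.
  exact: le_trans (HLk e _ e0' ea) eLk.
have T4 : `|Int m (fun y => g y * Gm e (x - y)) - Int m (fun y => g y * Gm 0 (x - y))| <= 8 * (Bg * ep).
  rewrite -(IntB m0) //; apply: (Int_bound m0) => y ym; rewrite -mulrBr normrM.
  have [near|far] := ltP (rho (x - y)) d; first by rewrite g0 // normr0 mul0r mulr_ge0 // ltW.
  rewrite ler_pM ?HBg //; exact: le_trans (HLg e _ e0' ea far) eLg.
have EW : Int m (fun y => W y * psi e (x - y)) = W x * A + Int m (fun y => h y * psi e (x - y)).
  rewrite /A -(IntZ m0) // -(IntD m0) //; last by apply: bddM => //; exact: bdd_cst.
  by apply: (Int_ext m0) => y _; rewrite /h; ring.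
have HE := HWI e e0 ea.
rewrite (@Int_ext _ _ m0 _ (fun y => W y * psi e (x - y) + W y * kap e (x - y))) in HE; last by move=> y _; rewrite mulrDr.
rewrite (IntD m0) // EW in HE.
have T1' : `|(C0 - A) * W x| <= 8 * ep * `|W x| by rewrite normrM ler_wpM2r.
move: T1' T2 T3 T4 HE; rewrite /Y /CC.
move: (Int m _) (Int m _) (Int m _) (Int m _) (Int m _) => i1 i2 i3 i4 i5.
rewrite !ler_norml => /andP[? ?] /andP[? ?] /andP[? ?] /andP[? ?] HE.
by apply/andP; split; lra.
Qed.

Lemma isq5_sq (d : R) : 0 < d -> isq 5 (4 * (d * d)) = 32^-1 * (d ^+ 5)^-1.
Proof.
move=> d0; rewrite (_ : 4 * (d * d) = (2 * d) ^+ 2); last by ring.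
have -> : isq 5 ((2 * d) ^+ 2) = (2 * d)^-1 ^+ 5.
  by rewrite isqE sqrtr_sqr gtr0_norm // mulr_gt0.
by field; rewrite gt_eqF.
Qed.

(* On the cube [0,d]^3 with e = d^2 one has - psi e >= const d^-3, so the mass of psi e does not vanish. *)
Lemma C0_neq0 : M0 < m -> C0 != 0.
Proof.
move=> Mm; have c00 := @c0_gt0 R.
have xm : `|0 : P| + M0 < m by rewrite normr0 add0r.
have [L L0 HL] := kap_unif.
pose c1 := c0 * (c0 / 16 / m ^+ 3) : R.
have m30 : 0 < m ^+ 3 by rewrite exprn_gt0.
have c10 : 0 < c1 by rewrite mulr_gt0 // !divr_gt0.
have L1 : 0 < 8 * L + 1 by rewrite ltr_wpDl // mulr_ge0.
pose d := Num.min (Num.min (m / 2) 1) (Num.min (a / 3) (c1 / (8 * L + 1))).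
have d0 : 0 < d by rewrite !lt_min ltr01 !divr_gt0.
have dm : d <= m / 2 by rewrite /d !ge_min lexx.
have d1 : d <= 1 by rewrite /d !ge_min lexx !orbT.
have da : d <= a / 3 by rewrite /d !ge_min lexx !orbT.
have dL : d * (8 * L + 1) <= c1 by rewrite -ler_pdivlMr // /d !ge_min lexx !orbT.
have dd : d * d <= d by rewrite ler_piMl // ltW.
pose e := d * d.
have e0 : 0 < e by rewrite mulr_gt0.
have e0' := ltW e0.
have e3 : 3 * e <= a by rewrite /e; lra.
have ea : e <= a by lra.
have bp := bdd_psi 0 e0; have bk := bdd_kap 0 e0'; have bk0 := bdd_kap 0 (lexx 0).
have bw := bdd_wave 0.
have bwp : bdd m (fun y => wave (0 - y) * psi e (0 - y)) by exact: bddM.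
have bwk : bdd m (fun y => wave (0 - y) * kap e (0 - y)) by exact: bddM.
have bwk0 : bdd m (fun y => wave (0 - y) * kap 0 (0 - y)) by exact: bddM.
have bN : bdd m (fun y => c0 * - psi e (0 - y)) by apply: bddM; [exact: bdd_cst | exact: bddN].
pose A := Int m (fun y => wave (0 - y) * psi e (0 - y)).
have T1 : `|C0 - A| <= 8 * (L * e).
  have -> : C0 - A = Int m (fun y => wave (0 - y) * kap e (0 - y) - wave (0 - y) * kap 0 (0 - y)).
    rewrite (IntB m0) // (C0E xm); have := wave_identity xm e0.
    rewrite (@Int_ext _ _ m0 _ (fun y => wave (0 - y) * psi e (0 - y) + wave (0 - y) * kap e (0 - y))); last by move=> y _; rewrite mulrDr.
    by rewrite (IntD m0) // -/A => E; rewrite -[LHS]addr0 -E; ring.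
  apply: (Int_bound m0) => y _; rewrite -mulrBr normrM -[leRHS]mul1r ler_pM ?wave_le1 //.
  exact: HL.
have hA : Int m (fun y => c0 * - psi e (0 - y)) <= - A.
  rewrite /A -(IntN m0) //; apply: (Int_le m0) => //; first exact: bddN.
  move=> y _; have [far|near] := leP (4 * a) (rho (0 - y)); first by rewrite psi_out // oppr0 !mulr0 oppr0.
  by rewrite -[leRHS]mulrN ler_wpM2r ?oppr_ge0 ?psi_le0 // wave_ge // ltW.
have hc : c1 <= Int m (fun y => c0 * - psi e (0 - y)).
  have -> : c1 = c0 * (c0 / (16 * d ^+ 3)) * (d / m) ^+ 3.
    by rewrite /c1; field; rewrite !gt_eqF.
  apply: (Int_cube m0) => //.
  - by rewrite d0; lra.
  - by rewrite mulr_ge0 ?(ltW c00) // divr_ge0 ?(ltW c00) // mulr_ge0 // exprn_ge0 // ltW.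
  - by move=> y _; rewrite mulr_ge0 ?(ltW c00) // oppr_ge0 psi_le0.
  move=> p q r /andP[p0 pd] /andP[q0 qd] /andP[r0 rd]; rewrite ler_wpM2l ?(ltW c00) //.
  have E : rho (0 - (p, q, r)) = p * p + q * q + r * r.
    by rewrite sub0r /rho dot3Nl dot3C dot3Nl opprK.
  have h1 : p * p <= e by rewrite ler_pM.
  have h2 : q * q <= e by rewrite ler_pM.
  have h3 : r * r <= e by rewrite ler_pM.
  have g0 : 0 <= rho (0 - (p, q, r)) by exact: rho_ge0.
  rewrite /psi; set s := rho _ in E g0 *.
  have s3 : s <= 3 * e by lra.
  rewrite X0in; last by lra.
  rewrite mul1r opprK.
  have se0 : 0 < s + e by lra.
  have se4 : s + e <= 4 * (d * d) by rewrite -/e; lra.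
  have k1 : 4 * k ^+ 2 * (s + e) <= 1.
    have h5 : s + e <= 5 * a by lra.
    by move: ka (ler_wpM2l (sqr_ge0 k) h5); lra.
  have G := gam2_lower k0 se0 k1.
  have I5 := isq_le 5 se0 se4; rewrite isq5_sq // in I5.
  apply: (@le_trans _ _ (4 * e * (c0 / 2 * (32^-1 * (d ^+ 5)^-1)))).
    rewrite le_eqVlt; apply/orP; left; apply/eqP; rewrite /e; field.
    by rewrite gt_eqF.
  have e4 : 0 <= 4 * e by rewrite mulr_ge0.
  apply: ler_wpM2l => //; apply: le_trans G; apply: ler_wpM2l I5.
  by rewrite divr_ge0 // (ltW c00).
have eL : 8 * (L * e) < c1.
  have h : L * e <= L * d by rewrite ler_wpM2l.
  by lra.
have hAc := le_trans hc hA.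
have : C0 < 0.
  move: T1; rewrite ler_norml => /andP[_]; move: (C0) (A) (c1) (L * e) hAc eL => u1 u2 u3 u4.
  by lra.
by rewrite lt_neqAle => /andP[].
Qed.

End Representation.

(** * Estimates for the kernel near a plane *)

Section InverseRoot.
Context {R : realType}.
Implicit Types (s t S : R).

Lemma isq4E s : 0 < s -> isq 4 s = (s * s)^-1.
Proof. by move=> s0; rewrite -(isqD 2 2) !isq2 // -invfM. Qed.

Lemma isqS_sqrt n s : 0 < s -> isq n s = isq n.+1 s * Num.sqrt s.
Proof. by move=> s0; rewrite !isqE exprS mulrAC mulVf ?mul1r // gt_eqF // sqrtr_gt0. Qed.

Lemma isq4_half s : 0 < s -> isq 4 (s / 2) = 4 * isq 4 s.
Proof. by move=> s0; rewrite !isq4E ?divr_gt0 //; field; rewrite gt_eqF. Qed.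

Lemma isq_shiftn n p s S : 0 < s -> s <= S -> isq n s <= Num.sqrt S ^+ p * isq (n + p) s.
Proof.
move=> s0 sS; elim: p => [|p IH]; first by rewrite mul1r addn0.
apply: (le_trans IH); rewrite exprSr -mulrA addnS ler_wpM2l ?exprn_ge0 ?sqrtr_ge0 //.
exact: isq_shift.
Qed.

Lemma gam_bound_le (k : R) i j S : 0 < k -> (i <= j)%N -> exists2 C, 0 <= C &
  forall s, 0 < s -> s <= S -> `|gam k i s| <= C * isq (j.*2.+1) s.
Proof.
move=> k0 ij; have [C C0 H] := gam_bound k0 i S.
exists (C * Num.sqrt S ^+ (j.*2 - i.*2)); first by rewrite mulr_ge0 // exprn_ge0 // sqrtr_ge0.
move=> s s0 sS; apply: (le_trans (H s s0 sS)); rewrite -mulrA ler_wpM2l //.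
have := isq_shiftn i.*2.+1 (j.*2 - i.*2) s0 sS.
by rewrite addSn subnKC // leq_double.
Qed.

Lemma dot3_sqrt (v z : R * R * R) : rho v <= 1 -> `|dot3 v z| <= Num.sqrt (rho z).
Proof.
move=> v1; rewrite -sqrtr_sqr ler_wsqrtr //; apply: (le_trans (Cauchy3 v z)).
by rewrite ler_piMl // rho_ge0.
Qed.

Lemma dot3_le1 (v w : R * R * R) : rho v <= 1 -> rho w <= 1 -> `|dot3 v w| <= 1.
Proof.
by move=> v1 w1; apply: (le_trans (dot3_sqrt w v1)); rewrite -[leRHS]sqrtr1 ler_wsqrtr.
Qed.

Lemma rho_line (n z : R * R * R) (s : R) : rho n = 1 -> rho (s *: n - z) = s ^+ 2 - 2 * s * dot3 n z + rho z.
Proof.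
have -> : rho (s *: n - z) = s ^+ 2 * rho n - 2 * s * dot3 n z + rho z.
  rewrite {1}/rho dot3Dl dot3Nl dot3Zl !(dot3C _ (s *: n - z)) !dot3Dl !dot3Nl !dot3Zl.
  by rewrite (dot3C z n) /rho; ring.
by move=> ->; rewrite mulr1.
Qed.

End InverseRoot.

Section KernelBounds.
Context {R : realType}.
Notation P := (R * R * R)%type.
Variables (k a : R) (X0 X1 X2 X3 : R -> R).
Hypotheses (k0 : 0 < k) (a0 : 0 < a) (HX : cutoff a X0 X1 X2 X3).
Implicit Types (x y z v w u n p : P) (s t d : R).
#[local] Opaque gam isq.
Local Notation G := (Gm k X0 0).

Lemma X3_cont t : {for t, continuous X3}.
Proof.
have [X3' [d2 s3]] := cutoff_smooth HX.
have -> : X3 = X3'.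
  by apply/funext => s; exact: (is_derive_uniq (cutoff_d2 HX s) (d2 s I)).
exact: (SC_cont (n := 2) (B := setT) (h := X3') s3 I).
Qed.

Lemma X3out s : 4 * a < s -> X3 s = 0.
Proof.
move=> sa; apply: (is_derive_const_near (c := 0) _ (cutoff_d2 HX s)).
by apply: filterS (near_gt sa) => u; exact: (X2out HX).
Qed.

Lemma cutoff_bound : exists2 B, 1 <= B & forall s, 0 <= s -> s <= 4 * a ->
  [/\ `|X0 s| <= B, `|X1 s| <= B, `|X2 s| <= B & `|X3 s| <= B].
Proof.
have [B1 B10 H1] := bound_on_interval a0 (@X1_cont _ _ _ _ _ _ HX).
have [B2 B20 H2] := bound_on_interval a0 (@X2_cont _ _ _ _ _ _ HX).
have [B3 B30 H3] := bound_on_interval a0 X3_cont.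
exists (1 + B1 + B2 + B3); first by lra.
move=> s s0 s4; have := H1 s s0 s4; have := H2 s s0 s4; have := H3 s s0 s4.
have /andP[h0 h1] := cutoff_01 HX s; rewrite (ger0_norm h0).
by split; lra.
Qed.

Let term B C I (b g : R) : `|b| <= B -> `|g| <= C * I -> 0 <= B -> `|b * g| <= B * C * I.
Proof. by move=> hb hg B0; rewrite normrM -mulrA ler_pM. Qed.

Lemma F1_bound : exists2 C, 0 <= C & forall s, 0 < s -> `|F1 k X0 X1 0 s| <= C * isq 3 s.
Proof.
have [B B1 HB] := cutoff_bound; have B0 : 0 <= B by lra.
have [C0 C00 H0] := @gam_bound_le _ k 0 1 (4 * a) k0 isT.
have [C1 C10 H1] := @gam_bound_le _ k 1 1 (4 * a) k0 isT.
exists (B * C1 + B * C0); first by rewrite addr_ge0 // mulr_ge0.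
move=> s s0; have [out|ins] := ltP (4 * a) s.
  rewrite /F1 (cutoff_out HX (ltW out)) (X1out HX out) mul0r mulr0 addr0 normr0.
  by rewrite mulr_ge0 ?addr_ge0 ?mulr_ge0 // ltW // isq_gt0.
have [h0 h1 h2 h3] := HB s (ltW s0) ins.
rewrite /F1 addr0 mulrDl (le_trans (ler_normD _ _)) // lerD //.
  exact: (term h0 (H1 s s0 ins) B0).
by rewrite [gam k 0 s * _]mulrC; exact: (term h1 (H0 s s0 ins) B0).
Qed.

Lemma F2_bound : exists2 C, 0 <= C & forall s, 0 < s -> `|F2 k X0 X1 X2 0 s| <= C * isq 5 s.
Proof.
have [B B1 HB] := cutoff_bound; have B0 : 0 <= B by lra.
have [C0 C00 H0] := @gam_bound_le _ k 0 2 (4 * a) k0 isT.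
have [C1 C10 H1] := @gam_bound_le _ k 1 2 (4 * a) k0 isT.
have [C2 C20 H2] := @gam_bound_le _ k 2 2 (4 * a) k0 isT.
exists (B * C2 + B * C1 + (B * C0 + B * C1)); first by rewrite !addr_ge0 // mulr_ge0.
move=> s s0; have [out|ins] := ltP (4 * a) s.
  rewrite /F2 (cutoff_out HX (ltW out)) (X1out HX out) (X2out HX out) !(mul0r, mulr0, addr0) normr0.
  by rewrite mulr_ge0 ?addr_ge0 ?mulr_ge0 // ltW // isq_gt0.
have [h0 h1 h2 h3] := HB s (ltW s0) ins.
have t02 := term h0 (H2 s s0 ins) B0; have t11 := term h1 (H1 s s0 ins) B0.
have t20 := term h2 (H0 s s0 ins) B0.
rewrite /F2 addr0 [gam k 1 s * _]mulrC [gam k 0 s * _]mulrC !mulrDl.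
rewrite (le_trans (ler_normD _ _)) // lerD // (le_trans (ler_normD _ _)) // lerD //.
Qed.

Lemma F3_bound : exists2 C, 0 <= C & forall s, 0 < s -> `|F3 k X0 X1 X2 X3 0 s| <= C * isq 7 s.
Proof.
have [B B1 HB] := cutoff_bound; have B0 : 0 <= B by lra.
have [C0 C00 H0] := @gam_bound_le _ k 0 3 (4 * a) k0 isT.
have [C1 C10 H1] := @gam_bound_le _ k 1 3 (4 * a) k0 isT.
have [C2 C20 H2] := @gam_bound_le _ k 2 3 (4 * a) k0 isT.
have [C3 C30 H3] := @gam_bound_le _ k 3 3 (4 * a) k0 isT.
exists (B * C3 + B * C2 + (B * C1 + B * C2) + (B * C0 + B * C1 + (B * C2 + B * C1))).
  by rewrite !addr_ge0 // mulr_ge0.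
move=> s s0; have [out|ins] := ltP (4 * a) s.
  rewrite /F3 (cutoff_out HX (ltW out)) (X1out HX out) (X2out HX out) (X3out out) !(mul0r, mulr0, addr0) normr0.
  by rewrite mulr_ge0 ?addr_ge0 ?mulr_ge0 // ltW // isq_gt0.
have [h0 h1 h2 h3] := HB s (ltW s0) ins.
have t03 := term h0 (H3 s s0 ins) B0; have t12 := term h1 (H2 s s0 ins) B0.
have t21 := term h2 (H1 s s0 ins) B0; have t30 := term h3 (H0 s s0 ins) B0.
rewrite /F3 addr0 [gam k 2 s * _]mulrC ![gam k 1 s * _]mulrC [gam k 0 s * _]mulrC !mulrDl.
have D (x1 x2 y1 y2 : R) : `|x1| <= y1 -> `|x2| <= y2 -> `|x1 + x2| <= y1 + y2.
  by move=> h h'; rewrite (le_trans (ler_normD _ _)) // lerD.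
by apply: (D _ _ _ _); apply: (D _ _ _ _); apply: (D _ _ _ _).
Qed.

Let pos0 z : 0 < rho z -> 0 < rho z + 0. Proof. by rewrite addr0. Qed.

(** Each factor dot3 v z is at most the Euclidean length of z, so both terms of the radial formula
    are of order |z|^-3; [kernel_D3] gains one more inverse power in the same way. *)
Lemma kernel_D2 : exists2 C, 0 <= C & forall v w z, rho v <= 1 -> rho w <= 1 -> 0 < rho z ->
  `|Dv v (Dv w G) z| <= C * isq 3 (rho z).
Proof.
have [C1 C10 H1] := F1_bound; have [C2 C20 H2] := F2_bound.
exists (4 * C2 + 2 * C1); first by rewrite addr_ge0 // mulr_ge0.
move=> v w z v1 w1 z0.
have [_ ->] := Dv2_radial v w (@open_ds R 0) (@dF0 _ k _ _ _ _ _ HX 0) (@dF1 _ k _ _ _ _ _ HX 0) (pos0 z0).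
have hv := dot3_sqrt z v1; have hw := dot3_sqrt z w1; have hvw := dot3_le1 v1 w1.
have h1 := H1 _ z0; have h2 := H2 _ z0.
have q0 : 0 <= Num.sqrt (rho z) by exact: sqrtr_ge0.
rewrite [leRHS]mulrDl (le_trans (ler_normD _ _)) // lerD //.
  rewrite (isqS_sqrt 3 z0) (isqS_sqrt 4 z0) (_ : 4 * C2 * _ = 4 * (C2 * isq 5 (rho z)) * (Num.sqrt (rho z) * Num.sqrt (rho z))); last by ring.
  rewrite normrM ler_pM //; first by rewrite normrM ger0_norm // ler_wpM2l.
  by rewrite normrM ler_pM.
rewrite -[leRHS]mulr1 normrM ler_pM // normrM ger0_norm // -mulrA ler_wpM2l //.
Qed.

Lemma kernel_D3 : exists2 C, 0 <= C & forall u v w z, rho u <= 1 -> rho v <= 1 -> rho w <= 1 -> 0 < rho z ->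
  dif (Dv v (Dv w G)) z /\ `|Dv u (Dv v (Dv w G)) z| <= C * isq 4 (rho z).
Proof.
have [C2 C20 H2] := F2_bound; have [C3 C30 H3] := F3_bound.
exists (8 * C3 + 12 * C2); first by rewrite addr_ge0 // mulr_ge0.
move=> u v w z u1 v1 w1 z0.
have [d ->] := Dv3_radial u v w (@open_ds R 0) (@dF0 _ k _ _ _ _ _ HX 0) (@dF1 _ k _ _ _ _ _ HX 0)
  (@dF2 _ k _ _ _ _ _ HX 0) (pos0 z0).
split=> //.
have hu := dot3_sqrt z u1; have hv := dot3_sqrt z v1; have hw := dot3_sqrt z w1.
have huv := dot3_le1 u1 v1; have huw := dot3_le1 u1 w1; have hvw := dot3_le1 v1 w1.
have h2 := H2 _ z0; have h3 := H3 _ z0.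
have q0 : 0 <= Num.sqrt (rho z) by exact: sqrtr_ge0.
rewrite [leRHS]mulrDl (le_trans (ler_normD _ _)) // lerD //.
  rewrite (isqS_sqrt 4 z0) (isqS_sqrt 5 z0) (isqS_sqrt 6 z0) (_ : 8 * C3 * _ = 8 * (C3 * isq 7 (rho z)) * (Num.sqrt (rho z) * Num.sqrt (rho z) * Num.sqrt (rho z))); last by ring.
  rewrite normrM ler_pM //; first by rewrite normrM ger0_norm // ler_wpM2l.
  by rewrite !normrM; apply: ler_pM => //; exact: ler_pM.
rewrite (isqS_sqrt 4 z0) (_ : 12 * C2 * _ = 4 * (C2 * isq 5 (rho z)) * (1 * Num.sqrt (rho z) + 1 * Num.sqrt (rho z) + 1 * Num.sqrt (rho z))); last by ring.
rewrite normrM ler_pM //; first by rewrite normrM ger0_norm // ler_wpM2l.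
have D (x1 x2 y1 y2 : R) : `|x1| <= y1 -> `|x2| <= y2 -> `|x1 + x2| <= y1 + y2.
  by move=> h h'; rewrite (le_trans (ler_normD _ _)) // lerD.
by apply: (D _ _ _ _); [apply: (D _ _ _ _)|]; rewrite normrM ler_pM.
Qed.

(** The mean value theorem on the segment of length 2 d, on which the squared distance to y is at
    least half of |y - p|^2. Halving the argument of [isq 4] costs 4, whence the constant 8. *)
Lemma segment_difference C v w n p y d : rho n = 1 -> 0 < d -> 0 < rho (y - p) -> 0 <= C ->
  (forall z, 0 < rho z -> dif (Dv v (Dv w G)) z /\ `|Dv n (Dv v (Dv w G)) z| <= C * isq 4 (rho z)) ->
  (forall s, `|s| <= d -> rho (y - p) / 2 <= rho (s *: n - (y - p))) ->
  `|Dv v (Dv w G) (p - d *: n - y) - Dv v (Dv w G) (p + d *: n - y)| <= 8 * C * d * isq 4 (rho (y - p)).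
Proof.
move=> n1 d0 t0 C00 HD3 Hs.
have E s : p + s *: n - y = s *: n - (y - p) by rewrite opprB addrCA addrA.
have rs s : `|s| <= d -> 0 < rho (s *: n - (y - p)).
  by move=> /Hs; apply: lt_le_trans; rewrite divr_gt0.
have pt t : - d *: n - (y - p) + t *: ((2 * d) *: n) = (t * (2 * d) - d) *: n - (y - p).
  by rewrite scalerA scalerBl scaleNr addrAC; congr (_ - _); exact: addrC.
have seg t : 0 <= t <= 1 -> `|t * (2 * d) - d| <= d.
  move=> /andP[t0' t1]; rewrite ler_norml; apply/andP; split; last first.
    have : t * (2 * d) <= 1 * (2 * d) by rewrite ler_wpM2r // mulr_ge0 // ltW.
    lra.
  have : 0 <= t * (2 * d) by rewrite !mulr_ge0 // ltW.
  lra.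
have lt_le (t : R) : 0 < t < 1 -> 0 <= t <= 1 by move=> /andP[/ltW -> /ltW ->].
have [||t t01 Et] := @MVT_line _ _ (Dv v (Dv w G)) (- d *: n - (y - p)) ((2 * d) *: n).
- by move=> t /lt_le t01; rewrite pt; apply: (HD3 _ _).1; apply: rs; exact: seg.
- by move=> t t01; rewrite pt; apply: dif_continuous; apply: (HD3 _ _).1; apply: rs; exact: seg.
have e1' : - d *: n - (y - p) + (2 * d) *: n = d *: n - (y - p).
  by have := pt 1; rewrite scale1r => ->; congr (_ *: _ - _); ring.
rewrite e1' pt in Et.
rewrite -scaleNr !E distrC Et.
have r0 := rs _ (seg _ (lt_le _ t01)).
have [dd h] := HD3 _ r0.
rewrite Dv_scalev // normrM gtr0_norm ?mulr_gt0 //.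
have i4 : isq 4 (rho ((t * (2 * d) - d) *: n - (y - p))) <= 4 * isq 4 (rho (y - p)).
  by rewrite -isq4_half //; apply: isq_le; [rewrite divr_gt0 | apply: Hs; apply: seg; exact: lt_le].
have h' := le_trans h (ler_wpM2l C00 i4).
have d2 : 0 <= 2 * d by lra.
have := ler_wpM2l d2 h'; lra.
Qed.

(** Completing the square with s - 2 n.z shows that, for z near the tangent plane, the whole normal
    line stays away from z, also when |s| is much larger than |z|. *)
Lemma cone_line n z s : rho n = 1 -> 4 * dot3 n z ^+ 2 <= rho z ->
  (s ^+ 2 + rho z) / 2 <= rho (s *: n - z).
Proof.
move=> n1 hz; rewrite rho_line //; have := sqr_ge0 (s - 2 * dot3 n z); rewrite !expr2 in hz *; nra.
Qed.

Lemma far_line n z s d : rho n = 1 -> 16 * d ^+ 2 <= rho z -> `|s| <= d ->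
  rho z / 2 <= rho (s *: n - z).
Proof.
move=> n1 hz sd; rewrite rho_line //.
have c := Cauchy3 n z; rewrite n1 mul1r in c.
have s2 : s ^+ 2 <= d ^+ 2.
  by rewrite -[s ^+ 2]real_normK ?num_real // lerXn2r ?nnegrE // (le_trans _ sd).
have := sqr_ge0 (2 * s - 2^-1 * dot3 n z); rewrite !expr2 in c s2 hz *; nra.
Qed.

(** On the cone there are two regimes. If d <= |y - p|, the third derivatives are integrated along
    the normal segment. If |y - p| < d, both terms are O((|y - p|^2 + d^2)^(-3/2)), and one inverse
    power is exchanged for d. The second bound is for points far from p, with no cone condition. *)
Lemma kernel_difference : exists2 C, 0 <= C & forall v w n p y d,
  rho v <= 1 -> rho w <= 1 -> rho n = 1 -> 0 < d -> 0 < rho (y - p) ->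
  (4 * dot3 n (y - p) ^+ 2 <= rho (y - p) ->
    `|Dv v (Dv w G) (p - d *: n - y) - Dv v (Dv w G) (p + d *: n - y)| <=
      C * (d * isq 4 (rho (y - p) + d ^+ 2))) /\
  (16 * d ^+ 2 <= rho (y - p) ->
    `|Dv v (Dv w G) (p - d *: n - y) - Dv v (Dv w G) (p + d *: n - y)| <=
      C * (d * isq 4 (rho (y - p)))).
Proof.
have [C2 C20 H2] := kernel_D2; have [C3 C30 H3] := kernel_D3.
exists (8 * C2 + 32 * C3); first by rewrite addr_ge0 // mulr_ge0.
move=> v w n p y d v1 w1 n1 d0 t0.
have n1' : rho n <= 1 by rewrite n1.
have HD3 z : 0 < rho z -> dif (Dv v (Dv w G)) z /\ `|Dv n (Dv v (Dv w G)) z| <= C3 * isq 4 (rho z).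
  by move=> z0; exact: H3.
have i4 := isq_gt0 4 t0.
have d2 : 0 < d ^+ 2 by rewrite exprn_gt0.
have s0 : 0 < rho (y - p) + d ^+ 2 by lra.
have i4' := isq_gt0 4 s0.
have di : 0 <= d * isq 4 (rho (y - p)) by rewrite mulr_ge0 // ltW.
have di' : 0 <= d * isq 4 (rho (y - p) + d ^+ 2) by rewrite mulr_ge0 // ltW.
split=> h.
  have HL s := cone_line s n1 h.
  have [dt|td] := leP (d ^+ 2) (rho (y - p)).
    have Hs s : `|s| <= d -> rho (y - p) / 2 <= rho (s *: n - (y - p)).
      by move=> _; apply: le_trans (HL s); have := sqr_ge0 s; lra.
    apply: (le_trans (segment_difference n1 d0 t0 C30 HD3 Hs)).
    have : isq 4 (rho (y - p)) <= 4 * isq 4 (rho (y - p) + d ^+ 2).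
      by rewrite -isq4_half //; apply: isq_le; [rewrite divr_gt0 | lra].
    move=> h4; have dC : 0 <= 8 * C3 * d by rewrite !mulr_ge0 // ltW.
    have := ler_wpM2l dC h4.
    have : 0 <= C2 * (d * isq 4 (rho (y - p) + d ^+ 2)) by rewrite mulr_ge0.
    lra.
  set s := rho (y - p) + d ^+ 2 in s0 i4' di' *.
  have Q (u : R) : u ^+ 2 = d ^+ 2 -> `|Dv v (Dv w G) (u *: n - (y - p))| <= 4 * C2 * (d * isq 4 s).
    move=> u2; have hu : s / 2 <= rho (u *: n - (y - p)) by have := HL u; rewrite u2 /s addrC.
    have s20 : 0 < s / 2 by rewrite divr_gt0.
    have r0 := lt_le_trans s20 hu.
    apply: (le_trans (H2 v w _ v1 w1 r0)).
    have : isq 3 (rho (u *: n - (y - p))) <= 4 * (d * isq 4 s).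
      apply: (le_trans (isq_le 3 s20 hu)); rewrite (isqS_sqrt 3 s20) isq4_half //.
      have : Num.sqrt (s / 2) <= d.
        by rewrite -[leRHS]gtr0_norm // -sqrtr_sqr ler_wsqrtr // /s; lra.
      move=> h5; have := ler_wpM2l (ltW i4') h5; lra.
    move=> h6; have := ler_wpM2l C20 h6; lra.
  have E (u : R) : p + u *: n - y = u *: n - (y - p) by rewrite opprB addrCA addrA.
  rewrite -scaleNr !E (le_trans (ler_normB _ _)) //.
  have q1 : `|Dv v (Dv w G) (- d *: n - (y - p))| <= 4 * C2 * (d * isq 4 s) by apply: Q; rewrite sqrrN.
  have q2 : `|Dv v (Dv w G) (d *: n - (y - p))| <= 4 * C2 * (d * isq 4 s) by apply: Q.
  have : 0 <= C3 * (d * isq 4 s) by rewrite mulr_ge0.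
  lra.
have Hs s : `|s| <= d -> rho (y - p) / 2 <= rho (s *: n - (y - p)).
  exact: far_line.
apply: (le_trans (segment_difference n1 d0 t0 C30 HD3 Hs)).
have : 0 <= C2 * (d * isq 4 (rho (y - p))) by rewrite mulr_ge0.
have : 0 <= C3 * (d * isq 4 (rho (y - p))) by rewrite mulr_ge0.
lra.
Qed.

Lemma csupp_lipschitz f n M : Ck 1 setT f -> csupp M f -> exists2 L, 0 <= L & forall x d, 0 < d ->
  `|f (x - d *: n) - f (x + d *: n)| <= L * d.
Proof.
move=> hf sf.
have cD z : {for z, continuous (Dv n f)} by apply: (@Ck_cont _ _ 0 setT) => //; exact: Ck_Dv.
have [L L0 H] := compact_le_bound (@compact_box R M) (fun z _ => cD z).
have HL z : `|Dv n f z| <= L.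
  have [zM|zM] := leP `|z| M; first exact: H.
  by rewrite (csupp_Dv n sf zM) normr0.
have dA z : dif f z by exact: (Ck_dif hf).
exists (2 * L); first by rewrite mulr_ge0.
move=> x d d0; have [||t _ E] := @MVT_line _ _ f (x - d *: n) ((2 * d) *: n).
- by move=> t _; exact: dA.
- by move=> t _; apply: dif_continuous.
have e1' : x - d *: n + (2 * d) *: n = x + d *: n.
  by rewrite -addrA -scaleNr -scalerDl; congr (_ + _ *: _); ring.
rewrite e1' in E; rewrite distrC E Dv_scalev // normrM gtr0_norm ?mulr_gt0 //.
have d2 : 0 <= 2 * d by lra.
by have := ler_wpM2l d2 (HL (x - d *: n + t *: ((2 * d) *: n))); lra.
Qed.

End KernelBounds.

(** * Second derivatives of the representation formula *)

Section HessianRepresentation.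
Context {R : realType}.
Notation P := (R * R * R)%type.
Variables (k a m : R) (X0 X1 X2 X3 : R -> R).
Hypotheses (k0 : 0 < k) (a0 : 0 < a) (m0 : 0 < m) (ka : 20 * k ^+ 2 * a <= 1).
Hypotheses (HX : cutoff a X0 X1 X2 X3) (Mm : M0 a < m).
Implicit Types (x y z v w : P) (W g f : P -> R) (d r : R).
Local Notation C0 := (C0 k m X1 X2).
Local Notation G := (Gm k X0 0).
Local Notation kp := (kap k X1 X2 0).

Lemma rhoD2 x y : rho (x + y) <= 2 * rho x + 2 * rho y.
Proof.
have := rho_ge0 (x - y).
have -> : rho (x - y) = rho x - 2 * dot3 x y + rho y.
  by rewrite /rho !(dot3Dl, dot3Nl) !(dot3C _ (x - y)) !(dot3Dl, dot3Nl) (dot3C y x); ring.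
have -> : rho (x + y) = rho x + 2 * dot3 x y + rho y.
  by rewrite /rho !dot3Dl !(dot3C _ (x + y)) !dot3Dl (dot3C y x); ring.
lra.
Qed.

Lemma Int_conv_D2 M W f v w x : bdd m W -> Ck 2 setT f -> csupp M f ->
  Dv v (Dv w (fun z => Int m (fun y => W y * f (z - y)))) x = Int m (fun y => W y * Dv v (Dv w f) (x - y)).
Proof.
move=> bW hf sf.
rewrite (_ : Dv w _ = fun z => Int m (fun y => W y * Dv w f (z - y))); last first.
  by apply/funext => z; have [_ ->] := Int_conv_dif m0 z bW (CkS hf) sf.
by have [_ ->] := Int_conv_dif m0 x bW (Ck_Dv w hf) (csupp_Dv w sf).
Qed.

(** Since g vanishes near x, the kernel may be cut out around its singularity without changing the
    formula at points close to x. The modified kernel is C^3, so W is C^3 near x and derivatives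
    pass under the integral. *)
Lemma hessian_representation W g x r d : `|x| + r + M0 a < m -> 0 < r -> bdd m W -> bdd m g ->
  0 < d -> (forall y, rho (x - y) < d -> g y = 0) ->
  (forall x', `|x' - x| < r -> {for x', continuous W}) ->
  (forall x' e, `|x' - x| < r -> 0 < e -> e <= a ->
    Int m (fun y => W y * (psi k X0 e (x' - y) + kap k X1 X2 e (x' - y))) =
    Int m (fun y => g y * Gm k X0 e (x' - y))) ->
  (exists B : set P, [/\ open B, B x & Ck 3 B W]) /\
  forall v w, C0 * Dv v (Dv w W) x =
    Int m (fun y => g y * Dv v (Dv w G) (x - y)) - Int m (fun y => W y * Dv v (Dv w kp) (x - y)).
Proof.
move=> xm r0 bW bg d0 g0 cW HWI.
have C00 : C0 != 0 by exact: (C0_neq0 k0 a0 m0 ka HX Mm).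
(* If |x' - x|^2 < d/4 and |x' - y|^2 < 4 b = d/4, then |x - y|^2 < d by [rhoD2], hence g y = 0: the
   region where the kernel is altered never meets the source. *)
pose b := d / 16; have b0 : 0 < b by rewrite divr_gt0.
have [Y0 [Y1 [Y2 [Y3 HY]]]] := cutoff_exists b0.
pose G' z := (1 - Y0 (rho z)) * G z.
have oP : open [set z : P | 0 < rho z + 0] by exact: (@open_pos R 0).
have o1 : open [set z : P | rho z < b] by exact: (open_rho (@open_lt R b)).
have o2 : open [set z : P | 4 * b < rho z] by exact: (open_rho (@open_gt R (4 * b))).
have CY : Ck 3 setT (fun z => 1 - Y0 (rho z)).
  apply: CkB; [exact: openT | exact: Ck_cst |].
  apply: (Ck_comp (h := Y0) (f := rho) (B := setT) openT) => //; last exact: Ck_rho.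
  exact: (SC_le _ (SX0 HY)).
have G'C : Ck 3 setT G'.
  have h1 : Ck 3 [set z : P | 0 < rho z + 0] G'.
    apply: CkM => //; first exact: (Ck_sub _ CY).
    exact: (Ck_le _ (Gm_Ck k HX 0)).
  have h2 : Ck 3 [set z : P | rho z < b] G'.
    apply: (Ck_ext o1 _ (@Ck_cst _ _ 3 _ 0)) => z /= /ltW zb.
    by rewrite /G' (cutoff_in HY zb) subrr mul0r.
  apply: (Ck_sub _ (Ck_union h1 h2)) => z _; rewrite /= addr0.
  by have [zb|zb] := ltP (rho z) b; [right | left; exact: lt_le_trans zb].
have G'E z : 4 * b <= rho z -> G' z = G z.
  by move=> h; rewrite /G' (cutoff_out HY h) subr0 mul1r.
have G'supp : csupp (M0 a) G'.
  move=> z /(M0_rho a0) /ltW h; rewrite /G' (Gm_out k HX) ?mulr0 //.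
have kC : Ck 3 setT kp by exact: (kap_Ck k a0 HX).
have ksupp : csupp (M0 a) kp by exact: csupp_kap HX _.
pose F x' := C0^-1 * (Int m (fun y => g y * G' (x' - y)) - Int m (fun y => W y * kp (x' - y))).
have FC : Ck 3 setT F.
  apply: CkZ; first exact: openT.
  apply: CkB; first exact: openT.
    exact: (@Int_conv_Ck _ _ m0 2 _ _ _ bg G'C G'supp).
  exact: (@Int_conv_Ck _ _ m0 2 _ _ _ bW kC ksupp).
pose B := [set x' : P | rho (x' - x) < d / 4] `&` [set x' : P | `|x' - x| < r].
have cx (z : P) : {for z, continuous (fun y : P => y - x)}.
  by apply: cvgB; [exact: cvg_id | exact: cvg_cst].
have oB : open B.
  apply: openI.
    apply: (@open_comp _ _ (fun y => rho (y - x)) [set s | s < d / 4]); last exact: open_lt.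
    by move=> z _; apply: (continuous_comp (cx z)); exact: rho_cont.
  apply: (@open_comp _ _ (fun y : P => `|y - x|) [set s | s < r]); last exact: open_lt.
  by move=> z _; apply: cvg_norm; exact: cx.
have Bx : B x.
  by split; rewrite /= subrr ?normr0 // /rho /dot3 /= !mul0r !addr0 divr_gt0.
have gB x' y : B x' -> rho (x' - y) < 4 * b -> g y = 0.
  move=> [/= h _] h2; apply: g0.
  have := rhoD2 (x - x') (x' - y); rewrite addrA subrK.
  have -> : rho (x - x') = rho (x' - x) by rewrite -opprB /rho dot3Nl dot3C dot3Nl opprK.
  by rewrite /b in h2; lra.
have WF x' : B x' -> W x' = F x'.
  move=> Bx'; have [_ /= xr] := Bx'.
  have x'm : `|x'| + M0 a < m.
    have : `|x'| <= `|x' - x| + `|x| by rewrite -{1}(subrK x x') ler_normD.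
    by move: xm; lra.
  have b40 : 0 < 4 * b by rewrite mulr_gt0.
  have := representation k0 a0 m0 ka HX x'm bW (cW _ xr) bg b40 (fun y => gB x' y Bx')
    (fun e => HWI x' e xr).
  move=> E; rewrite /F; apply: (mulfI C00); rewrite mulVKf // E; congr (_ - _).
  apply: (Int_ext m0) => y _; have [near|far] := ltP (rho (x' - y)) (4 * b).
    by rewrite (gB _ _ Bx' near) !mul0r.
  by rewrite G'E.
split; first by exists B; split=> //; apply: (Ck_ext oB _ (Ck_sub _ FC)) => // z /WF.
move=> v w.
have dF z : dif (Dv w F) z by apply: (Ck_dif (n := 1) (A := setT)) => //; exact: Ck_Dv.
have D1 z : B z -> Dv w W z = Dv w F z.
  by move=> Bz; apply: Dv_near; apply: (near_open oB Bz) => y; exact: WF.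
have -> : Dv v (Dv w W) x = Dv v (Dv w F) x.
  by apply: Dv_near; apply: (near_open oB Bx) => y; exact: D1.
have I1 := @Int_conv_Ck _ _ m0 2 _ _ _ bg G'C G'supp.
have I2 := @Int_conv_Ck _ _ m0 2 _ _ _ bW kC ksupp.
set i1 := (fun z => Int m (fun y => g y * G' (z - y))) in I1.
set i2 := (fun z => Int m (fun y => W y * kp (z - y))) in I2.
have d1 z : dif i1 z by exact: (Ck_dif I1).
have d2 z : dif i2 z by exact: (Ck_dif I2).
have e1' z : dif (Dv w i1) z by exact: (Ck_dif (Ck_Dv w I1)).
have e2' z : dif (Dv w i2) z by exact: (Ck_dif (Ck_Dv w I2)).
have -> : Dv w F = fun z => C0^-1 * (Dv w i1 z - Dv w i2 z).
  apply/funext => z; rewrite -(DvB w (d1 z) (d2 z)) -DvZ //; exact: difB.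
rewrite DvZ; last exact: difB.
rewrite (DvB v (e1' x) (e2' x)) mulVKf //; congr (_ - _).
  rewrite /i1 (Int_conv_D2 v w x bg (CkS G'C) G'supp); apply: (Int_ext m0) => y _.
  have [near|far] := ltP (rho (x - y)) d; first by rewrite g0 // !mul0r.
  congr (_ * _); have xy : [set z : P | 4 * b < rho z] (x - y) by rewrite /= /b; lra.
  apply: Dv_near; apply: (near_open o2 xy) => z h; apply: Dv_near.
  by apply: (near_open o2 h) => z' /ltW; exact: G'E.
exact: (Int_conv_D2 v w x bW (CkS kC) ksupp).
Qed.

End HessianRepresentation.

(** * Mass of the weight d (|z|^2 + d^2)^-2 in space and in a thin cone *)

Section ConeMass.
Context {R : realType}.
Notation P := (R * R * R)%type.
Variables (a m : R) (X0 X1 X2 X3 : R -> R).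
Hypotheses (a0 : 0 < a) (m0 : 0 < m) (HX : cutoff a X0 X1 X2 X3).
Implicit Types (x y z v w n p : P) (g f : P -> R) (d s t : R).
#[local] Opaque isq.

Lemma Int_Dv_trans f v p M : M + `|p| < m -> Ck 1 setT f -> csupp M f ->
  Int m (fun y => Dv v f (y - p)) = 0.
Proof.
move=> Mp hf sf.
have hg : Ck 1 setT (fun y => f (y + - p)).
  by have := @Ck_trans _ _ 1 setT f (- p) openT hf; apply: Ck_sub.
have sg : csupp (M + `|p|) (fun y => f (y + - p)).
  move=> y h; apply: sf; have : `|y| <= `|y - p| + `|p| by rewrite -{1}(subrK p y) ler_normD.
  lra.
rewrite -[RHS](Int_Dv m0 v Mp hg sg); apply: (Int_ext m0) => y _.
by have [_ ->] := dif_trans (x := - p) (Ck_dif hf (I : setT (y + - p))).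
Qed.

Lemma csupp_radial (H : R -> R) (h : P -> R) : (forall s, 4 * a < s -> H s = 0) ->
  csupp (M0 a) (fun z => h z * H (rho z)).
Proof. by move=> H0 z /(M0_rho a0) /H0 ->; rewrite mulr0. Qed.

Let isqd (n : nat) d t : is_derive t 1 (fun s => isq n (s + d ^+ 2)) (- (n%:R / 2) * isq n.+2 (t + d ^+ 2)) \/ t + d ^+ 2 <= 0.
Proof.
have [h|h] := ltP 0 (t + d ^+ 2); last by right.
left; have D : is_derive t 1 (fun u : R => u + d ^+ 2) (1 + 0).
  exact: (is_deriveDt (is_derive_id _ _) (is_derive_cst _ _ _)).
have C := is_derive_compt (g := isq n) (h := fun u : R => u + d ^+ 2) (isq_derive n h) D.
by apply: (is_derive_eq C); rewrite addr0 mulr1.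
Qed.

Let isqd' (n : nat) d t : 0 < t + d ^+ 2 -> is_derive t 1 (fun s => isq n (s + d ^+ 2)) (- (n%:R / 2) * isq n.+2 (t + d ^+ 2)).
Proof. by move=> h; case: (isqd n d t) => //; rewrite leNgt h. Qed.

Let SCi k (n : nat) d : SC k (fun s => 0 < s + d ^+ 2) (fun s => isq n (s + d ^+ 2)).
Proof. by apply: (SC_comp (SC_isq k n)) => //; exact: SC_shift. Qed.

Let SC0 d : SC 1 (fun s => 0 < s + d ^+ 2) X0.
Proof. by apply: (SC_sub (A := setT)) => //; exact: (SC_le _ (SX0 HX)). Qed.

Let pos d z : 0 < d -> 0 < rho z + d ^+ 2.
Proof. by move=> d0; rewrite ltr_wpDl ?rho_ge0 // exprn_gt0. Qed.

Let Ck_rad k H d : 0 < d -> SC k (fun s => 0 < s + d ^+ 2) H -> Ck k setT (fun z : P => H (rho z)).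
Proof.
move=> d0 sH; apply: (Ck_comp openT sH) => [z _|]; first exact: pos.
exact: Ck_rho.
Qed.

Let q d s := 4 / 3 * isq 3 (s + d ^+ 2) - d * isq 4 (s + d ^+ 2).
Let q' d s := 2 * d * isq 6 (s + d ^+ 2) - 2 * isq 5 (s + d ^+ 2).

Let dq d s : 0 < s + d ^+ 2 -> is_derive s 1 (q d) (q' d s).
Proof.
move=> h; have D := is_deriveDt (is_deriveZt (4 / 3) (isqd' 3 h)) (is_deriveNt (is_deriveZt d (isqd' 4 h))).
by apply: (is_derive_eq D); rewrite /q'; field.
Qed.

Let SCq d : SC 1 (fun s => 0 < s + d ^+ 2) (q d).
Proof.
apply: SCD; first by apply: SCZ; exact: SCi.
rewrite (_ : (fun t => - _) = fun t => - d * isq 4 (t + d ^+ 2)); last by apply/funext => t; rewrite mulNr.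
by apply: SCZ; exact: SCi.
Qed.

(** With t = s + d^2, the right side minus the left side is 4 d^2 t^-3 (sqrt t - d) >= 0. The
    coefficient 4/3 makes the term in t^(-3/2) contribute 4 d^2 t^(-5/2), which dominates the - 4
    d^3 t^-3 left by the other term. *)
Let q_div d s : 0 < d -> 0 <= s -> d * isq 4 (s + d ^+ 2) <= 3 * q d s + 2 * s * q' d s.
Proof.
move=> d0 s0; have d2 : 0 < d ^+ 2 by rewrite exprn_gt0.
have t0 : 0 < s + d ^+ 2 by lra.
rewrite /q /q'; set t := s + d ^+ 2 in t0 *.
have r0 : 0 < Num.sqrt t by rewrite sqrtr_gt0.
have rd : d <= Num.sqrt t by rewrite -[leLHS]gtr0_norm // -sqrtr_sqr ler_wsqrtr // /t; lra.
have rt : Num.sqrt t * Num.sqrt t = s + d ^+ 2 by rewrite -expr2 sqr_sqrtr // ltW.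
have i6 := isq_gt0 6 t0.
rewrite !(isqS_sqrt 3 t0) !(isqS_sqrt 4 t0) !(isqS_sqrt 5 t0).
set u := Num.sqrt t in r0 rd rt *; set J := isq 6 t in i6 *.
rewrite -subr_ge0.
have -> : 3 * (4 / 3 * (J * u * u * u) - d * (J * u * u)) + 2 * s * (2 * d * J - 2 * (J * u)) - d * (J * u * u) =
  J * (4 * u * (u * u) - 4 * d * (u * u) + 4 * s * d - 4 * s * u) by field.
rewrite rt mulr_ge0 ?(ltW i6) //.
have -> : 4 * u * (s + d ^+ 2) - 4 * d * (s + d ^+ 2) + 4 * s * d - 4 * s * u = 4 * d ^+ 2 * (u - d) by ring.
by rewrite !mulr_ge0 ?subr_ge0 // ltW.
Qed.

Let q_bound d s : 0 < d -> a <= s -> `|q d s| <= 7 / 3 * isq 3 a.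
Proof.
have a0' := a0; move=> d0 sa; have d2 : 0 < d ^+ 2 by rewrite exprn_gt0.
have t0 : 0 < s + d ^+ 2 by lra.
have i3 : isq 3 (s + d ^+ 2) <= isq 3 a by apply: isq_le => //; lra.
have p3 := isq_gt0 3 t0; have p4 := isq_gt0 4 t0.
have rd : d <= Num.sqrt (s + d ^+ 2) by rewrite -[leLHS]gtr0_norm // -sqrtr_sqr ler_wsqrtr //; lra.
have i4 : d * isq 4 (s + d ^+ 2) <= isq 3 (s + d ^+ 2).
  by rewrite (isqS_sqrt 3 t0) mulrC ler_wpM2l // ltW.
have i4' : 0 <= d * isq 4 (s + d ^+ 2) by rewrite mulr_ge0 // ltW.
rewrite /q ler_norml; apply/andP; split; lra.
Qed.

Let B1 : exists2 B, 1 <= B & forall s, 0 <= s -> s <= 4 * a -> `|X1 s| <= B.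
Proof.
have [B B1 H] := cutoff_bound a0 HX; exists B => // s s0 s4; by have [] := H s s0 s4.
Qed.

Lemma bdd_shift f p : (forall z, {for z, continuous f}) -> bdd m (fun y => f (y - p)).
Proof.
move=> cf; apply: bdd_cont => y; apply: (@continuous_comp _ _ _ (fun y : P => y - p) f); last exact: cf.
by apply: cvgB; [exact: cvg_id | exact: cvg_cst].
Qed.

(** The bound of [kernel_difference] on the cone, up to its constant, with z = y - p, cut off to the
    support of the kernel. *)
Definition wt d z : R := X0 (rho z) * (d * isq 4 (rho z + d ^+ 2)).

Let wt_cont d z : 0 < d -> {for z, continuous (wt d)}.
Proof.
move=> d0; apply: (@Ck_cont _ _ 1 setT) => //.
apply: (Ck_rad (H := fun s => X0 s * (d * isq 4 (s + d ^+ 2))) d0).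
by apply: SCM; [exact: SC0 | apply: SCZ; exact: SCi].
Qed.

Let wt_ge0 d z : 0 < d -> 0 <= wt d z.
Proof.
move=> d0; have /andP[h _] := cutoff_01 HX (rho z).
by rewrite /wt mulr_ge0 // mulr_ge0 ?(ltW d0) // ltW // isq_gt0 // pos.
Qed.

(* The field z q(|z|^2) X0, with q = (4/3) t^-3/2 - d t^-2 at t = |z|^2 + d^2, has divergence at least
   the weight d t^-2 where X0 = 1. *)
Lemma weight_mass : exists2 C, 0 <= C & forall p d, M0 a + `|p| < m -> 0 < d ->
  Int m (fun y => wt d (y - p)) <= C.
Proof.
have a0' := a0; have [B B_ge1 HB] := B1; have B0 : 0 <= B by lra.
have i3a := isq_gt0 3 a0.
exists (8 * (8 * a * B * (7 / 3 * isq 3 a))).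
  by rewrite !mulr_ge0 // ltW.
move=> p d pm d0; have d2 : 0 < d ^+ 2 by rewrite exprn_gt0.
pose H s := X0 s * q d s; pose H' s := X0 s * q' d s + q d s * X1 s.
have dH s : 0 < s + d ^+ 2 -> is_derive s 1 H (H' s).
  by move=> h; exact: (is_deriveMt (cutoff_d0 HX s) (dq h)).
have Hout s : 4 * a < s -> H s = 0 by move=> /ltW h; rewrite /H (cutoff_out HX h) mul0r.
have HC : Ck 1 setT (fun z : P => H (rho z)).
  by apply: (Ck_rad d0); apply: SCM; [exact: SC0 | exact: SCq].
pose f v z := dot3 v z * H (rho z).
have fC v : Ck 1 setT (f v) by apply: CkM; [exact: openT | exact: Ck_dot3 | exact: HC].
have fsupp v : csupp (M0 a) (f v) by exact: csupp_radial.
have fD v z : Dv v (f v) z = dot3 v z * (H' (rho z) * (2 * dot3 v z)) + H (rho z) * rho v.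
  have [dh Dh] := Dv_radial v (dH _ (pos z d0)); have [dl Dl] := dif_dot3 v z.
  by rewrite /f (DvM v dl dh) Dh Dl.
have fI v : Int m (fun y => Dv v (f v) (y - p)) = 0 by exact: Int_Dv_trans (fC v) (fsupp v).
have fb v : bdd m (fun y => Dv v (f v) (y - p)).
  apply: bdd_shift => z; apply: (@Ck_cont _ _ 0 setT) => //; exact: (Ck_Dv v (fC v)).
pose T z := Dv (@e1 R) (f (@e1 R)) z + Dv (@e2 R) (f (@e2 R)) z + Dv (@e3 R) (f (@e3 R)) z.
have IT : Int m (fun y => T (y - p)) = 0.
  by rewrite /T (IntD m0 (bddD (fb _) (fb _)) (fb _)) (IntD m0 (fb _) (fb _)) !fI !addr0.
have bT : bdd m (fun y => T (y - p)) by exact: (bddD (bddD (fb _) (fb _)) (fb _)).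
have TE z : T z = X0 (rho z) * (3 * q d (rho z) + 2 * rho z * q' d (rho z)) + 2 * rho z * (q d (rho z) * X1 (rho z)).
  rewrite /T !fD /H /H'; set A := X0 _; set Q := q d _; set Q' := q' d _; set Z := X1 _.
  by rewrite /rho /dot3 /=; ring.
have bw : bdd m (fun y => wt d (y - p)) by apply: bdd_shift => z; exact: wt_cont.
(* A bound for the term with the derivative of the cutoff: it lives in a <= |z|^2 <= 4 a, where |X1|
   <= B and |q| <= (7/3) a^(-3/2). *)
set Kb := 8 * a * B * (7 / 3 * isq 3 a).
have -> : 8 * Kb = Int m (fun y => T (y - p) + Kb) by rewrite (IntD m0 bT (bdd_cst m Kb)) IT Int_cst add0r.
apply: (Int_le m0 bw (bddD bT (bdd_cst m Kb))) => y _; set z := y - p.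
have Kb0 : 0 <= Kb by rewrite /Kb !mulr_ge0 // ltW.
have /andP[x0 x1] := cutoff_01 HX (rho z).
have r0 := rho_ge0 z.
rewrite TE; have h1 := ler_wpM2l x0 (q_div d0 r0); rewrite -/(wt d z) in h1.
suff : - Kb <= 2 * rho z * (q d (rho z) * X1 (rho z)) by lra.
have [near|near] := ltP (rho z) a; first by rewrite (X1in HX near) !mulr0 oppr_le0.
have [far|far] := ltP (4 * a) (rho z); first by rewrite (X1out HX far) !mulr0 oppr_le0.
have : `|2 * rho z * (q d (rho z) * X1 (rho z))| <= Kb; last by rewrite ler_norml => /andP[].
rewrite (_ : Kb = 8 * a * (7 / 3 * isq 3 a * B)); last by rewrite /Kb; ring.
rewrite normrM ler_pM //; first by rewrite ger0_norm ?mulr_ge0 //; lra.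
by rewrite normrM ler_pM //; [exact: q_bound | exact: HB].
Qed.

(* The angular field N X0 d t^-3/2 atan (nu t^-1/2 / ep), with nu = n.z and t = |z|^2 + d^2, has divergence
   of size 1/ep times the weight on the cone |nu| <= ep |z|. *)
Lemma cone_mass : exists2 C, 0 <= C & forall n p d ep g, rho n = 1 -> M0 a + `|p| < m -> 0 < d -> 0 < ep -> ep <= 2^-1 ->
  bdd m g -> (forall y, `|g y| <= wt d (y - p)) ->
  (forall y, ep ^+ 2 * rho (y - p) < dot3 n (y - p) ^+ 2 -> g y = 0) -> `|Int m g| <= C * ep.
Proof.
have a0' := a0; have [B B_ge1 HB] := B1; have B0 : 0 <= B by lra.
have [CA CA0 HA] := weight_mass.
have i1a := isq_gt0 1 a0.
exists (3 * (6 * CA + 8 * (4 * B * isq 1 a))).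
  have h1 : 0 <= 4 * B * isq 1 a by rewrite !mulr_ge0 // ltW.
  by rewrite !mulr_ge0 // addr_ge0 // mulr_ge0.
move=> n p d ep g n1 pm d0 ep0 ep2 bg gw gcone.
have d2 : 0 < d ^+ 2 by rewrite exprn_gt0.
pose H s := X0 s * (d * isq 3 (s + d ^+ 2)).
pose H' s := X0 s * (d * (- (3 / 2) * isq 5 (s + d ^+ 2))) + d * isq 3 (s + d ^+ 2) * X1 s.
have dH s : 0 < s + d ^+ 2 -> is_derive s 1 H (H' s).
  by move=> h; exact: (is_deriveMt (cutoff_d0 HX s) (is_deriveZt d (isqd' 3 h))).
have Hout s : 4 * a < s -> H s = 0 by move=> /ltW h; rewrite /H (cutoff_out HX h) mul0r.
have HC : Ck 1 setT (fun z : P => H (rho z)).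
  by apply: (Ck_rad d0); apply: SCM; [exact: SC0 | apply: SCZ; exact: SCi].
have IC : Ck 1 setT (fun z : P => isq 1 (rho z + d ^+ 2)).
  by apply: (Ck_rad (H := fun s => isq 1 (s + d ^+ 2)) d0); exact: SCi.
pose w z := ep^-1 * (dot3 n z * isq 1 (rho z + d ^+ 2)).
have wC : Ck 1 setT w.
  by apply: CkZ; [exact: openT | apply: CkM; [exact: openT | exact: Ck_dot3 | exact: IC]].
have aC : Ck 1 setT (fun z => atan (w z)).
  by apply: (Ck_comp openT (SC_atan (R := R))).
pose f z := atan (w z) * H (rho z).
have fC : Ck 1 setT f by apply: CkM; [exact: openT | exact: aC | exact: HC].
have fsupp : csupp (M0 a) f by exact: csupp_radial.
pose psi1 z := H (rho z) * ((1 + w z ^+ 2)^-1 * (ep^-1 * (isq 1 (rho z + d ^+ 2) - dot3 n z ^+ 2 * isq 3 (rho z + d ^+ 2)))).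
have fD z : Dv n f z = atan (w z) * (H' (rho z) * (2 * dot3 n z)) + psi1 z.
  have pz := pos z d0.
  have [dh Dh] := Dv_radial n (dH _ pz).
  have [di Di] := Dv_radial n (isqd' 1 pz).
  have [dl Dl] := dif_dot3 n z.
  have dw : dif w z by exact: (Ck_dif wC).
  have da := is_derive1_atan (w z).
  have daw : dif (fun z => atan (w z)) z by exact: (Ck_dif aC).
  rewrite /f (DvM n daw dh) Dh (Dv_comp n da dw) /w DvZ; last exact: difM.
  rewrite (DvM n dl di) Dl Di -/(rho n) n1 /psi1; congr (_ + _ * (_ * _)).
  by congr (_ * _); rewrite mulr1; field.
have If : Int m (fun y => Dv n f (y - p)) = 0 by exact: Int_Dv_trans fC fsupp.
have bf : bdd m (fun y => Dv n f (y - p)).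
  by apply: bdd_shift => z; apply: (@Ck_cont _ _ 0 setT) => //; exact: (Ck_Dv n fC).
have bw : bdd m (fun y => wt d (y - p)) by apply: bdd_shift => z; exact: wt_cont.
set K := 4 * B * isq 1 a.
have K0 : 0 <= K by rewrite /K !mulr_ge0 // ltW.
have bK : bdd m (fun y => Dv n f (y - p) + (6 * wt d (y - p) + K)).
  by apply: bddD => //; apply: bddD; [apply: bddM => //; exact: bdd_cst | exact: bdd_cst].
(* The terms with derivatives of the radial factor are at least - (6 wt + K), with 6 = 2 * 2 * 3/2
   and atan bounded by 2. On the cone, differentiating the atan yields at least 3/8 of wt / ep: a
   factor 1/2 since w^2 <= 1, and 3/4 since (n.z)^2 <= t / 4. *)
have key y : `|g y| <= 3 * ep * (Dv n f (y - p) + (6 * wt d (y - p) + K)).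
  set z := y - p; rewrite fD.
  have pz := pos z d0; have wz0 := wt_ge0 z d0; have gz := gw y; rewrite -/z in gz.
  set t := rho z + d ^+ 2 in pz *.
  have r0 := rho_ge0 z; have nz : dot3 n z ^+ 2 <= rho z by have := Cauchy3 n z; rewrite n1 mul1r.
  have sq0 : 0 < Num.sqrt t by rewrite sqrtr_gt0.
  have nt : `|dot3 n z| <= Num.sqrt t.
    by rewrite -sqrtr_sqr ler_wsqrtr // (le_trans nz) // /t lerDl ltW.
  have dt : d <= Num.sqrt t by rewrite -[leLHS]gtr0_norm // -sqrtr_sqr ler_wsqrtr // /t; lra.
  have i1 := isq_gt0 1 pz; have i2 := isq_gt0 2 pz; have i3 := isq_gt0 3 pz.
  have i4 := isq_gt0 4 pz; have i5 := isq_gt0 5 pz.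
  have e12 : isq 1 t = isq 2 t * Num.sqrt t by exact: isqS_sqrt.
  have e23 : isq 2 t = isq 3 t * Num.sqrt t by exact: isqS_sqrt.
  have e34 : isq 3 t = isq 4 t * Num.sqrt t by exact: isqS_sqrt.
  have e45 : isq 4 t = isq 5 t * Num.sqrt t by exact: isqS_sqrt.
  have tE : Num.sqrt t * Num.sqrt t = t by rewrite -expr2 sqr_sqrtr // ltW.
  have /andP[x0 x1] := cutoff_01 HX (rho z).
  have X1b : `|d * isq 3 t * X1 (rho z) * dot3 n z| <= B * isq 1 a.
    have Bi : 0 <= B * isq 1 a by rewrite mulr_ge0 // ltW.
    have [near|near] := ltP (rho z) a; first by rewrite (X1in HX near) mulr0 mul0r normr0.
    have [far|far] := ltP (4 * a) (rho z); first by rewrite (X1out HX far) mulr0 mul0r normr0.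
    have h1 : isq 1 t <= isq 1 a by apply: isq_le => //; rewrite /t; lra.
    rewrite (_ : _ * _ = X1 (rho z) * (isq 3 t * d * dot3 n z)); last by ring.
    rewrite normrM ler_pM ?HB // (le_trans _ h1) //.
    rewrite normrM e12 e23 ler_pM // ger0_norm ?mulr_ge0 ?(ltW i3) ?(ltW d0) //.
    by rewrite ler_wpM2l // ltW.
  have at2 := atan_bound (w z).
  have T1 : `|atan (w z) * (H' (rho z) * (2 * dot3 n z))| <= 6 * wt d z + K.
    rewrite /H' (_ : _ * (_ * _) = atan (w z) * (2 * (- (3 / 2) * (X0 (rho z) * (d * (isq 5 t * dot3 n z))) + d * isq 3 t * X1 (rho z) * dot3 n z))); last by rewrite -/t; ring.
    have h5 : `|isq 5 t * dot3 n z| <= isq 4 t.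
      by rewrite normrM (gtr0_norm i5) e45 ler_wpM2l // ltW.
    have h6 : `|X0 (rho z) * (d * (isq 5 t * dot3 n z))| <= wt d z.
      by rewrite normrM (ger0_norm x0) ler_wpM2l // normrM (gtr0_norm d0) ler_wpM2l // ltW.
    rewrite normrM (_ : 6 * wt d z + K = 2 * (2 * (3 / 2 * wt d z + B * isq 1 a))); last by rewrite /K; field.
    rewrite ler_pM // normrM ger0_norm // ler_wpM2l // (le_trans (ler_normD _ _)) // lerD //.
    have h32 : 0 <= 3 / 2 :> R by lra.
    by rewrite normrM normrN (ger0_norm h32) ler_wpM2l.
  have ie : 0 < ep^-1 by rewrite invr_gt0.
  have w0 : 0 <= (1 + w z ^+ 2)^-1 by rewrite invr_ge0 addr_ge0 // sqr_ge0.
  have Hz : H (rho z) * isq 1 t = wt d z.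
    rewrite /H /wt -/t (_ : isq 4 t = isq 3 t * isq 1 t); last by rewrite isqD.
    by ring.
  have diff : isq 1 t - dot3 n z ^+ 2 * isq 3 t = isq 1 t * (1 - dot3 n z ^+ 2 * isq 2 t).
    rewrite (_ : isq 3 t = isq 1 t * isq 2 t); last by rewrite isqD.
    by ring.
  have n2 : dot3 n z ^+ 2 * isq 2 t <= 1.
    rewrite isq2 // ler_pdivrMr // mul1r (le_trans nz) // /t lerDl; exact: ltW.
  have P0 : 0 <= psi1 z.
    have h0 : 0 <= H (rho z) by rewrite /H !mulr_ge0 // ltW.
    rewrite /psi1 -/t diff; apply: mulr_ge0 => //; apply: mulr_ge0 => //; apply: mulr_ge0; first exact: ltW.
    by apply: mulr_ge0; [exact: ltW | rewrite subr_ge0].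
  move: T1; rewrite ler_norml => /andP[T1 _].
  have ep3 : 0 <= 3 * ep by lra.
  have [out|ins] := ltP (ep ^+ 2 * rho z) (dot3 n z ^+ 2).
    rewrite gcone // normr0 mulr_ge0 //; lra.
  suff : wt d z <= 3 * ep * psi1 z.
    move=> h; have := mulr_ge0 ep3 (_ : 0 <= atan (w z) * (H' (rho z) * (2 * dot3 n z)) + (6 * wt d z + K)).
    by move=> h'; have := h' ltac:(lra); lra.
  have n4 : dot3 n z ^+ 2 * isq 2 t <= 4^-1.
    rewrite isq2 // ler_pdivrMr // (le_trans ins) //.
    have h2 : ep ^+ 2 <= 4^-1.
      by rewrite (_ : 4^-1 = 2^-1 ^+ 2 :> R); [rewrite lerXn2r ?nnegrE // ltW | field].
    apply: (@le_trans _ _ (4^-1 * rho z)); first by rewrite ler_wpM2r.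
    by rewrite ler_wpM2l // /t lerDl ltW.
  have w1 : w z ^+ 2 <= 1.
    rewrite /w -/t !exprMn (_ : isq 1 t ^+ 2 = isq 2 t); last by rewrite expr2 isqD.
    rewrite exprVn mulrC ler_pdivrMr ?exprn_gt0 // mul1r isq2 // ler_pdivrMr // (le_trans ins) //.
    by rewrite ler_wpM2l ?sqr_ge0 // /t lerDl ltW.
  have wi : 2^-1 <= (1 + w z ^+ 2)^-1.
    by rewrite lef_pV2 ?posrE // ?ltr_wpDr ?sqr_ge0 //; lra.
  rewrite /psi1 -/t diff (_ : 3 * ep * _ = 3 * ((1 + w z ^+ 2)^-1 * (1 - dot3 n z ^+ 2 * isq 2 t)) * (H (rho z) * isq 1 t)); last first.
    have := gt_eqF ep0; move: (H _) (isq _ _) (isq _ _) ((1 + _)^-1) (dot3 n z) => A I1 I2 V q0 epn.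
    by field; rewrite epn.
  rewrite Hz ler_peMl //.
  have : 2^-1 * (3 / 4) <= (1 + w z ^+ 2)^-1 * (1 - dot3 n z ^+ 2 * isq 2 t) by rewrite ler_pM //; lra.
  by lra.
apply: (le_trans (Int_le_norm m0 bg _ (fun y _ => key y))).
  by apply: bddM => //; exact: bdd_cst.
rewrite (IntZ m0) // (IntD m0 bf); last first.
  by apply: bddD; [apply: bddM => //; exact: bdd_cst | exact: bdd_cst].
rewrite If add0r (IntD m0); [|by apply: bddM => //; exact: bdd_cst|exact: bdd_cst].
rewrite (IntZ m0) // Int_cst.
have h := HA p d pm d0.
have : 6 * Int m (fun y => wt d (y - p)) + 8 * K <= 6 * CA + 8 * K by rewrite lerD2r ler_wpM2l.
have ep3 : 0 <= 3 * ep by lra.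
by move=> /(ler_wpM2l ep3); rewrite -/K; lra.
Qed.

End ConeMass.

(** * Boundary charts and the extension by zero *)

Section BoundaryGeometry.
Context {R : realType}.
Notation P := (R * R * R)%type.
Implicit Types (x y z s v w n l : P) (A B D : set P) (f u phi : P -> R) (d e r : R).

Lemma grad3E f : grad3 f = fun x => (Dv (@e1 R) f x, Dv (@e2 R) f x, Dv (@e3 R) f x).
Proof. by apply/funext => x; rewrite /grad3 -!DvE. Qed.

Lemma Dv_grad3 f x v : dif f x -> Dv v f x = dot3 (grad3 f x) v.
Proof.
move=> df; rewrite Dv_coord // /dot3 grad3E.
by move: (Dv (@e1 R) f x) (Dv (@e2 R) f x) (Dv (@e3 R) f x) => a b c; rewrite /=; ring.
Qed.

Lemma cont_triple (a b c : P -> R) x : {for x, continuous a} -> {for x, continuous b} -> {for x, continuous c} ->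
  {for x, continuous (fun y => (a y, b y, c y))}.
Proof. by move=> ca cb cc; exact: (cvg_pair (cvg_pair ca cb) cc). Qed.

Lemma C1_on_Ck A f : open A -> C1_on A f -> Ck 1 A f.
Proof.
move=> oA h; split=> [x Ax|v]; first by have [] := h x Ax.
apply: (@Ck_ext _ _ 0 A (fun y => dot3 v (grad3 f y))) => //.
  by move=> y Ay; rewrite Dv_grad3 ?(dot3C v) //; have [] := h y Ay.
move=> x Ax; have [_ cg] := h x Ax.
by apply: (@continuous_comp _ _ _ (grad3 f) (dot3 v)) => //; exact: dot3_cont.
Qed.

Lemma Ck_C1_on A f : open A -> Ck 1 A f -> C1_on A f.
Proof.
move=> oA [df Df] x Ax; split; first exact: df.
by rewrite grad3E; apply: cont_triple; exact: Df.
Qed.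

Lemma C2_on_Ck A f : open A -> C2_on A f -> Ck 2 A f.
Proof.
move=> oA [h0 [h1 [h2 h3]]]; have c0' := C1_on_Ck oA h0.
have k1 : Ck 1 A (Dv (@e1 R) f) by rewrite DvEfun; exact: (C1_on_Ck oA h1).
have k2 : Ck 1 A (Dv (@e2 R) f) by rewrite DvEfun; exact: (C1_on_Ck oA h2).
have k3 : Ck 1 A (Dv (@e3 R) f) by rewrite DvEfun; exact: (C1_on_Ck oA h3).
split=> [x Ax|v]; first exact: (Ck_dif c0').
apply: (Ck_ext (f := fun x => v.1.1 * Dv (@e1 R) f x + v.1.2 * Dv (@e2 R) f x + v.2 * Dv (@e3 R) f x)) => //.
  by move=> x Ax; rewrite -Dv_coord //; exact: (Ck_dif c0').
by exact: (CkD oA (CkD oA (CkZ _ oA k1) (CkZ _ oA k2)) (CkZ _ oA k3)).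
Qed.

Lemma Ck_C2_on A f : open A -> Ck 2 A f -> C2_on A f.
Proof.
move=> oA h; split; first by apply: Ck_C1_on => //; exact: CkS.
by split; [|split]; rewrite -DvEfun; apply: Ck_C1_on => //; exact: Ck_Dv.
Qed.

Lemma lap3E f : lap3 f = lapD f.
Proof. by apply/funext => x; rewrite /lap3 /lapD !DvEfun. Qed.

Lemma bdry_within_proper D s : bdry D s -> ProperFilter (within D (nbhs s)).
Proof. by move=> [cs _]; apply: within_nbhs_proper. Qed.

(** A defining function on a ball about s that grows at rate at least m1 in the fixed direction n,
    the normal at s, and whose gradient at s is g n. *)
Definition chart D n s phi r m1 g :=
  [/\ 0 < r, 0 < m1, Ck 1 [set x | `|x - s| < r] phi, 0 < g & phi s = 0] /\
  [/\ forall x, `|x - s| < r -> (D x <-> phi x < 0),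
      forall x, `|x - s| < r -> (bdry D x <-> phi x = 0),
      forall x, `|x - s| < r -> m1 <= Dv n phi x &
      forall v, Dv v phi s = g * dot3 n v].

Lemma dist_cont s x : {for x, continuous (fun y : P => `|y - s|)}.
Proof. by apply: cvg_norm; apply: cvgB; [exact: cvg_id | exact: cvg_cst]. Qed.

Lemma open_dist s r : open [set x : P | `|x - s| < r].
Proof.
apply: (@open_comp _ _ (fun y : P => `|y - s|) [set t | t < r]); last exact: open_lt.
by move=> z _; exact: dist_cont.
Qed.

Lemma near_dist s r : 0 < r -> \forall x \near s, `|x - s| < r.
Proof.
move=> r0; apply/nbhs_ballP; exists r => //= x.
by rewrite -ball_normE /= distrC.
Qed.

Lemma near_distP s (Q : P -> Prop) : (\forall x \near s, Q x) -> exists2 r, 0 < r & forall x, `|x - s| < r -> Q x.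
Proof.
move=> /nbhs_ballP[r /= r0 H]; exists r => // x xr; apply: H.
by rewrite -ball_normE /= distrC.
Qed.

Lemma boundary_chart D N s : C1_boundary_outward_normal D N -> bdry D s ->
  rho (N s) = 1 /\ exists phi r m1 g, chart D (N s) s phi r m1 g.
Proof.
move=> hN bs; have [A [phi [oA As C1 G [ED EB EN]]]] := hN s bs.
have c1 := C1_on_Ck oA C1; have ds : dif phi s := Ck_dif c1 As.
set G0 := grad3 phi s in EN.
have G0n : G0 != 0 by apply/eqP => h; have := G s As bs; rewrite -/G0 h.
have G00 : 0 < rho G0 by exact: rho_gt0.
have q0 : 0 < enorm3 G0 by rewrite sqrtr_gt0.
have NE : N s = (enorm3 G0)^-1 *: G0 by rewrite EN.
have q2 : rho G0 = enorm3 G0 * enorm3 G0 by rewrite -expr2 sqr_sqrtr // ltW.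
have DE v : Dv v phi s = enorm3 G0 * dot3 (N s) v.
  by rewrite NE dot3Zl mulVKf ?gt_eqF // Dv_grad3.
have n1 : rho (N s) = 1.
  rewrite NE /rho dot3Zl dot3C dot3Zl -/(rho G0) q2 mulKf ?gt_eqF //.
  by rewrite mulVf // gt_eqF.
split=> //.
have cD : {for s, continuous (Dv (N s) phi)} by exact: (Ck_cont (Ck_Dv (N s) c1) As).
have Ds : Dv (N s) phi s = enorm3 G0 by rewrite DE -/(rho _) n1 mulr1.
have N1 : \forall x \near s, enorm3 G0 / 2 < Dv (N s) phi x.
  apply: (cD [set t | enorm3 G0 / 2 < t]); apply: lt_nbhsr.
  by rewrite Ds ltr_pdivrMr // ltr_pMr // ltr1n.
have [r1 r10 H1] := near_distP N1.
have [r2 r20 H2] := open_normP oA As.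
pose r := Num.min r1 r2.
have rr1 x : `|x - s| < r -> `|x - s| < r1 by rewrite lt_min => /andP[].
have rr2 x : `|x - s| < r -> A x by rewrite lt_min => /andP[_ /H2].
exists phi, r, (enorm3 G0 / 2), (enorm3 G0); split.
  split=> //; [by rewrite lt_min r10 | by rewrite divr_gt0 | exact: (Ck_sub rr2 c1) |].
  by have : (bdry D `&` A) s by []; rewrite EB => -[].
split=> // x xr; have Ax := rr2 x xr.
- split=> h; first by have : (D `&` A) x by []; rewrite ED => -[].
  by have : [set x | A x /\ phi x < 0] x by []; rewrite -ED => -[].
- split=> h; first by have : (bdry D `&` A) x by []; rewrite EB => -[].
  by have : [set x | A x /\ phi x = 0] x by []; rewrite -EB => -[].
- by apply/ltW/H1/rr1.
Qed.

Section Exit.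
Variables (D : set P) (n s : P) (phi : P -> R) (r m1 g : R).
Hypotheses (n1 : rho n = 1) (ch : chart D n s phi r m1 g).

Let r0 : 0 < r. Proof. by case: ch => -[]. Qed.
Let m10 : 0 < m1. Proof. by case: ch => -[]. Qed.
Let C1 : Ck 1 [set x | `|x - s| < r] phi. Proof. by case: ch => -[]. Qed.
Let phis : phi s = 0. Proof. by case: ch => -[]. Qed.

Lemma norm_unit : `|n| <= 1.
Proof. by rewrite -(@expr_le1 _ 2) // -n1 norm_rho. Qed.

Lemma normal_line x (t : R) : `|x - s| < r / 2 -> `|t| <= r / 2 -> `|x + t *: n - s| < r.
Proof.
move=> xs tr; rewrite addrAC (le_lt_trans (ler_normD _ _)) // normrZ.
have : `|t| * `|n| <= r / 2 by rewrite -[leRHS]mulr1 ler_pM // norm_unit.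
by lra.
Qed.

Lemma normal_growth x (t t' : R) : `|x - s| < r / 2 -> 0 <= t -> t < t' -> t' <= r / 2 ->
  phi (x + t *: n) + m1 * (t' - t) <= phi (x + t' *: n).
Proof.
move=> xs t0 tt' t'r.
have inB (q : R) : 0 <= q <= 1 -> `|x + t *: n + q *: ((t' - t) *: n) - s| < r.
  move=> /andP[q0 q1]; rewrite scalerA -(addrA x) -scalerDl; apply: normal_line => //.
  have h : 0 <= q * (t' - t) by rewrite mulr_ge0 // subr_ge0 ltW.
  have : q * (t' - t) <= 1 * (t' - t) by rewrite ler_wpM2r // subr_ge0 ltW.
  by rewrite ger0_norm ?addr_ge0 //; lra.
have [||q q01 E] := @MVT_line _ _ phi (x + t *: n) ((t' - t) *: n).
- by move=> q /andP[q0 q1]; apply: (Ck_dif C1); apply: inB; rewrite !ltW.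
- by move=> q q01; apply: (Ck_cont C1); exact: inB.
have Bq : `|x + t *: n + q *: ((t' - t) *: n) - s| < r.
  by apply: inB; have /andP[q0 q1] := q01; rewrite !ltW.
have EE : x + t *: n + (t' - t) *: n = x + t' *: n by rewrite -(addrA x) -scalerDl (addrC t) subrK.
rewrite EE Dv_scalev in E; last exact: (Ck_dif C1).
rewrite -lerBrDl E mulrC ler_wpM2l ?subr_ge0 ?(ltW tt') //.
by case: ch => _ [_ _ H _]; exact: H.
Qed.

(** Along the line x + t n the function phi increases at rate at least m1, so it has a single zero
    there, found by the intermediate value theorem at distance at most - phi x / m1. Before it the
    line is in D, after it outside the closure of D. *)
Lemma exit_exists x : `|x - s| < r / 2 -> D x -> - phi x < m1 * (r / 2) ->
  exists d, [/\ 0 < d, m1 * d <= - phi x, d < r / 2 & bdry D (x + d *: n)] /\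
    ((forall t, 0 <= t -> t < d -> D (x + t *: n)) /\
     (forall t, d < t -> t <= r / 2 -> ~ D (x + t *: n) /\ ~ bdry D (x + t *: n))).
Proof.
have r0' := r0; move=> xs Dx phix; have [_ [HD HB _ _]] := ch.
have inB (t : R) : 0 <= t -> t <= r / 2 -> `|x + t *: n - s| < r.
  by move=> t0 tr; apply: normal_line => //; rewrite ger0_norm.
have x0 : x + 0 *: n = x by rewrite scale0r addr0.
have px : phi x < 0 by rewrite -x0; apply/HD; rewrite ?x0 //; move: xs; lra.
pose T := - phi x / m1.
have T0 : 0 < T by rewrite divr_gt0 // oppr_gt0.
have Tr : T < r / 2 by rewrite ltr_pdivrMr // mulrC.
have mT : m1 * T = - phi x by rewrite /T mulrC divfK // gt_eqF.
have pT : 0 <= phi (x + T *: n).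
  have := normal_growth xs (lexx 0) T0 (ltW Tr); rewrite x0 subr0 mT; lra.
have cf (t : R) : t \in `[0, T] -> {for t, continuous (fun t : R => phi (x + t *: n))}.
  rewrite in_itv /= => /andP[t0 tT]; apply: differentiable_continuous.
  have B : `|x + t *: n - s| < r by apply: inB => //; lra.
  have [dd _] := line_derive (Ck_dif C1 B).
  exact/derivable1_diffP.
have [||d] := @IVT R (fun t : R => phi (x + t *: n)) 0 T 0 (ltW T0).
- apply: derivable_within_continuous => t tT.
  have B : `|x + t *: n - s| < r.
    by move: tT; rewrite in_itv /= => /andP[h1 h2]; apply: inB => //; lra.
  by have [] := line_derive (Ck_dif C1 B).
- by rewrite x0 ge_min le_max (ltW px) pT orbT.
rewrite in_itv /= => /andP[d0 dT] pd.
have {}d0 : 0 < d.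
  by rewrite lt_neqAle d0 andbT; apply/eqP => h; move: pd; rewrite -h x0 => h'; move: px; rewrite h' ltxx.
have dr : d < r / 2 by lra.
exists d; split; first split=> //.
- by rewrite -mT ler_wpM2l // ltW.
- by apply/HB => //; apply: inB => //; exact: ltW.
split=> t.
  move=> t0 td; apply/HD; first by apply: inB => //; lra.
  have := normal_growth xs t0 td (ltW dr); rewrite pd.
  have : 0 < m1 * (d - t) by rewrite mulr_gt0 // subr_gt0.
  lra.
move=> dt tr; have t0 : 0 <= t by lra.
have B : `|x + t *: n - s| < r by exact: inB.
have p0 : 0 < phi (x + t *: n).
  have := normal_growth xs (ltW d0) dt tr; rewrite pd.
  have : 0 < m1 * (t - d) by rewrite mulr_gt0 // subr_gt0.
  lra.
split=> [/(HD _ B)|/(HB _ B)]; first by rewrite ltNge (ltW p0).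
by move=> h; move: p0; rewrite h ltxx.
Qed.

Lemma chart_lipschitz : exists2 C, 0 <= C & \forall x \near s, `|phi x| <= C * `|x - s|.
Proof.
have ds : dif phi s by apply: (Ck_dif C1); rewrite /= subrr normr0.
have [_ [_ _ _ Dp]] := ch.
exists (3 * `|g *: n| + 1); first by rewrite addr_ge0 // mulr_ge0.
have /near_distP[q q0 H] := dif_approx ds ltr01.
apply: filterS (near_dist s q0) => x xq.
have := H (x - s); rewrite subr0 => /(_ xq); rewrite subrK phis subr0 mul1r Dp -dot3Zl => h.
have := dot3_le (g *: n) (x - s).
have : `|phi x| <= `|phi x - dot3 (g *: n) (x - s)| + `|dot3 (g *: n) (x - s)|.
  by rewrite -{1}(subrK (dot3 (g *: n) (x - s)) (phi x)) ler_normD.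
lra.
Qed.

(** Since phi s = 0 and phi is differentiable at s, |phi x| = O(|x - s|); with the rate m1 this
    bounds the exit distance. *)
Lemma exit_near : exists2 C, 0 <= C & forall e, 0 < e -> e <= r / 2 -> \forall x \near s, D x ->
  exists d, [/\ 0 < d, d < e, d <= C * `|x - s| & bdry D (x + d *: n)] /\
    ((forall t, 0 <= t -> t < d -> D (x + t *: n)) /\
     (forall t, d < t -> t <= r / 2 -> ~ D (x + t *: n) /\ ~ bdry D (x + t *: n))).
Proof.
have [C C0 HC] := chart_lipschitz.
exists (C / m1); first by rewrite divr_ge0 // ltW.
move=> e e0 er.
have r20 : 0 < r / 2 by rewrite divr_gt0.
pose q := m1 * e / (C + 1).
have C10 : 0 < C + 1 by lra.
have q0 : 0 < q by rewrite divr_gt0 ?mulr_gt0.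
apply: filterS3 (near_dist s r20) (near_dist s q0) HC => x xr xq xC Dx.
have pq : `|phi x| < m1 * e.
  apply: (le_lt_trans xC); move: xq; rewrite /q ltr_pdivlMr //.
  by have := normr_ge0 (x - s); lra.
have pm : - phi x <= `|phi x| by rewrite -normrN ler_norm.
have [|d [[d0 dp dr bd] H]] := exit_exists xr Dx.
  by apply: (le_lt_trans pm); apply: (lt_le_trans pq); rewrite ler_wpM2l // ltW.
exists d; split=> //; split=> //.
  by rewrite -(ltr_pM2l m10); apply: (le_lt_trans dp); exact: le_lt_trans pm pq.
rewrite mulrAC ler_pdivlMr // mulrC; apply: (le_trans dp); exact: le_trans pm xC.
Qed.

End Exit.
End BoundaryGeometry.

(** * Functions with zero Cauchy data near the boundary *)

Section ZeroExtension.
Context {R : realType}.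
Notation P := (R * R * R)%type.
Implicit Types (x y z s v w n l : P) (f : P -> R) (d e r : R).
Variables (D : set P) (N : P -> P).
Hypotheses (oD : open D) (hN : C1_boundary_outward_normal D N).

Lemma normal_derivE f s l : bdry D s -> grad3 f @ within D (nbhs s) --> l ->
  normal_deriv D N f s = dot3 l (N s).
Proof.
move=> bs cl; have PF := bdry_within_proper bs.
rewrite /normal_deriv dot3C; apply: cvg_lim => //.
rewrite (_ : (fun x => _) = dot3 (N s) \o grad3 f); last by apply/funext => x; rewrite /= dot3C.
by apply: (@cvg_comp _ _ _ _ _ _ (nbhs l)) => //; exact: dot3_cont.
Qed.

Lemma grad_within f s l v e : Ck 1 D f -> grad3 f @ within D (nbhs s) --> l -> 0 < e ->
  \forall x \near s, D x -> `|Dv v f x - dot3 l v| <= e.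
Proof.
move=> h cl e0.
have C : dot3 v \o grad3 f @ within D (nbhs s) --> dot3 v l.
  by apply: (@cvg_comp _ _ _ _ _ _ (nbhs l)) => //; exact: dot3_cont.
have /cvgrPdist_le /(_ e e0) := C; rewrite near_withinE; apply: filterS => x H Dx.
have df := Ck_dif h Dx; rewrite (Dv_grad3 v df) (dot3C _ v) (dot3C l v) distrC.
by move: (H Dx); rewrite [(_ \o _) x]/=.
Qed.

Lemma zero_near f s e : zero_on_bdry D f -> bdry D s -> 0 < e ->
  exists2 q, 0 < q & forall x, `|x - s| < q -> D x -> `|f x| <= e.
Proof.
move=> h bs e0; have /cvgrPdist_le /(_ e e0) := h s bs.
rewrite near_withinE => /near_distP[q q0 H]; exists q => // x xq Dx.
by have := H x xq Dx; rewrite sub0r normrN.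
Qed.

(** The small derivative in the direction N s is integrated from x up to the exit point, where f
    tends to 0, over a distance at most C |x - s|. *)
Lemma small_near_boundary f s : bdry D s -> Ck 1 D f -> zero_on_bdry D f ->
  (forall e, 0 < e -> \forall x \near s, D x -> `|Dv (N s) f x| <= e) ->
  exists2 C, 0 <= C & forall e, 0 < e -> \forall x \near s, D x -> `|f x| <= C * `|x - s| * e.
Proof.
move=> bs h z0 Hn; have [n1 [phi [r [m1 [g ch]]]]] := boundary_chart hN bs.
have r0 : 0 < r by case: ch => -[].
have [C C0 HC] := exit_near n1 ch; exists C => // e e0.
have /near_distP[q q0 Hq] := Hn e e0.
have q20 : 0 < q / 2 by rewrite divr_gt0.
pose e' := Num.min (q / 2) (r / 2).
have e'0 : 0 < e' by rewrite lt_min q20 divr_gt0.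
have e'r : e' <= r / 2 by rewrite ge_min lexx orbT.
apply: filterS2 (near_dist s q20) (HC e' e'0 e'r) => x xq Hx Dx.
have [d [[d0 de dC bp] [Hin _]]] := Hx Dx.
have dq : d < q / 2 by move: de; rewrite lt_min => /andP[].
have nn := norm_unit n1.
have seg (t : R) : 0 <= t -> t < d -> `|x + t *: N s - s| < q.
  move=> t0 td; rewrite addrAC (le_lt_trans (ler_normD _ _)) // normrZ ger0_norm //.
  have : t * `|N s| <= t * 1 by rewrite ler_wpM2l.
  lra.
suff H : `|f x| <= d * e by apply: (le_trans H); rewrite ler_wpM2r // ltW.
apply/ler_addgt0Pr => e2 e20.
have [q' q'0 Hq'] := zero_near z0 bp e20.
(* Boundary values of f are limits from inside D only, so the segment stops short of the exit point,
   where |f| <= e2, and e2 is arbitrary. *)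
pose mm := Num.min (d / 2) (q' / 2).
have mm0 : 0 < mm by rewrite lt_min !divr_gt0.
have mmd : mm <= d / 2 by rewrite ge_min lexx.
have mmq : mm <= q' / 2 by rewrite ge_min lexx orbT.
pose t := d - mm.
have t0 : 0 < t by rewrite /t; lra.
have td : t < d by rewrite /t; lra.
have fe : `|f (x + t *: N s)| <= e2.
  apply: Hq'; last by apply: Hin => //; exact: ltW.
  rewrite opprD addrACA subrr add0r -scalerBl normrZ.
  have : `|t - d| * `|N s| <= mm * 1.
    by rewrite ler_pM // /t addrAC subrr add0r normrN gtr0_norm.
  lra.
have sc (a : R) : 0 <= a <= 1 -> 0 <= a * t /\ a * t < d.
  move=> /andP[a0 a1]; split; first by rewrite mulr_ge0 // ltW.
  by apply: (le_lt_trans _ td); rewrite ler_piMl // ltW.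
have [||a a01 E] := @MVT_line _ _ f x (t *: N s).
- move=> a /andP[a0 a1]; have [|b0 b1] := sc a; first by rewrite (ltW a0) (ltW a1).
  by rewrite scalerA; apply: (Ck_dif h); exact: Hin.
- by move=> a a01; have [b0 b1] := sc a a01; rewrite scalerA; apply: (Ck_cont h); exact: Hin.
have {}a01 : 0 <= a <= 1 by case/andP: a01 => a0 a1; rewrite (ltW a0) (ltW a1).
have [b0 b1] := sc a a01; rewrite scalerA in E.
rewrite Dv_scalev in E; last by apply: (Ck_dif h); exact: Hin.
have B := Hq _ (seg _ b0 b1) (Hin _ b0 b1).
have : `|f x| <= `|f (x + t *: N s)| + `|f (x + t *: N s) - f x|.
  by rewrite -{1}(subKr (f (x + t *: N s)) (f x)) ler_normB.
rewrite E normrM gtr0_norm //.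
have : t * `|Dv (N s) f (x + (a * t) *: N s)| <= d * e by rewrite ler_pM // ltW.
lra.
Qed.

(** First-order expansion of the defining function: phi (s + t v) = t g N.v + o(t), which is
    negative for small t > 0. *)
Lemma inward_segment s v : bdry D s -> dot3 (N s) v < 0 ->
  exists2 T, 0 < T & forall t, 0 < t -> t <= T -> D (s + t *: v).
Proof.
move=> bs nv; have [n1 [phi [r [m1 [g [[r0 m10 C1 g0 p0] [HD _ _ Dp]]]]]]] := boundary_chart hN bs.
have ds : dif phi s by apply: (Ck_dif C1); rewrite /= subrr normr0.
have v1 : 0 < `|v| + 1 by rewrite ltr_wpDl.
have e0 : 0 < g * - dot3 (N s) v / (`|v| + 1) by rewrite divr_gt0 // mulr_gt0 // oppr_gt0.
have /near_distP[q q0 Hq] := dif_approx ds e0.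
pose qq := Num.min q r.
have qq0 : 0 < qq by rewrite lt_min q0.
exists (qq / (`|v| + 1)); first by rewrite divr_gt0.
move=> t t0 tT.
have tv : `|t *: v| < qq.
  rewrite normrZ gtr0_norm //; move: tT; rewrite ler_pdivlMr //.
  have := normr_ge0 v; lra.
have tq : `|t *: v - 0| < q by rewrite subr0; move: tv; rewrite lt_min => /andP[].
have tr : `|s + t *: v - s| < r by rewrite addrAC subrr add0r; move: tv; rewrite lt_min => /andP[].
apply/HD => //; have := Hq _ tq; rewrite (addrC (t *: v)) p0 subr0 Dp dot3C dot3Zl dot3C normrZ gtr0_norm //.
rewrite ler_norml => /andP[_].
have X0 : 0 < g * - dot3 (N s) v by rewrite mulr_gt0 // oppr_gt0.
have : g * - dot3 (N s) v / (`|v| + 1) * (t * `|v|) < g * - dot3 (N s) v * t.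
  set X := g * _ in X0 *.
  by rewrite mulrAC ltr_pdivrMr // -(mulrA X t) (ltr_pM2l X0) (ltr_pM2l t0) ltrDl.
lra.
Qed.

(* The limit l of the gradient is orthogonal to N s by hypothesis; and l.v = 0 for inward v, because
   |f| <= C |x - s| sup |D_N f| is o(|x - s|). *)
Lemma grad_vanish f s : bdry D s -> Ck 1 D f -> zero_on_bdry D f -> grad_up_to_bdry D f ->
  normal_deriv D N f s = 0 -> forall v e, 0 < e -> \forall x \near s, D x -> `|Dv v f x| <= e.
Proof.
move=> bs h z0 gb nd; have [l cl] := gb s bs.
have ln : dot3 l (N s) = 0 by rewrite -(normal_derivE bs cl).
have [n1 _] := boundary_chart hN bs.
have [|C C0 HC] := small_near_boundary bs h z0.
  by move=> e e0; have := grad_within (N s) h cl e0; rewrite ln; apply: filterS => x H /H; rewrite subr0.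
have key v : dot3 (N s) v < 0 -> dot3 l v = 0.
  move=> nv; have [T T0 HT] := inward_segment bs nv.
  apply/eqP; rewrite -normr_le0; apply/ler_addgt0Pr => e2 e20; rewrite add0r.
  pose K := 1 + 4 * C * `|v|.
  have K0 : 0 < K by rewrite ltr_wpDr // !mulr_ge0.
  pose e := e2 / K; have e0 : 0 < e by rewrite divr_gt0.
  have /near_distP[q1 q10 H1] := grad_within v h cl e0.
  have /near_distP[q2 q20 H2] := HC e e0.
  pose q := Num.min q1 q2; have q0 : 0 < q by rewrite lt_min q10.
  have v1 : 0 < `|v| + 1 by rewrite ltr_wpDl.
  pose t := Num.min T (q / (2 * (`|v| + 1))).
  have t0 : 0 < t by rewrite lt_min T0 divr_gt0 // mulr_gt0.
  have tT : t <= T by rewrite ge_min lexx.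
  have tv : t * `|v| < q.
    have : t <= q / (2 * (`|v| + 1)) by rewrite ge_min lexx orbT.
    rewrite ler_pdivlMr ?mulr_gt0 //.
    by have := mulr_ge0 (ltW t0) (normr_ge0 v); lra.
  have near (b : R) : 0 < b -> b <= t -> `|s + b *: v - s| < q1 /\ `|s + b *: v - s| < q2.
    move=> b0 bt; have : `|s + b *: v - s| < q.
      rewrite addrAC subrr add0r normrZ gtr0_norm //; apply: le_lt_trans tv.
      by rewrite ler_wpM2r.
    by rewrite lt_min => /andP.
  have inD (b : R) : 0 < b -> b <= t -> D (s + b *: v).
    by move=> b0 bt; apply: HT => //; exact: le_trans tT.
  have t20 : 0 < t / 2 by rewrite divr_gt0.
  have t2t : t / 2 <= t by lra.
  have E0 (a : R) : s + (t / 2) *: v + a *: ((t / 2) *: v) = s + (t / 2 + a * (t / 2)) *: v.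
    by rewrite scalerA -(addrA s) -scalerDl.
  have sc (a : R) : 0 <= a <= 1 -> 0 < t / 2 + a * (t / 2) /\ t / 2 + a * (t / 2) <= t.
    move=> /andP[a0 a1]; have h1 : 0 <= a * (t / 2) by rewrite mulr_ge0 // ltW.
    have : a * (t / 2) <= 1 * (t / 2) by rewrite ler_wpM2r // ltW.
    by split; lra.
  have [||a a01 E] := @MVT_line _ _ f (s + (t / 2) *: v) ((t / 2) *: v).
  - move=> a /andP[a0 a1]; have [|b0 b1] := sc a; first by rewrite (ltW a0) (ltW a1).
    by rewrite E0; apply: (Ck_dif h); exact: inD.
  - by move=> a a01; have [b0 b1] := sc a a01; rewrite E0; apply: (Ck_cont h); exact: inD.
  have {}a01 : 0 <= a <= 1 by case/andP: a01 => a0 a1; rewrite (ltW a0) (ltW a1).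
  have [b0 b1] := sc a a01; rewrite E0 in E.
  have E1 : s + (t / 2) *: v + (t / 2) *: v = s + t *: v.
    by rewrite -(addrA s) -scalerDl -splitr.
  rewrite E1 Dv_scalev in E; last by apply: (Ck_dif h); exact: inD.
  have [n1' _] := near _ b0 b1; have [_ nt] := near _ t0 (lexx t); have [_ nt2] := near _ t20 t2t.
  have A1 := H1 _ n1' (inD _ b0 b1).
  have A2 := H2 _ nt (inD _ t0 (lexx t)).
  have A3 := H2 _ nt2 (inD _ t20 t2t).
  have nE (b : R) : 0 < b -> `|s + b *: v - s| = b * `|v|.
    by move=> b0'; rewrite addrAC subrr add0r normrZ gtr0_norm.
  rewrite nE // in A2; rewrite nE // in A3.
  have A4 : t / 2 * `|Dv v f (s + (t / 2 + a * (t / 2)) *: v)| <= C * (t * `|v|) * e + C * (t / 2 * `|v|) * e.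
    rewrite -[X in X * `|_| <= _](gtr0_norm t20) -normrM -E.
    by apply: (le_trans (ler_normB _ _)); rewrite lerD.
  set w := Dv v f _ in A1 A4.
  have A5 : `|w| <= 4 * C * `|v| * e.
    rewrite -(ler_pM2l t20); apply: (le_trans A4).
    have : 0 <= C * (t * `|v|) * e by exact: (mulr_ge0 (mulr_ge0 C0 (mulr_ge0 (ltW t0) (normr_ge0 v))) (ltW e0)).
    lra.
  have : `|dot3 l v| <= `|w| + `|w - dot3 l v|.
    by rewrite -{1}(subKr w (dot3 l v)) ler_normB.
  have : K * e = e2 by rewrite /e mulrC divfK // gt_eqF.
  rewrite /K; lra.
have l0 v : dot3 l v = 0.
  (* As l is orthogonal to N s, subtracting a multiple of N s from v does not change l.v; this
     multiple gives w.N = -1, an inward direction. *)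
  set w := v - (dot3 (N s) v + 1) *: N s.
  have E x : dot3 x w = dot3 x v - (dot3 (N s) v + 1) * dot3 x (N s).
    by rewrite !(dot3C x) /w dot3Dl dot3Nl dot3Zl.
  have := key w; rewrite !E ln mulr0 subr0; apply.
  by rewrite -/(rho (N s)) n1; lra.
move=> v e e0; have := grad_within v h cl e0; rewrite l0.
by apply: filterS => x H /H; rewrite subr0.
Qed.

End ZeroExtension.

(** * Extension by zero and interior regularity *)

Section Regularity.
Context {R : realType}.
Notation P := (R * R * R)%type.
Implicit Types (x y z s v w n l : P) (f : P -> R) (d e r : R).

Lemma small_radius (k q : R) : 0 < k -> 0 < q -> exists a, [/\ 0 < a, 20 * k ^+ 2 * a <= 1 & M0 a <= q].
Proof.
move=> k0 q0; have kk : 0 < 20 * k ^+ 2 by rewrite mulr_gt0 // exprn_gt0.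
have q20 : 0 < q / 2 by rewrite divr_gt0.
pose a := Num.min ((q / 2) ^+ 2) (20 * k ^+ 2)^-1.
exists a; split.
- by rewrite lt_min exprn_gt0 // invr_gt0.
- have : a <= (20 * k ^+ 2)^-1 by rewrite ge_min lexx orbT.
  by move=> /(ler_wpM2l (ltW kk)); rewrite divff // gt_eqF.
have : Num.sqrt a <= q / 2.
  rewrite -[leRHS](gtr0_norm q20) -sqrtr_sqr ler_wsqrtr // ge_min lexx //.
by rewrite /M0; lra.
Qed.

Definition ext (D : set P) f x := \1_D x * f x.

Lemma ext_in D f x : D x -> ext D f x = f x.
Proof. by move=> Dx; rewrite /ext indicT // mul1r. Qed.

Lemma ext_out D f x : ~ D x -> ext D f x = 0.
Proof. by move=> Dx; rewrite /ext indicF // mul0r. Qed.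

Lemma Ck_ext_in j D f : open D -> Ck j D f -> Ck j D (ext D f).
Proof. by move=> oD; apply: Ck_ext => // x Dx; rewrite ext_in. Qed.

Lemma Dv_ext_in D f v x : open D -> D x -> Dv v (ext D f) x = Dv v f x.
Proof. by move=> oD Dx; apply: Dv_near; apply: (near_open oD Dx) => y Dy; exact: ext_in. Qed.

Lemma lapD_ext_in D f x : open D -> D x -> lapD (ext D f) x = lapD f x.
Proof.
move=> oD Dx; rewrite /lapD; congr (_ + _ + _); apply: Dv_near; apply: (near_open oD Dx) => y Dy; exact: Dv_ext_in.
Qed.

Section ExtC1.
Variables (D : set P) (N : P -> P) (f : P -> R).
Hypotheses (oD : open D) (hN : C1_boundary_outward_normal D N).
Hypotheses (f1 : Ck 1 D f) (f0 : zero_on_bdry D f) (fg : grad_up_to_bdry D f).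
Hypothesis fn : forall s, bdry D s -> normal_deriv D N f s = 0.

(** At a boundary point, [small_near_boundary] says that f is o of the distance on D, so the
    extension has differential 0 there; beyond the closure it is locally zero. *)
Lemma ext_dif_out x : ~ D x -> dif (ext D f) x /\ forall v, Dv v (ext D f) x = 0.
Proof.
move=> Dx; have [cx|cx] := pselect (closure D x); last first.
  have oC : open (~` closure D) by apply: closed_openC; exact: closed_closure.
  have Z : \forall y \near x, ext D f y = 0.
    by apply: (near_open oC cx) => y cy; apply: ext_out => Dy; apply: cy; exact: subset_closure.
  split=> [|v]; last by rewrite (Dv_near v Z) Dv_cst.
  by apply: (@dif_near _ _ (fun=> 0)); [apply: filterS Z => y -> | exact: dif_cst].
have bx : bdry D x by [].
have [C C0 HC] := small_near_boundary hN bx f1 f0 (grad_vanish hN bx f1 f0 fg (fn bx) (N x)).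
suff [d Dd] : dif (ext D f) x /\ forall v, Dv v (ext D f) x = dot3 0 v.
  by split=> // v; rewrite Dd /dot3 /= !mul0r !addr0.
apply: dif3P => e e0; have C10 : 0 < C + 1 by lra.
have e'0 : 0 < e / (C + 1) by rewrite divr_gt0.
have /near_distP[q q0 Hq] := HC _ e'0.
apply: filterS (near0_norm q0) => h hq.
rewrite (ext_out _ Dx) /dot3 /= !mul0r !addr0 !subr0.
have [Dh|Dh] := pselect (D (h + x)); last by rewrite ext_out // normr0 mulr_ge0 // ltW.
rewrite ext_in //; have := Hq (h + x); rewrite addrK => /(_ hq Dh) H; apply: (le_trans H).
rewrite mulrAC ler_wpM2r // mulrC mulrAC ler_pdivrMr //.
by rewrite ler_wpM2l ?(ltW e0) //; lra.
Qed.

Lemma ext_Ck1 : Ck 1 setT (ext D f).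
Proof.
split=> [x _|v x _].
  have [Dx|Dx] := pselect (D x); last by have [] := ext_dif_out Dx.
  exact: (Ck_dif (Ck_ext_in oD f1)).
have [Dx|Dx] := pselect (D x); first exact: (Ck_cont (Ck_Dv v (Ck_ext_in oD f1))).
have [_ D0] := ext_dif_out Dx.
have [cx|cx] := pselect (closure D x).
  have bx : bdry D x by [].
  suff : Dv v (ext D f) @ x --> (0 : R) by rewrite -(D0 v).
  apply/cvgrPdist_le => e e0.
  apply: filterS (grad_vanish hN bx f1 f0 fg (fn bx) v e0) => y Hy; rewrite sub0r normrN.
  have [Dy|Dy] := pselect (D y); first by rewrite Dv_ext_in //; exact: Hy.
  by have [_ ->] := ext_dif_out Dy; rewrite normr0 ltW.
have oC : open (~` closure D) by apply: closed_openC; exact: closed_closure.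
apply: (@Ck_cont _ _ 0 (~` closure D)) => //; apply: (@Ck_ext _ _ 0 _ (fun=> 0)) => //; last exact: Ck_cst.
by move=> y cy; have [|_ ->] := @ext_dif_out y => // Dy; apply: cy; exact: subset_closure.
Qed.

End ExtC1.

(** What the weak identity requires of a domain and a function with zero Cauchy data. Both the
    extension of u and the half-space solution satisfy it, so their identities can be subtracted. *)
Record helmholtz_pair (D : set P) (k c : R) (V : P -> R) : Prop := HelmholtzPair {
  hp_open : open D;
  hp_out : forall x, ~ D x -> V x = 0;
  hp_Dout : forall x v, ~ D x -> Dv v V x = 0;
  hp_C1 : Ck 1 setT V;
  hp_C2 : Ck 2 D V;
  hp_eq : forall x, D x -> lapD V x + k ^+ 2 * V x = c }.

Lemma ext_helmholtz_pair D N (k c : R) f : open D -> C1_boundary_outward_normal D N -> Ck 2 D f ->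
  grad_up_to_bdry D f -> zero_on_bdry D f -> (forall s, bdry D s -> normal_deriv D N f s = 0) ->
  (forall x, D x -> lapD f x + k ^+ 2 * f x = c) -> helmholtz_pair D k c (ext D f).
Proof.
move=> oD hN f2 fg f0 fn fe; have f1 := CkS f2; split=> //.
- by move=> x; exact: ext_out.
- by move=> x v Dx; have [_ ->] := ext_dif_out hN f1 f0 fg fn Dx.
- exact: (ext_Ck1 oD hN f1 f0 fg fn).
- exact: Ck_ext_in.
- by move=> x Dx; rewrite lapD_ext_in // ext_in // fe.
Qed.

Lemma Ck_local j D f : (forall x, D x -> exists B : set P, [/\ open B, B x & Ck j B f]) -> Ck j D f.
Proof.
elim: j f => [|j IH] f H.
  by move=> x Dx; have [B [oB Bx cf]] := H x Dx; exact: cf.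
split=> [x Dx|v]; first by have [B [oB Bx cf]] := H x Dx; exact: (Ck_dif cf).
by apply: IH => x Dx; have [B [oB Bx cf]] := H x Dx; exists B; split=> //; exact: Ck_Dv.
Qed.

Lemma Int_difference m (V1 V2 : P -> R) (D1 D2 : set P) (c : R) (K G : P -> R) : 0 < m ->
  bdd m V1 -> bdd m V2 -> bdd m K -> bdd m G ->
  Int m (fun y => V1 y * K y) = c * Int m (fun y => \1_D1 y * G y) ->
  Int m (fun y => V2 y * K y) = c * Int m (fun y => \1_D2 y * G y) ->
  Int m (fun y => (V1 y - V2 y) * K y) = Int m (fun y => c * (\1_D1 y - \1_D2 y) * G y).
Proof.
move=> m0 b1 b2 bK bG E1 E2.
rewrite (_ : (fun y => (V1 y - V2 y) * K y) = fun y => V1 y * K y - V2 y * K y); last first.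
  by apply/funext => y; rewrite mulrBl.
rewrite (_ : (fun y => c * _ * G y) = fun y => c * (\1_D1 y * G y - \1_D2 y * G y)); last first.
  by apply/funext => y; rewrite -mulrBl mulrA.
have i1 : bdd m (fun y => \1_D1 y * G y) by apply: bddM => //; exact: bdd_indic.
have i2 : bdd m (fun y => \1_D2 y * G y) by apply: bddM => //; exact: bdd_indic.
rewrite (IntB m0 (bddM b1 bK) (bddM b2 bK)) (IntZ m0 _ (bddB i1 i2)) (IntB m0 i1 i2).
by rewrite E1 E2 mulrBr.
Qed.

Lemma lapD_cst (b : R) x : lapD (fun=> b) x = 0.
Proof.
have E v w : Dv v (Dv w (fun _ : P => b)) x = 0.
  by rewrite (_ : Dv w _ = fun=> 0) ?Dv_cst //; apply/funext => y; rewrite Dv_cst.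
by rewrite /lapD !E !addr0.
Qed.

(** V is compared with the constant c / k^2, a solution on the whole space with source c. The source
    of the difference, c (1_D - 1), vanishes near x, so [hessian_representation] gives C^3
    regularity there. *)
Lemma interior_Ck3 D (k c : R) V : 0 < k -> helmholtz_pair D k c V -> Ck 3 D V.
Proof.
move=> k0 hp; apply: Ck_local => x Dx.
have [oD V0 DV0 V1 V2 Ve] := hp.
have [q q0 Hq] := open_normP oD Dx.
have q40 : 0 < q / 4 by rewrite divr_gt0.
have [a [a0 ka Ma]] := small_radius k0 q40.
have [X0 [X1 [X2 [X3 HX]]]] := cutoff_exists a0.
have Mge := M0_ge0 a.
pose m := `|x| + q / 4 + M0 a + 1.
have nx := normr_ge0 x.
have m0 : 0 < m by rewrite /m; lra.
have Mm : M0 a < m by rewrite /m; lra.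
have xm : `|x| + q / 4 + M0 a < m by rewrite /m; lra.
pose b := c / k ^+ 2.
have kk : k ^+ 2 != 0 by rewrite gt_eqF // exprn_gt0.
have cV y : {for y, continuous V} by exact: (Ck_cont V1).
have bV : bdd m V by exact: bdd_cont.
have bb : bdd m (fun _ : P => b) by exact: bdd_cst.
pose W y := V y - b; pose g y := c * (\1_D y - \1_setT y).
have bg : bdd m g by apply: bddM; [exact: bdd_cst | apply: bddB; exact: bdd_indic].
have q2 : 0 < q ^+ 2 by rewrite exprn_gt0.
have gin y : rho (x - y) < q ^+ 2 -> g y = 0.
  move=> h; rewrite /g !indicT ?subrr ?mulr0 //; apply: Hq.
  rewrite -(ltr_pXn2r (n := 2)) ?nnegrE ?(ltW q0) // distrC.
  exact: le_lt_trans (norm_rho _) h.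
have cW x' : `|x' - x| < q / 4 -> {for x', continuous W}.
  by move=> _; apply: cvgB; [exact: cV | exact: cvg_cst].
have [|[B [oB Bx hB]] _] := hessian_representation k0 a0 m0 ka HX Mm xm q40 (bddB bV bb) bg q2 gin cW.
  move=> x' e x'q e0 ea.
  have x'm : `|x'| + M0 a < m.
    have : `|x'| <= `|x' - x| + `|x| by rewrite -{1}(subrK x x') ler_normD.
    by rewrite /m; lra.
  have bK : bdd m (fun y => psi k X0 e (x' - y) + kap k X1 X2 e (x' - y)).
    by apply: bddD; [exact: (bdd_psi k m HX) | exact: (bdd_kap k m a0 HX x' (ltW e0))].
  have bG : bdd m (fun y => Gm k X0 e (x' - y)) by exact: (bdd_Gm k m HX).
  apply: (Int_difference m0 bV bb bK bG); last first.
    rewrite (weak_identity_all k0 a0 m0 HX (c := c) x'm e0).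
    - by congr (c * _); apply: (Int_ext m0) => y _; rewrite indicT // mul1r.
    - exact: Ck_cst.
    - by move=> y; rewrite lapD_cst add0r /b mulrCA mulfV ?mulr1.
  have inB y : rho (x' - y) <= 4 * a -> `|y - x| < q.
    move=> h; have h1 : `|x' - y| <= M0 a by rewrite leNgt; apply/negP => /(M0_rho a0); rewrite ltNge h.
    have : `|y - x| <= `|x' - y| + `|x' - x|.
      by rewrite (distrC x' y) -{1}(subrK x' y) -addrA ler_normD.
    by lra.
  (* The ball of radius q lies in D, so a linear function that is negative on it plays the part of
     the boundary function. *)
  pose b' := - (`|x| + q).
  have [dp Dp] : (forall y, dif (fun y => dot3 (@e1 R) y + b') y) /\
      forall y v, Dv v (fun y => dot3 (@e1 R) y + b') y = dot3 (@e1 R) v.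
    split=> y; have [dd D1] := dif_dot3 (@e1 R) y; first by apply: difD => //; exact: dif_cst.
    by move=> v; rewrite DvD ?Dv_cst ?addr0 //; exact: dif_cst.
  apply: (weak_identity_kernel k0 a0 m0 HX (m1 := 1) (B := [set y | `|y - x| < q])
    (phi := fun y => dot3 (@e1 R) y + b') (w := @e1 R) x'm e0 oD (@open_dist R x q) _ V0 DV0 V1 V2 Ve) => //.
  - by apply: (Ck_sub (A := setT)) => //; apply: CkD; [exact: openT | exact: Ck_dot3 | exact: Ck_cst].
  - move=> y /= yq; split=> [_|_]; last exact: Hq.
    have [h1 _ _] := coord_le y; have h2 := ler_norm y.1.1.
    have : `|y| <= `|y - x| + `|x| by rewrite -{1}(subrK x y) ler_normD.
    by rewrite /b' (_ : dot3 _ y = y.1.1); [lra | rewrite /dot3 /=; ring].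
  - by move=> y _; rewrite Dp /dot3 /= !mulr0 !addr0 mulr1.
exists B; split=> //.
apply: (Ck_ext (f := fun y => W y + b) oB) => [y _|]; first by rewrite /W subrK.
by apply: CkD => //; exact: Ck_cst.
Qed.

End Regularity.

(** * Second derivatives at the boundary *)

Section HalfSpace.
Context {R : realType}.
Notation P := (R * R * R)%type.
Implicit Types (x y z v w n : P) (s t : R).

(** Squeezing by the increments of a function with derivative 0; it joins the two branches of
    [hwave] at 0. *)
Lemma is_derive_flat (h f : R -> R) t : is_derive t 1 f 0 -> h t = f t ->
  (forall s, `|h s - f t| <= `|f s - f t|) -> is_derive t 1 h 0.
Proof.
move=> df ht H; apply: is_derive_near => e e0.
have dd : dif f t by apply/derivable1_diffP; case: df.
have D0 : Dv (1 : R) f t = 0 by rewrite DvE; case: df.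
have /nbhs_ballP[q /= q0 Hq] := dif_approx dd e0.
apply/nbhs_ballP; exists q => //= s; rewrite -ball_normE /= => sq.
have := Hq (s - t); rewrite -ball_normE /= sub0r normrN distrC => /(_ sq).
rewrite subrK (_ : s - t = (s - t) *: (1 : R)); last by rewrite [RHS]mulr1.
rewrite Dv_scalev // D0 mulr0 subr0 [(s - t) *: 1]mulr1 mul0r subr0 ht.
by apply: le_trans; exact: H.
Qed.

Variables (k c : R) (n : P) (b : R).
Hypotheses (k0 : 0 < k) (n1 : rho n = 1).

(* hwave'' + k^2 hwave = c for t < 0, with zero Cauchy data at t = 0, extended by zero. *)
Definition hwave t := c / k ^+ 2 * (1 - cos (k * Num.min t 0)).
Definition hwave1 t := c / k * sin (k * Num.min t 0).
Definition hwave2 t := c * cos (k * t).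
Definition halfspace : set P := [set y | dot3 n y + b < 0].
Definition halfwave y := hwave (dot3 n y + b).

Let G t := c / k ^+ 2 * (1 - cos (k * t)).
Let G1 t := c / k * sin (k * t).

Let dG t : is_derive t 1 G (G1 t).
Proof.
have D : is_derive t 1 (fun u : R => k * u) (k * 1) by exact: (is_deriveZt k (is_derive_id t 1)).
have C := is_derive_compt (g := cos) (h := fun u : R => k * u) (is_derive_cos (k * t)) D.
have E := is_deriveZt (c / k ^+ 2) (is_deriveDt (is_derive_cst (1 : R) t 1) (is_deriveNt C)).
by apply: (is_derive_eq E); rewrite /G1; field; rewrite gt_eqF.
Qed.

Let dG1 t : is_derive t 1 G1 (hwave2 t).
Proof.
have D : is_derive t 1 (fun u : R => k * u) (k * 1) by exact: (is_deriveZt k (is_derive_id t 1)).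
have C := is_derive_compt (g := sin) (h := fun u : R => k * u) (is_derive_sin (k * t)) D.
by apply: (is_derive_eq (is_deriveZt (c / k) C)); rewrite /hwave2; field; rewrite gt_eqF.
Qed.

Let hE t : t < 0 -> hwave t = G t.
Proof. by move=> t0; rewrite /hwave /G (min_idPl (ltW t0)). Qed.

Let h1E t : t < 0 -> hwave1 t = G1 t.
Proof. by move=> t0; rewrite /hwave1 /G1 (min_idPl (ltW t0)). Qed.

Let h0 t : 0 <= t -> hwave t = 0.
Proof. by move=> t0; rewrite /hwave (min_idPr t0) mulr0 cos0 subrr mulr0. Qed.

Let h10 t : 0 <= t -> hwave1 t = 0.
Proof. by move=> t0; rewrite /hwave1 (min_idPr t0) mulr0 sin0 mulr0. Qed.

Let G0 : G 0 = 0.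
Proof. by rewrite /G mulr0 cos0 subrr mulr0. Qed.

Lemma hwave_derive t : is_derive t 1 hwave (hwave1 t).
Proof.
have [t0|t0|->] := ltgtP t 0.
- have N1 : \forall s \near t, hwave s = G s by apply: filterS (lt_nbhsl t0) => s; exact: hE.
  exact: (is_derive_eq (is_derive_local N1 (dG t)) (esym (h1E t0))).
- have N1 : \forall s \near t, hwave s = 0 by apply: filterS (lt_nbhsr t0) => s /ltW; exact: h0.
  exact: (is_derive_eq (is_derive_local N1 (is_derive_cst (0 : R) t 1)) (esym (h10 (ltW t0)))).
have dG0 : is_derive (0 : R) 1 G 0 by apply: (is_derive_eq (dG 0)); rewrite /G1 mulr0 sin0 mulr0.
have hG0 : hwave 0 = G 0 by rewrite h0 // G0.
apply: (is_derive_eq (is_derive_flat dG0 hG0 _)); last by rewrite h10.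
move=> s; rewrite G0 !subr0; have [s0|s0] := ltP s 0; first by rewrite hE.
by rewrite h0 // normr0.
Qed.

Lemma hwave1_derive t : t < 0 -> is_derive t 1 hwave1 (hwave2 t).
Proof.
by move=> t0; apply: (is_derive_local _ (dG1 t)); apply: filterS (lt_nbhsl t0) => s; exact: h1E.
Qed.

Lemma hwave1_cont t : {for t, continuous hwave1}.
Proof.
apply: cvgM; first exact: cvg_cst.
apply: (@continuous_comp _ _ _ (fun t => k * Num.min t 0) sin); last exact: continuous_sin.
apply: cvgM; first exact: cvg_cst.
by apply: continuous_min; [exact: cvg_id | exact: cvg_cst].
Qed.

Lemma hwave2_cont t : {for t, continuous hwave2}.
Proof.
apply: cvgM; first exact: cvg_cst.
apply: (@continuous_comp _ _ _ (fun t => k * t) cos); last exact: continuous_cos.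
by apply: cvgM; [exact: cvg_cst | exact: cvg_id].
Qed.

Lemma halfwave_bound y : `|halfwave y| <= 2 * `|c / k ^+ 2|.
Proof.
rewrite /halfwave /hwave normrM mulrC ler_wpM2r //.
by rewrite (le_trans (ler_normB _ _)) // normr1 -[2]/(1 + 1) lerD2l cos_max.
Qed.

Let oneg : open [set t : R | t < 0]. Proof. exact: open_lt. Qed.

Let C_affine j (A : set P) : Ck j A (fun y => dot3 n y + b).
Proof.
by apply: (@Ck_sub _ _ j setT) => //; apply: CkD; [exact: openT | exact: Ck_dot3 | exact: Ck_cst].
Qed.

Lemma halfwave_Hessian x v w : dot3 n x + b < 0 ->
  Dv v (Dv w halfwave) x = c * cos (k * (dot3 n x + b)) * (dot3 n v * dot3 n w).
Proof.
move=> xb; have [_ ->] := Dv2_ridge (F := hwave) (F1 := hwave1) (F2 := hwave2) (n := n) (b := b) v w oneg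
  (fun t _ => hwave_derive t) (fun t h => hwave1_derive h) xb.
by [].
Qed.

Lemma halfwave_pair : helmholtz_pair halfspace k c halfwave.
Proof.
have oH : open halfspace by exact: (@open_ridge R [set t | t < 0] n b oneg).
split=> //.
- by move=> x /negP; rewrite -leNgt => xb; rewrite /halfwave h0.
- move=> x v /negP; rewrite -leNgt => xb.
  by have [_ ->] := Dv_ridge (n := n) (b := b) v (hwave_derive (dot3 n x + b)); rewrite h10 // mul0r.
- apply: (Ck_comp (B := setT) (h := hwave) openT) => //.
  by exists hwave1; split=> [t _|t _]; [exact: hwave_derive | exact: hwave1_cont].
- apply: (Ck_comp (B := fun t => t < 0) (h := hwave) oH) => //.
  exists hwave1; split=> [t _|]; first exact: hwave_derive.
  by exists hwave2; split=> [t t0|t _]; [exact: hwave1_derive | exact: hwave2_cont].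
move=> x xb; have -> := lapD_ridge (F := hwave) (F1 := hwave1) (F2 := hwave2) (n := n) (b := b) (z := x) oneg
  (fun t _ => hwave_derive t) (fun t h => hwave1_derive h) xb.
by rewrite n1 /halfwave hE // /G /hwave2; field; rewrite gt_eqF.
Qed.

End HalfSpace.

(** * The Hessian near a boundary point *)

Section BoundaryHessian.
Context {R : realType}.
Notation P := (R * R * R)%type.
Implicit Types (x y z v w p : P) (d e q t : R).
Variables (D : set P) (k c : R) (V : P -> R) (s n : P) (phi : P -> R) (r m1 g : R).
Hypotheses (k0 : 0 < k) (hp : helmholtz_pair D k c V) (n1 : rho n = 1) (ch : chart D n s phi r m1 g).

Let r0 : 0 < r. Proof. by case: ch => -[]. Qed.
Let g0 : 0 < g. Proof. by case: ch => -[]. Qed.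
Let m10 : 0 < m1. Proof. by case: ch => -[]. Qed.
Let C1 : Ck 1 [set x | `|x - s| < r] phi. Proof. by case: ch => -[]. Qed.
Let oD := hp_open hp.
Let V1 := hp_C1 hp.

Lemma convex_dist q x y t : `|x - s| < q -> `|y - s| < q -> 0 <= t <= 1 -> `|x + t *: (y - x) - s| < q.
Proof.
move=> xq yq /andP[t0 t1].
have -> : x + t *: (y - x) - s = (1 - t) *: (x - s) + t *: (y - s).
  have -> : y - x = (y - s) - (x - s) by rewrite opprB addrA subrK.
  by rewrite addrAC scalerBl scale1r scalerBr addrA addrAC.
rewrite (le_lt_trans (ler_normD _ _)) // !normrZ (ger0_norm t0) ger0_norm ?subr_ge0 //.
have h1 : (1 - t) * `|x - s| <= (1 - t) * Num.max `|x - s| `|y - s|.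
  by rewrite ler_wpM2l ?subr_ge0 // le_max lexx.
have h2 : t * `|y - s| <= t * Num.max `|x - s| `|y - s|.
  by rewrite ler_wpM2l // le_max lexx orbT.
have h3 : Num.max `|x - s| `|y - s| < q by rewrite gt_max xq.
lra.
Qed.

(** The sets D and the half space differ only where phi y and n.(y - p) have opposite signs. As the
    gradient of phi is continuous at s, phi y = g n.(y - p) + o(|y - p|) uniformly in boundary
    points p near s, although n is the normal at s and not at p. Opposite signs then force n.(y - p)
    to be of the size of the error. *)
Lemma cone_condition e : 0 < e -> exists2 q, 0 < q & forall y p, `|y - s| < q -> `|p - s| < q ->
  phi p = 0 -> (phi y < 0 /\ 0 <= dot3 n (y - p)) \/ (0 <= phi y /\ dot3 n (y - p) < 0) ->
  dot3 n (y - p) ^+ 2 <= e ^+ 2 * rho (y - p).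
Proof.
move=> e0; have [_ [_ _ _ Dp]] := ch.
have eta0 : 0 < g * e / 3 by rewrite divr_gt0 // mulr_gt0.
have ss : [set x | `|x - s| < r] s by rewrite /= subrr normr0.
have N v : \forall x \near s, `|Dv v phi s - Dv v phi x| <= g * e / 3.
  have cD : Dv v phi @ s --> Dv v phi s by exact: (Ck_cont (Ck_Dv v C1) ss).
  by move/cvgrPdist_le : cD; exact.
have [q1 q10 H1] := near_distP (N (@e1 R)).
have [q2 q20 H2] := near_distP (N (@e2 R)).
have [q3 q30 H3] := near_distP (N (@e3 R)).
pose q := Num.min (Num.min q1 q2) (Num.min q3 r).
have q0 : 0 < q by rewrite !lt_min q10 q20 q30 r0.
exists q => // y p yq pq pp H.
have inq x : `|x - s| < q -> [/\ `|x - s| < q1, `|x - s| < q2, `|x - s| < q3 & `|x - s| < r].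
  by rewrite !lt_min => /andP[/andP[? ?] /andP[? ?]].
have seg t : 0 <= t <= 1 -> `|p + t *: (y - p) - s| < q by exact: convex_dist.
have [||t t01 E] := @MVT_line _ _ phi p (y - p).
- move=> t /andP[t0 t1]; have [|_ _ _ h] := inq _ (seg t _); first by rewrite (ltW t0) (ltW t1).
  exact: (Ck_dif C1).
- by move=> t t01; have [_ _ _ h] := inq _ (seg t t01); exact: (Ck_cont C1).
have {}t01 : 0 <= t <= 1 by case/andP: t01 => t0 t1; rewrite (ltW t0) (ltW t1).
have [x1 x2 x3 xr] := inq _ (seg t t01).
move: (H1 _ x1) (H2 _ x2) (H3 _ x3) E; set xi := p + _ => h1 h2 h3 E.
have B : `|Dv (y - p) phi s - Dv (y - p) phi xi| <= g * e * `|y - p|.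
  have [d1 d2] : dif phi s /\ dif phi xi by split; exact: (Ck_dif C1).
  have [c1 c2 c3] := coord_le (y - p).
  rewrite !(Dv_coord (y - p)) //; move: h1 h2 h3 c1 c2 c3.
  move: (Dv (@e1 R) phi s) (Dv (@e2 R) phi s) (Dv (@e3 R) phi s) => A1 A2 A3.
  move: (Dv (@e1 R) phi xi) (Dv (@e2 R) phi xi) (Dv (@e3 R) phi xi) => B1 B2 B3.
  set v := y - p => h1 h2 h3 c1 c2 c3.
  rewrite (_ : _ - _ = v.1.1 * (A1 - B1) + v.1.2 * (A2 - B2) + v.2 * (A3 - B3)); last by ring.
  rewrite (_ : g * e * _ = `|v| * (g * e / 3) + `|v| * (g * e / 3) + `|v| * (g * e / 3)); last by field.
  rewrite (le_trans (ler_normD _ _)) // lerD ?(le_trans (ler_normD _ _)) ?lerD //.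
  - by rewrite normrM ler_pM.
  - by rewrite normrM ler_pM.
  - by rewrite normrM ler_pM.
rewrite (addrC p) subrK pp subr0 in E; rewrite -E Dp in B.
have {}B : `|dot3 n (y - p)| <= e * `|y - p|.
  rewrite -(ler_pM2l g0) mulrA; apply: le_trans B.
  move: (ler_norm (g * dot3 n (y - p) - phi y)) (ler_norm (- (g * dot3 n (y - p) - phi y))); rewrite normrN.
  move=> B1 B2; case: H => -[h4 h5].
    by rewrite ger0_norm //; lra.
  by rewrite ltr0_norm //; lra.
have h : `|dot3 n (y - p)| ^+ 2 <= (e * `|y - p|) ^+ 2 by rewrite lerXn2r ?nnegrE // mulr_ge0 // ltW.
rewrite real_normK ?num_real // in h; apply: (le_trans h).
by rewrite exprMn ler_wpM2l ?sqr_ge0 // norm_rho.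
Qed.

Variables (a m : R) (X0 X1 X2 X3 : R -> R).
Hypotheses (a0 : 0 < a) (ka : 20 * k ^+ 2 * a <= 1) (HX : cutoff a X0 X1 X2 X3).
Hypotheses (ar : M0 a <= r / 8) (ms : `|s| + r + M0 a < m).
Local Notation G := (Gm k X0 0).
Local Notation kp := (kap k X1 X2 0).
Local Notation C0 := (C0 k m X1 X2).

Let m0 : 0 < m.
Proof.
have r0' := r0; have ms' := ms; have := normr_ge0 s; have := M0_ge0 a; lra.
Qed.

Let Mm : M0 a < m.
Proof.
have r0' := r0; have ms' := ms; have := normr_ge0 s; lra.
Qed.

Lemma in_box z : `|z - s| < r -> `|z| + M0 a < m.
Proof.
move=> zr; have ms' := ms; have : `|z| <= `|z - s| + `|s| by rewrite -{1}(subrK s z) ler_normD.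
lra.
Qed.

Lemma boundary_identity z e : `|z - s| < r / 2 -> 0 < e ->
  Int m (fun y => V y * (psi k X0 e (z - y) + kap k X1 X2 e (z - y))) =
  c * Int m (fun y => \1_D y * Gm k X0 e (z - y)).
Proof.
move=> zr e0; have r0' := r0; have ar' := ar.
have zm : `|z| + M0 a < m by apply: in_box; lra.
have inB y : rho (z - y) <= 4 * a -> `|y - s| < r.
  move=> h; have h1 : `|z - y| <= M0 a by rewrite leNgt; apply/negP => /(M0_rho a0); rewrite ltNge h.
  have : `|y - s| <= `|z - y| + `|z - s| by rewrite (distrC z y) -{1}(subrK z y) -addrA ler_normD.
  lra.
have [_ V0 DV0 _ V2 Ve] := hp; have [_ [HD _ Hm _]] := ch.
apply: (weak_identity_kernel k0 a0 m0 HX (m1 := m1) (phi := phi) (w := n) zm e0 oD (@open_dist R s r) inB V0 DV0 V1 V2 Ve) => //.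
by move=> y h; apply: Hm; exact: inB.
Qed.

Lemma halfspace_identity z e b : `|z - s| < r / 2 -> 0 < e ->
  Int m (fun y => halfwave k c n b y * (psi k X0 e (z - y) + kap k X1 X2 e (z - y))) =
  c * Int m (fun y => \1_(halfspace n b) y * Gm k X0 e (z - y)).
Proof.
move=> zr e0; have r0' := r0.
have zm : `|z| + M0 a < m by apply: in_box; lra.
have [oH V0 DV0 U1 U2 Ue] := halfwave_pair c b k0 n1.
have D1 y : dif (fun y => dot3 n y + b) y /\ Dv n (fun y => dot3 n y + b) y = 1.
  have [dn Dn] := dif_dot3 n y; split; first by apply: difD => //; exact: dif_cst.
  by rewrite DvD ?Dv_cst ?addr0 ?Dn //; exact: dif_cst.
apply: (weak_identity_kernel k0 a0 m0 HX (m1 := 1) (phi := fun y => dot3 n y + b) (w := n) zm e0 oH openT (fun y _ => I) V0 DV0 U1 U2 Ue) => //.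
  by apply: CkD; [exact: openT | exact: Ck_dot3 | exact: Ck_cst].
by move=> y _; have [_ ->] := D1 y.
Qed.

(* V minus the half-space solution satisfies the Helmholtz equation with source gap b, which, near a
   boundary point p with dot3 n p = - b, is supported in a thin cone around the tangent plane. *)
Definition gap b y := c * (\1_D y - \1_(halfspace n b) y).
Definition defect b y := V y - halfwave k c n b y.

Lemma bdd_gap b : bdd m (gap b).
Proof. by apply: bddM; [exact: bdd_cst | apply: bddB; exact: bdd_indic]. Qed.

Let cW b y : {for y, continuous (defect b)}.
Proof.
by apply: cvgB; [exact: (Ck_cont V1) | exact: (Ck_cont (hp_C1 (halfwave_pair c b k0 n1)))].
Qed.

Lemma bdd_defect b : bdd m (defect b). Proof. exact: bdd_cont. Qed.

Lemma hessian_rep_near b z d v w : `|z - s| < r / 4 -> 0 < d -> (forall y, rho (z - y) < d -> gap b y = 0) ->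
  C0 * Dv v (Dv w (defect b)) z =
  Int m (fun y => gap b y * Dv v (Dv w G) (z - y)) - Int m (fun y => defect b y * Dv v (Dv w kp) (z - y)).
Proof.
move=> zr d0 gd; have r0' := r0; have ms' := ms.
have r80 : 0 < r / 8 by rewrite divr_gt0.
have zm : `|z| + r / 8 + M0 a < m.
  have : `|z| <= `|z - s| + `|s| by rewrite -{1}(subrK s z) ler_normD.
  lra.
have [|_ H] := hessian_representation k0 a0 m0 ka HX Mm zm r80 (bdd_defect b) (bdd_gap b) d0 gd (fun x' _ => @cW b x').
  move=> x' e x'z e0 ea.
  have x's : `|x' - s| < r / 2.
    have : `|x' - s| <= `|x' - z| + `|z - s| by rewrite -{1}(subrK z x') -addrA ler_normD.
    lra.
  have bK : bdd m (fun y => psi k X0 e (x' - y) + kap k X1 X2 e (x' - y)).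
    by apply: bddD; [exact: (bdd_psi k m HX) | exact: (bdd_kap k m a0 HX x' (ltW e0))].
  have bG : bdd m (fun y => Gm k X0 e (x' - y)) by exact: (bdd_Gm k m HX).
  have bV : bdd m V by apply: bdd_cont => y; exact: (Ck_cont V1).
  have bU : bdd m (halfwave k c n b) by apply: bdd_cont => y; exact: (Ck_cont (hp_C1 (halfwave_pair c b k0 n1))).
  exact: (Int_difference m0 bV bU bK bG (boundary_identity x's e0) (halfspace_identity b x's e0)).
exact: H.
Qed.

Lemma bdd_gap_kernel b z d v w : rho v <= 1 -> rho w <= 1 -> 0 < d -> (forall y, rho (z - y) < d -> gap b y = 0) ->
  bdd m (fun y => gap b y * Dv v (Dv w G) (z - y)).
Proof.
move=> v1 w1 d0 gd; have [C C0' HC] := kernel_D2 k0 a0 HX.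
have [B HB] := bdd_gap b; exists (B * (C * isq 3 d)) => y ym.
have B0 : 0 <= B := le_trans (normr_ge0 _) (HB y ym).
have [near|far] := ltP (rho (z - y)) d.
  by rewrite gd // mul0r normr0 mulr_ge0 // mulr_ge0 // ltW // isq_gt0.
rewrite normrM ler_pM ?HB //; apply: (le_trans (HC v w _ v1 w1 (lt_le_trans d0 far))).
by rewrite ler_wpM2l // isq_le.
Qed.

Lemma bdd_defect_kernel b z v w : bdd m (fun y => defect b y * Dv v (Dv w kp) (z - y)).
Proof.
apply: bddM; first exact: bdd_defect.
apply: bdd_cont => y; apply: (@cont_refl _ (Dv v (Dv w kp)) z) => u.
by apply: (@Ck_cont _ _ 1 setT) => //; do 2!apply: Ck_Dv; exact: (kap_Ck k a0 HX).
Qed.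

Lemma gap_locally_zero b z : (D z /\ halfspace n b z) \/ (~ closure D z /\ 0 < dot3 n z + b) ->
  exists2 d, 0 < d & forall y, rho (z - y) < d -> gap b y = 0.
Proof.
have [oH _ _ _ _ _] := halfwave_pair c b k0 n1.
suff H (A : set P) : open A -> A z -> (forall y, A y -> gap b y = 0) ->
    exists2 d, 0 < d & forall y, rho (z - y) < d -> gap b y = 0.
  case=> [[Dz Hz]|[cz pz]].
    apply: (H (D `&` halfspace n b)) => //; first exact: openI.
    by move=> y [Dy Hy]; rewrite /gap !indicT // subrr mulr0.
  apply: (H (~` closure D `&` [set y | 0 < dot3 n y + b])) => //.
    apply: openI; first by apply: closed_openC; exact: closed_closure.
    exact: (@open_ridge R [set t | 0 < t] n b (@open_gt R 0)).
  move=> y [Dy /= Hy]; rewrite /gap !indicF ?subrr ?mulr0 //.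
    by rewrite /halfspace /= => h; move: Hy; rewrite ltNge (ltW h).
  by move=> Dy'; apply: Dy; exact: subset_closure.
move=> oA Az HA; have [q q0 Hq] := open_normP oA Az.
exists (q ^+ 2); first by rewrite exprn_gt0.
move=> y h; apply/HA/Hq; rewrite -(ltr_pXn2r (n := 2)) ?nnegrE ?(ltW q0) // distrC.
exact: le_lt_trans (norm_rho _) h.
Qed.

(* The mirror image p + d n lies outside D, where the defect vanishes: its Hessian at p - d n is the difference
   of the two representations, in which the singular kernels nearly cancel on the cone. *)
Lemma hessian_jump x d v w : let p := x + d *: n in let b := - dot3 n p in
  rho v <= 1 -> rho w <= 1 -> `|x - s| < r / 8 -> 0 < d -> d < r / 16 -> D x -> bdry D p ->
  ~ D (p + d *: n) -> ~ bdry D (p + d *: n) ->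
  bdd m (fun y => gap b y * (Dv v (Dv w G) (p - d *: n - y) - Dv v (Dv w G) (p + d *: n - y))) /\
  C0 * (Dv v (Dv w V) x - c * cos (k * - d) * (dot3 n v * dot3 n w)) =
  Int m (fun y => gap b y * (Dv v (Dv w G) (p - d *: n - y) - Dv v (Dv w G) (p + d *: n - y))) -
  Int m (fun y => defect b y * (Dv v (Dv w kp) (p - d *: n - y) - Dv v (Dv w kp) (p + d *: n - y))).
Proof.
move=> p b v1 w1 xs d0 dr Dx bp nD nb; have r0' := r0.
have xE : p - d *: n = x by rewrite /p addrK.
have nx : dot3 n x + b = - d.
  by rewrite /b /p (dot3C n (x + _)) dot3Dl dot3Zl -/(rho n) n1 (dot3C x); ring.
have nx' : dot3 n (p + d *: n) + b = d.
  by rewrite /b (dot3C n (p + _)) dot3Dl dot3Zl -/(rho n) n1 (dot3C p); ring.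
have Hx : halfspace n b x by rewrite /halfspace /= nx oppr_lt0.
have nc : ~ closure D (p + d *: n) by move=> h; apply: nb.
have xs4 : `|x - s| < r / 4 by lra.
have xs' : `|p + d *: n - s| < r / 4.
  have -> : p + d *: n - s = x - s + (2 * d) *: n.
    by rewrite /p mulr_natl mulr2n scalerDl [RHS]addrAC addrA.
  rewrite (le_lt_trans (ler_normD _ _)) // normrZ gtr0_norm ?mulr_gt0 //.
  have : 2 * d * `|n| <= 2 * d * 1 by rewrite ler_wpM2l ?(norm_unit n1) // mulr_ge0 // ltW.
  lra.
have [d1 d10 H1] := @gap_locally_zero b x (or_introl (conj Dx Hx)).
have [|d2 d20 H2] := @gap_locally_zero b (p + d *: n); first by right; rewrite nx'.
have E1 := hessian_rep_near v w xs4 d10 H1.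
have E2 := hessian_rep_near v w xs' d20 H2.
have [_ V0 _ _ V2 _] := hp.
have Z : Dv v (Dv w (defect b)) (p + d *: n) = 0.
  have oA : open (~` closure D `&` [set y | 0 < dot3 n y + b]).
    apply: openI; first by apply: closed_openC; exact: closed_closure.
    exact: (@open_ridge R [set t | 0 < t] n b (@open_gt R 0)).
  have ZA y : (~` closure D `&` [set y | 0 < dot3 n y + b]) y -> defect b y = 0.
    move=> [cy /= py]; have [_ U0 _ _ _ _] := halfwave_pair c b k0 n1.
    rewrite /defect V0 ?U0 ?subrr //.
      by rewrite /halfspace /= => h; move: py; rewrite ltNge (ltW h).
    by move=> Dy'; apply: cy; exact: subset_closure.
  have Ax : (~` closure D `&` [set y | 0 < dot3 n y + b]) (p + d *: n) by split=> //=; rewrite nx'.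
  rewrite (_ : Dv v _ _ = Dv v (fun=> 0) (p + d *: n)); first by rewrite Dv_cst.
  apply: Dv_near; apply: (near_open oA Ax) => y Ay.
  rewrite -[RHS](Dv_cst w 0 y); apply: Dv_near; exact: (near_open oA Ay ZA).
have Ex : Dv v (Dv w (defect b)) x = Dv v (Dv w V) x - c * cos (k * - d) * (dot3 n v * dot3 n w).
  have [oH _ _ _ U2 _] := halfwave_pair c b k0 n1.
  rewrite -nx -(halfwave_Hessian c k0 v w Hx).
  have oA : open (D `&` halfspace n b) by exact: openI.
  have dV y : (D `&` halfspace n b) y -> dif V y /\ dif (halfwave k c n b) y.
    by move=> [Dy Hy]; split; [exact: (Ck_dif V2) | exact: (Ck_dif U2)].
  rewrite (_ : Dv v (Dv w (defect b)) x = Dv v (fun y => Dv w V y - Dv w (halfwave k c n b) y) x); last first.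
    apply: Dv_near; apply: (near_open oA (conj Dx Hx)) => y Ay; have [h1 h2] := dV y Ay.
    by rewrite /defect DvB.
  by rewrite DvB //; [exact: (Ck_dif (Ck_Dv w V2)) | exact: (Ck_dif (Ck_Dv w U2))].
rewrite -Ex E1; rewrite Z mulr0 in E2.
have bg1 := bdd_gap_kernel v1 w1 d10 H1; have bg2 := bdd_gap_kernel v1 w1 d20 H2.
have bk z := bdd_defect_kernel b z v w.
rewrite xE.
have EG : (fun y => gap b y * (Dv v (Dv w G) (x - y) - Dv v (Dv w G) (p + d *: n - y))) =
    fun y => gap b y * Dv v (Dv w G) (x - y) - gap b y * Dv v (Dv w G) (p + d *: n - y).
  by apply/funext => y; rewrite mulrBr.
have Ek : (fun y => defect b y * (Dv v (Dv w kp) (x - y) - Dv v (Dv w kp) (p + d *: n - y))) =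
    fun y => defect b y * Dv v (Dv w kp) (x - y) - defect b y * Dv v (Dv w kp) (p + d *: n - y).
  by apply/funext => y; rewrite mulrBr.
rewrite EG Ek; split; first exact: bddB.
rewrite -[LHS]subr0 [X in _ - X = _]E2.
by rewrite (IntB m0 bg1 bg2) (IntB m0 (bk _) (bk _)); ring.
Qed.

Lemma gap_le b y : `|gap b y| <= 2 * `|c|.
Proof.
rewrite /gap normrM mulrC ler_wpM2r // (le_trans (ler_normB _ _)) // -[2]/(1 + 1).
by apply: lerD; rewrite indicE; case: (_ \in _); rewrite ?normr1 ?normr0.
Qed.

(** The contrapositive of [cone_condition]: outside the cone, y belongs to both D and the half space
    or to neither. *)
Lemma gap_cone e : 0 < e -> exists2 q, 0 < q & forall y p, `|y - s| < q -> `|p - s| < q -> phi p = 0 ->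
  e ^+ 2 * rho (y - p) < dot3 n (y - p) ^+ 2 -> gap (- dot3 n p) y = 0.
Proof.
move=> e0; have [q q0 Hq] := cone_condition e0; have [_ [HD _ _ _]] := ch.
exists (Num.min q r); first by rewrite lt_min q0 r0.
move=> y p; rewrite !lt_min => /andP[yq yr] /andP[pq pr] pp; apply: contraPP => gn.
apply/negP; rewrite -leNgt; apply: Hq => //.
have E : dot3 n y + - dot3 n p = dot3 n (y - p) by rewrite !(dot3C n) dot3Dl dot3Nl.
have [py|py] := ltP (phi y) 0; [left|right]; split=> //.
  rewrite leNgt; apply/negP => h; apply: gn.
  have Dy : D y by exact/(HD y yr).
  have Hy : halfspace n (- dot3 n p) y by rewrite /halfspace /= E.
  by rewrite /gap (indicT Dy) (indicT Hy) subrr mulr0.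
rewrite ltNge; apply/negP => h; apply: gn.
have Dy : ~ D y by move/(HD _ yr); rewrite ltNge py.
have Hy : ~ halfspace n (- dot3 n p) y by rewrite /halfspace /= E => h2; move: h; rewrite leNgt h2.
by rewrite /gap (indicF Dy) (indicF Hy) subrr mulr0.
Qed.

Lemma gap_center p : `|p - s| < r -> phi p = 0 -> gap (- dot3 n p) p = 0.
Proof.
move=> pr pp; have [_ [HD _ _ _]] := ch.
have Dp : ~ D p by move/(HD _ pr); rewrite pp ltxx.
have Hp : ~ halfspace n (- dot3 n p) p by rewrite /halfspace /= subrr ltxx.
by rewrite /gap (indicF Dp) (indicF Hp) subrr mulr0.
Qed.

(** The order of the quantifiers matters: Ka is independent of the opening e of the cone, whereas Kb
    and q depend on it. The bound is small when e is chosen first and d afterwards. *)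
Lemma gap_term v w : rho v <= 1 -> rho w <= 1 -> exists2 Ka, 0 <= Ka & forall e, 0 < e -> e <= 2^-1 ->
  exists Kb q, [/\ 0 <= Kb, 0 < q & forall p d, `|p - s| < q -> phi p = 0 -> 0 < d -> d < q ->
    let T y := gap (- dot3 n p) y * (Dv v (Dv w G) (p - d *: n - y) - Dv v (Dv w G) (p + d *: n - y)) in
    bdd m T -> `|Int m T| <= Ka * e + Kb * d].
Proof.
move=> v1 w1; have r0' := r0; have [C1' C10 HC1] := kernel_difference k0 a0 HX.
have [C2 C20 HC2] := cone_mass a0 m0 HX.
pose K := 2 * `|c| * C1' + 1.
have cC : 0 <= 2 * `|c| * C1' by rewrite !mulr_ge0.
have K0 : 0 < K by rewrite /K; lra.
exists (K * C2); first by rewrite mulr_ge0 // ltW.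
move=> e e0 e2; have [q1 q10 Hq1] := gap_cone e0.
pose r1 := Num.min (q1 / 2) (Num.sqrt a).
have r10 : 0 < r1 by rewrite lt_min divr_gt0 // sqrtr_gt0.
have r1q : r1 <= q1 / 2 by rewrite ge_min lexx.
have r1a : r1 ^+ 2 <= a.
  have h : r1 <= Num.sqrt a by rewrite ge_min lexx orbT.
  by rewrite -[leRHS]sqr_sqrtr ?(ltW a0) // lerXn2r ?nnegrE ?sqrtr_ge0 // ltW.
have r120 : 0 < r1 ^+ 2 by rewrite exprn_gt0.
pose q := Num.min (Num.min (q1 / 2) r) (r1 / 4).
exists (8 * (2 * `|c| * C1' * isq 4 (r1 ^+ 2))), q; split.
- by rewrite !mulr_ge0 // ltW // isq_gt0.
- by rewrite !lt_min r0 !divr_gt0.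
move=> p d pq pp d0 dq T bT.
have [pq1 pr dr1] : [/\ `|p - s| < q1 / 2, `|p - s| < r & d < r1 / 4].
  by move: pq dq; rewrite !lt_min => /andP[/andP[-> ->] _] /andP[_ ->].
have d16 : 16 * d ^+ 2 <= r1 ^+ 2.
  have h : (4 * d) ^+ 2 <= r1 ^+ 2 by rewrite lerXn2r ?nnegrE; lra.
  by move: h; rewrite exprMn (_ : 4 ^+ 2 = 16 :> R) //; ring.
have pm : M0 a + `|p| < m by rewrite addrC; exact: in_box.
(* Within radius r1 the cutoff is 1 and the source is confined to the cone, so [cone_mass] applies;
   beyond it, 16 d^2 <= r1^2 makes the kernel difference O(d). *)
pose T1 y := if rho (y - p) < r1 ^+ 2 then T y else 0.
have bT1 : bdd m T1.
  have [B HB] := bT; exists (Num.max B 0) => y ym; rewrite /T1; case: ifP => _.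
    by rewrite le_max HB.
  by rewrite normr0 le_max lexx orbT.
pose T2 y := T y - T1 y.
have bT2 : bdd m T2 by exact: bddB.
have TE : Int m T = Int m T1 + Int m T2.
  by rewrite -(IntD m0 bT1 bT2); apply: (Int_ext m0) => y _; rewrite /T2 addrC subrK.
have I2 : `|Int m T2| <= 8 * (2 * `|c| * C1' * isq 4 (r1 ^+ 2)) * d.
  rewrite -mulrA; apply: (Int_bound m0) => y _.
  have i4 := isq_gt0 4 r120.
  rewrite /T2 /T1; have [near|far] := ltP (rho (y - p)) (r1 ^+ 2).
    by rewrite subrr normr0 mulr_ge0 ?(ltW d0) // mulr_ge0 // ltW.
  have rp : 0 < rho (y - p) by exact: lt_le_trans far.
  have [_ H] := HC1 v w n p y d v1 w1 n1 d0 rp.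
  rewrite subr0 /T normrM (_ : _ * isq 4 _ * d = 2 * `|c| * (C1' * (d * isq 4 (r1 ^+ 2)))); last by ring.
  rewrite ler_pM ?gap_le // (le_trans (H (le_trans d16 far))) // ler_wpM2l // ler_wpM2l ?(ltW d0) //.
  exact: isq_le.
have near_s y : rho (y - p) < r1 ^+ 2 -> `|y - s| < q1 /\ `|p - s| < q1.
  move=> h; have yp : `|y - p| < r1.
    by rewrite -(ltr_pXn2r (n := 2)) ?nnegrE ?(ltW r10) //; exact: le_lt_trans (norm_rho _) h.
  have : `|y - s| <= `|y - p| + `|p - s| by rewrite -{1}(subrK p y) -addrA ler_normD.
  by split; lra.
have Ki : 0 <= K^-1 by rewrite invr_ge0 ltW.
have wt0 y : 0 <= wt X0 d (y - p).
  have /andP[h _] := cutoff_01 HX (rho (y - p)).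
  have t0 : 0 < rho (y - p) + d ^+ 2 by rewrite ltr_wpDl ?rho_ge0 // exprn_gt0.
  by rewrite /wt mulr_ge0 // mulr_ge0 ?(ltW d0) // ltW // isq_gt0.
have cone y : e ^+ 2 * rho (y - p) < dot3 n (y - p) ^+ 2 -> K^-1 * T1 y = 0.
  move=> h; rewrite /T1; case: ifP => [near|_]; last by rewrite mulr0.
  have [ys ps] := near_s y near.
  by rewrite /T (Hq1 y p ys ps pp h) mul0r mulr0.
have dom y : `|K^-1 * T1 y| <= wt X0 d (y - p).
  have [out|ins] := ltP (e ^+ 2 * rho (y - p)) (dot3 n (y - p) ^+ 2); first by rewrite cone // normr0.
  rewrite normrM (ger0_norm Ki) mulrC ler_pdivrMr // /T1; case: ifP => [near|_]; last first.
    by rewrite normr0 mulr_ge0 // ltW.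
  (* The kernel bound requires y different from p; at y = p the source itself is 0, because p lies
     neither in D nor in the open half space. *)
  have [yp|yp] := eqVneq y p; first by rewrite /T yp (gap_center pr pp) mul0r normr0 mulr_ge0 // ?(ltW K0) // -yp.
  have rp : 0 < rho (y - p) by apply: rho_gt0; rewrite subr_eq0.
  have [H _] := HC1 v w n p y d v1 w1 n1 d0 rp.
  have h4 : 4 * dot3 n (y - p) ^+ 2 <= rho (y - p).
    have ee : e ^+ 2 <= 4^-1.
      by rewrite (_ : 4^-1 = 2^-1 ^+ 2 :> R); [rewrite lerXn2r ?nnegrE // ltW | field].
    have := ler_wpM2r (ltW rp) ee; lra.
  have X1' : X0 (rho (y - p)) = 1 by apply: (cutoff_in HX); apply: ltW; exact: lt_le_trans near r1a.
  rewrite /wt X1' mul1r; set Z := d * _.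
  have Z0 : 0 <= Z by move: (wt0 y); rewrite /wt X1' mul1r.
  have : `|T y| <= 2 * `|c| * (C1' * Z) by rewrite /T normrM ler_pM ?gap_le //; exact: H.
  by rewrite /K; lra.
have bg : bdd m (fun y => K^-1 * T1 y) by apply: bddM => //; exact: bdd_cst.
have := HC2 n p d e _ n1 pm d0 e0 e2 bg dom cone.
rewrite (IntZ m0 _ bT1) normrM (ger0_norm Ki) mulrC ler_pdivrMr // => I1.
rewrite TE (le_trans (ler_normD _ _)) //; lra.
Qed.

(** This part has the C^3 kernel [kap], whose second derivatives are Lipschitz along n, and a
    bounded density; the two points are 2 d apart. *)
Lemma defect_term v w : exists2 Kc, 0 <= Kc & forall p d, 0 < d ->
  `|Int m (fun y => defect (- dot3 n p) y * (Dv v (Dv w kp) (p - d *: n - y) - Dv v (Dv w kp) (p + d *: n - y)))| <= Kc * d.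
Proof.
have cV y : {for y, continuous V} by exact: (Ck_cont V1).
have [BV BV0 HV] := @compact_le_bound R _ V (@compact_box R m) (fun y _ => cV y).
have kC : Ck 1 setT (Dv v (Dv w kp)) by do 2!apply: Ck_Dv; exact: (kap_Ck k a0 HX).
have [L L0 HL] := csupp_lipschitz n kC (csupp_Dv v (csupp_Dv w (csupp_kap k a0 HX 0))).
exists (8 * ((BV + 2 * `|c / k ^+ 2|) * L)); first by rewrite !mulr_ge0 // addr_ge0 // mulr_ge0.
move=> p d d0; rewrite -mulrA; apply: (Int_bound m0) => y ym; rewrite -mulrA normrM ler_pM //.
  by rewrite /defect (le_trans (ler_normB _ _)) // lerD ?halfwave_bound //; exact: HV.
by rewrite (addrAC p) (addrAC p (d *: n)); exact: HL.
Qed.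

(** As x tends to s, its exit distance d tends to 0. The two integrals of [hessian_jump] are at most
    Ka ep + Kb d and Kc d, and the Hessian c cos (k d) n n^T of the half-space solution tends to c n
    n^T. *)
Lemma boundary_Hessian_limit v w e : rho v <= 1 -> rho w <= 1 -> 0 < e ->
  \forall x \near s, D x -> `|Dv v (Dv w V) x - c * (dot3 n v * dot3 n w)| <= e.
Proof.
move=> v1 w1 e0; have r0' := r0.
have C00 : C0 != 0 by exact: (C0_neq0 k0 a0 m0 ka HX Mm).
have c00 : 0 < `|C0| by rewrite normr_gt0.
have [Ka Ka0 HKa] := gap_term v1 w1; have [Kc Kc0 HKc] := defect_term v w.
have Ka1 : 0 < 4 * (Ka + 1) by lra.
pose ep := Num.min 2^-1 (`|C0| * e / (4 * (Ka + 1))).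
have ep0 : 0 < ep by rewrite lt_min invr_gt0 ltr0n divr_gt0 // mulr_gt0.
have ep2 : ep <= 2^-1 by rewrite ge_min lexx.
have epK : Ka * ep <= `|C0| * e / 4.
  have : ep <= `|C0| * e / (4 * (Ka + 1)) by rewrite ge_min lexx orbT.
  rewrite ler_pdivlMr // => h; have := ltW ep0; lra.
have [Kb [q [Kb0 q0 H]]] := HKa ep ep0 ep2.
have cosN : \forall d \near (0 : R), `|c| * `|cos (k * - d) - 1| <= e / 4.
  have e1 : 0 < e / 4 / (`|c| + 1) by rewrite !divr_gt0 // ltr_wpDl.
  have cc : (fun d : R => cos (k * - d)) @ (0 : R) --> (1 : R).
    have E0 : cos (k * - 0) = 1 :> R by rewrite oppr0 mulr0 cos0.
    rewrite -[X in _ --> X]E0.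
    apply: (@continuous_comp _ _ _ (fun d : R => k * - d) cos); last exact: continuous_cos.
    by apply: cvgM; [exact: cvg_cst | apply: cvgN; exact: cvg_id].
  have /cvgrPdist_le /(_ _ e1) := cc; apply: filterS => d; rewrite distrC ler_pdivlMr ?ltr_wpDl //.
  by have := normr_ge0 (cos (k * - d) - 1); lra.
have [dl dl0 Hdl] : exists2 dl : R, 0 < dl & forall d, 0 < d -> d < dl -> `|c| * `|cos (k * - d) - 1| <= e / 4.
  have /nbhs_ballP[dl /= dl0 Hdl] := cosN; exists dl => // d d0 dd; apply: Hdl.
  by rewrite -ball_normE /= sub0r normrN gtr0_norm.
have Kbc : 0 < 4 * (Kb + Kc + 1) by lra.
pose de := Num.min (Num.min dl (r / 16)) (Num.min (q / 2) (`|C0| * e / (4 * (Kb + Kc + 1)))).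
have de0 : 0 < de by rewrite !lt_min dl0 !divr_gt0 // mulr_gt0.
have der : de <= r / 2.
  have : de <= r / 16 by rewrite !ge_min lexx !orbT.
  lra.
have [C _ HC] := exit_near n1 ch.
have r80 : 0 < r / 8 by rewrite divr_gt0.
have q20 : 0 < q / 2 by rewrite divr_gt0.
apply: filterS3 (near_dist s r80) (near_dist s q20) (HC de de0 der) => x xr xq Hx Dx.
have [d [[d0 dde _ bp] [_ Hout]]] := Hx Dx.
have [ddl ddr ddq ddC] : [/\ d < dl, d < r / 16, d < q / 2 & d < `|C0| * e / (4 * (Kb + Kc + 1))].
  by move: dde; rewrite !lt_min => /andP[/andP[-> ->] /andP[-> ->]].
have nn := norm_unit n1.
have ps q' : `|x - s| < q' / 2 -> d < q' / 2 -> `|x + d *: n - s| < q'.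
  move=> h1 h2; rewrite addrAC (le_lt_trans (ler_normD _ _)) // normrZ gtr0_norm //.
  have : d * `|n| <= d * 1 by rewrite ler_wpM2l // ltW.
  lra.
have pr : `|x + d *: n - s| < r by apply: ps; lra.
have pp : phi (x + d *: n) = 0 by have [_ [_ HB _ _]] := ch; exact/HB.
have t1 : d < 2 * d by lra.
have t2 : 2 * d <= r / 2 by lra.
have [nD nb] := Hout _ t1 t2.
have E2 : x + (2 * d) *: n = x + d *: n + d *: n by rewrite mulr_natl mulr2n scalerDl addrA.
rewrite E2 in nD nb.
have [bT E] := hessian_jump v1 w1 xr d0 ddr Dx bp nD nb.
have q2q : q / 2 < q by lra.
have IT := H (x + d *: n) d (ps q xq ddq) pp d0 (lt_trans ddq q2q) bT.
have ID := HKc (x + d *: n) d d0.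
set Y := Dv v (Dv w V) x in E *; set nv := dot3 n v * dot3 n w in E *.
have nv1 : `|nv| <= 1.
  have h1 u : rho u <= 1 -> `|dot3 n u| <= 1.
    by move=> u1; rewrite -(@expr_le1 _ 2) // real_normK ?num_real // (le_trans (Cauchy3 n u)) // n1 mul1r.
  by rewrite /nv normrM mulr_ile1 // h1.
have B1 : `|C0| * `|Y - c * cos (k * - d) * nv| <= `|C0| * (e / 2).
  rewrite -normrM E (le_trans (ler_normB _ _)) //.
  have : (Kb + Kc) * d <= `|C0| * e / 4.
    move: ddC; rewrite ltr_pdivlMr // => h; lra.
  move: IT ID; lra.
rewrite (ler_pM2l c00) in B1.
have B2 : `|c * cos (k * - d) * nv - c * nv| <= e / 4.
  rewrite (_ : _ - _ = c * (cos (k * - d) - 1) * nv); last by ring.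
  rewrite normrM -[leRHS]mulr1 ler_pM // normrM; exact: Hdl.
have : `|Y - c * nv| <= `|Y - c * cos (k * - d) * nv| + `|c * cos (k * - d) * nv - c * nv|.
  by rewrite -{1}(subrK (c * cos (k * - d) * nv) Y) -addrA ler_normD.
lra.
Qed.

End BoundaryHessian.

(** * The field cross3 x (grad u) *)

Section Rotation.
Context {R : realType}.
Notation P := (R * R * R)%type.
Implicit Types (x y z s v w p q : P) (f : P -> R) (e : R).

Lemma cvg_within_of (D : set P) s (f : P -> R) (l : R) : f @ s --> l -> f @ within D (nbhs s) --> l.
Proof. by move=> H; apply: cvg_trans H; apply: cvg_app; exact: cvg_within. Qed.

Lemma cvg_within_near (D : set P) s (f : P -> R) (l : R) :
  (forall e, 0 < e -> \forall x \near s, D x -> `|f x - l| <= e) -> f @ within D (nbhs s) --> l.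
Proof.
move=> H; apply/cvgrPdist_le => e e0; rewrite near_withinE; apply: filterS (H e e0) => x h Dx.
by rewrite distrC; exact: h.
Qed.

Lemma cvg_within_eq (D : set P) s (f h : P -> R) (l : R) : (forall x, D x -> f x = h x) ->
  f @ within D (nbhs s) --> l -> h @ within D (nbhs s) --> l.
Proof.
move=> fh H; apply: cvg_trans H; apply: near_eq_cvg; rewrite near_withinE.
by apply: filterE => x Dx; rewrite fh.
Qed.

Lemma grad3_cvg (D : set P) s f (l : P) : (forall v, basis3 v -> Dv v f @ within D (nbhs s) --> dot3 l v) ->
  grad3 f @ within D (nbhs s) --> l.
Proof.
move=> H; rewrite grad3E.
have H1 := H (@e1 R) (Or31 _ _ erefl); have H2 := H (@e2 R) (Or32 _ _ erefl).
have H3 := H (@e3 R) (Or33 _ _ erefl).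
have E : [/\ dot3 l (@e1 R) = l.1.1, dot3 l (@e2 R) = l.1.2 & dot3 l (@e3 R) = l.2].
  by rewrite /dot3 /=; split; ring.
have [E1 E2 E3] := E; rewrite E1 in H1; rewrite E2 in H2; rewrite E3 in H3.
rewrite (_ : l = (l.1.1, l.1.2, l.2)); last by case: (l) => [[]].
exact: (cvg_pair (cvg_pair H1 H2) H3).
Qed.

Lemma Dv_sum J (a : 'I_J -> R) (f : 'I_J -> P -> R) x v : (forall j, dif (f j) x) ->
  dif (fun y => \sum_(j < J) a j * f j y) x /\
  Dv v (fun y => \sum_(j < J) a j * f j y) x = \sum_(j < J) a j * Dv v (f j) x.
Proof.
move=> df; elim: (index_enum _) => [|i t [IHd IHD]].
  rewrite (_ : (fun y => _) = fun=> 0); last by apply/funext => y; rewrite big_nil.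
  by rewrite big_nil Dv_cst; split=> //; exact: dif_cst.
rewrite (_ : (fun y => _) = fun y => a i * f i y + \sum_(j <- t) a j * f j y); last first.
  by apply/funext => y; rewrite big_cons.
have h : dif (fun y => a i * f i y) x by exact: difZ.
by rewrite big_cons (DvD v h IHd) DvZ // IHD; split=> //; exact: difD.
Qed.

Variables (D : set P) (N : P -> P) (k c : R) (u : P -> R).
Hypotheses (oD : open D) (hN : C1_boundary_outward_normal D N) (k0 : 0 < k).
Hypotheses (u2 : Ck 2 D u) (ug : grad_up_to_bdry D u) (uz : zero_on_bdry D u).
Hypothesis un : forall s, bdry D s -> normal_deriv D N u s = 0.
Hypothesis ue : forall x, D x -> lapD u x + k ^+ 2 * u x = c.

Let hp : helmholtz_pair D k c (ext D u).
Proof. exact: (ext_helmholtz_pair oD hN). Qed.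

Let u3 : Ck 3 D u.
Proof.
by apply: (Ck_ext oD _ (interior_Ck3 k0 hp)) => x; exact: ext_in.
Qed.

Lemma boundary_Hessian s v w : bdry D s -> rho v <= 1 -> rho w <= 1 ->
  Dv v (Dv w u) @ within D (nbhs s) --> c * (dot3 (N s) v * dot3 (N s) w).
Proof.
move=> bs v1 w1; have [n1 [phi [r [m1 [g ch]]]]] := boundary_chart hN bs.
have r0 : 0 < r by case: ch => -[].
have r80 : 0 < r / 8 by rewrite divr_gt0.
have [a [a0 ka Ma]] := small_radius k0 r80.
have [X0 [X1 [X2 [X3 HX]]]] := cutoff_exists a0.
pose m := `|s| + r + M0 a + 1.
have ms : `|s| + r + M0 a < m by rewrite /m; lra.
apply: cvg_within_near => e e0.
apply: filterS (boundary_Hessian_limit k0 hp n1 ch a0 ka HX Ma ms v1 w1 e0) => x H Dx.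
rewrite (_ : Dv v (Dv w u) x = Dv v (Dv w (ext D u)) x); first exact: H.
by apply: Dv_near; apply: (near_open oD Dx) => y Dy; rewrite Dv_ext_in.
Qed.

Lemma boundary_grad s v : bdry D s -> Dv v u @ within D (nbhs s) --> (0 : R).
Proof.
move=> bs; apply: cvg_within_near => e e0.
by apply: filterS (grad_vanish hN bs (CkS u2) uz ug (un bs) v e0) => x H /H; rewrite subr0.
Qed.

(* cross3 x (grad u) has the components rot e2 e3, rot e3 e1 and rot e1 e2. *)
Definition rot p q x := dot3 p x * Dv q u x - dot3 q x * Dv p u x.

Lemma rot_Ck p q : Ck 2 D (rot p q).
Proof.
by apply: CkB => //; apply: CkM => //; [exact: Ck_dot3 | exact: Ck_Dv | exact: Ck_dot3 | exact: Ck_Dv].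
Qed.

Let d1 v x : D x -> dif (Dv v u) x.
Proof. by move=> Dx; exact: (Ck_dif (Ck_Dv v u3) Dx). Qed.

Let d2 v w x : D x -> dif (Dv v (Dv w u)) x.
Proof. by move=> Dx; exact: (Ck_dif (Ck_Dv v (Ck_Dv w u3)) Dx). Qed.

Lemma rot_Dv p q v x : D x -> Dv v (rot p q) x =
  dot3 p x * Dv v (Dv q u) x + Dv q u x * dot3 p v - (dot3 q x * Dv v (Dv p u) x + Dv p u x * dot3 q v).
Proof.
move=> Dx; have [dp Dp] := dif_dot3 p x; have [dq Dq] := dif_dot3 q x.
have h1 := difM dp (d1 q Dx); have h2 := difM dq (d1 p Dx).
by rewrite (DvB v h1 h2) (DvM v dp (d1 q Dx)) (DvM v dq (d1 p Dx)) Dp Dq.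
Qed.

Lemma rot_Dv2 p q v x : D x -> Dv v (Dv v (rot p q)) x =
  dot3 p x * Dv v (Dv v (Dv q u)) x + 2 * dot3 p v * Dv v (Dv q u) x
  - (dot3 q x * Dv v (Dv v (Dv p u)) x + 2 * dot3 q v * Dv v (Dv p u) x).
Proof.
move=> Dx; have [dp Dp] := dif_dot3 p x; have [dq Dq] := dif_dot3 q x.
have N1 : \forall y \near x, Dv v (rot p q) y =
  dot3 p y * Dv v (Dv q u) y + dot3 p v * Dv q u y - (dot3 q y * Dv v (Dv p u) y + dot3 q v * Dv p u y).
  by apply: (near_open oD Dx) => y Dy; rewrite rot_Dv // (mulrC (Dv q u y)) (mulrC (Dv p u y)).
rewrite (Dv_near v N1).
have a1 := difM dp (d2 v q Dx); have a2 := difZ (dot3 p v) (d1 q Dx).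
have b1 := difM dq (d2 v p Dx); have b2 := difZ (dot3 q v) (d1 p Dx).
rewrite (DvB v (difD a1 a2) (difD b1 b2)) (DvD v a1 a2) (DvD v b1 b2).
rewrite (DvM v dp (d2 v q Dx)) (DvM v dq (d2 v p Dx)) (DvZ v _ (d1 q Dx)) (DvZ v _ (d1 p Dx)) Dp Dq.
by ring.
Qed.

(** The equation is differentiated in the direction q, which removes the constant c. This uses the
    C^3 regularity of u and symmetry of second derivatives. *)
Lemma lapD_Dv q x : D x -> lapD (Dv q u) x + k ^+ 2 * Dv q u x = 0.
Proof.
move=> Dx.
have E v : Dv v (Dv v (Dv q u)) x = Dv q (Dv v (Dv v u)) x.
  rewrite (Schwarz q v oD (Ck_Dv v u3) Dx); apply: Dv_near.
  by apply: (near_open oD Dx) => y Dy; rewrite (Schwarz v q oD u2 Dy).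
have Z : Dv q (fun y => lapD u y + k ^+ 2 * u y) x = 0.
  have N1 : \forall y \near x, lapD u y + k ^+ 2 * u y = c by apply: (near_open oD Dx) => y Dy; exact: ue.
  by rewrite (Dv_near q N1) Dv_cst.
have du : dif u x by exact: (Ck_dif u2).
have l12 := difD (d2 (@e1 R) (@e1 R) Dx) (d2 (@e2 R) (@e2 R) Dx).
have l3 := difD l12 (d2 (@e3 R) (@e3 R) Dx).
rewrite -{}Z (DvD q l3 (difZ _ du)) (DvD q l12 (d2 _ _ Dx)) (DvD q (d2 _ _ Dx) (d2 _ _ Dx)) (DvZ q _ du).
by rewrite /lapD !E.
Qed.

(** Infinitesimal rotations commute with the Laplacian: the cross terms add up to twice the
    difference of the mixed derivatives of u along p and q, which is 0. *)
Lemma rot_helmholtz p q x : D x -> lapD (rot p q) x + k ^+ 2 * rot p q x = 0.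
Proof.
move=> Dx.
have S := Schwarz p q oD u2 Dx.
have Cp : Dv p (Dv q u) x = p.1.1 * Dv (@e1 R) (Dv q u) x + p.1.2 * Dv (@e2 R) (Dv q u) x + p.2 * Dv (@e3 R) (Dv q u) x.
  by rewrite -Dv_coord //; exact: d1.
have Cq : Dv q (Dv p u) x = q.1.1 * Dv (@e1 R) (Dv p u) x + q.1.2 * Dv (@e2 R) (Dv p u) x + q.2 * Dv (@e3 R) (Dv p u) x.
  by rewrite -Dv_coord //; exact: d1.
have Lp := lapD_Dv p Dx; have Lq := lapD_Dv q Dx.
rewrite /lapD !rot_Dv2 //; rewrite /lapD in Lp Lq; rewrite /rot.
have E (y : P) : [/\ dot3 y (@e1 R) = y.1.1, dot3 y (@e2 R) = y.1.2 & dot3 y (@e3 R) = y.2].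
  by rewrite /dot3 /=; split; ring.
have [-> -> ->] := E p; have [-> -> ->] := E q.
move: Lp Lq Cp Cq; rewrite S.
move: (Dv (@e1 R) (Dv (@e1 R) (Dv q u)) x) (Dv (@e2 R) (Dv (@e2 R) (Dv q u)) x) (Dv (@e3 R) (Dv (@e3 R) (Dv q u)) x) => A1 A2 A3.
move: (Dv (@e1 R) (Dv (@e1 R) (Dv p u)) x) (Dv (@e2 R) (Dv (@e2 R) (Dv p u)) x) (Dv (@e3 R) (Dv (@e3 R) (Dv p u)) x) => B1 B2 B3.
move: (Dv (@e1 R) (Dv q u) x) (Dv (@e2 R) (Dv q u) x) (Dv (@e3 R) (Dv q u) x) => a1 a2 a3.
move: (Dv (@e1 R) (Dv p u) x) (Dv (@e2 R) (Dv p u) x) (Dv (@e3 R) (Dv p u) x) => b1 b2 b3.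
move: (Dv q (Dv p u) x) (Dv q u x) (Dv p u x) (dot3 p x) (dot3 q x) => S0 A B Px Qx.
move=> Lp Lq -> Cq.
have EA : A1 + A2 + A3 = - (k ^+ 2 * A) by apply/eqP; rewrite -addr_eq0 Lq.
have EB : B1 + B2 + B3 = - (k ^+ 2 * B) by apply/eqP; rewrite -addr_eq0 Lp.
transitivity (Px * (A1 + A2 + A3 + k ^+ 2 * A) - Qx * (B1 + B2 + B3 + k ^+ 2 * B) +
  2 * ((p.1.1 * a1 + p.1.2 * a2 + p.2 * a3) - (q.1.1 * b1 + q.1.2 * b2 + q.2 * b3))); first by ring.
by rewrite Lp Lq !mulr0 subr0 add0r -Cq subrr mulr0.
Qed.

(** In [rot_Dv] the terms with first derivatives of u tend to 0, and the Hessian tends to c N N^T,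
    so only a multiple of N s remains. *)
Lemma rot_boundary p q s : bdry D s -> rho p <= 1 -> rho q <= 1 ->
  grad3 (rot p q) @ within D (nbhs s) --> (c * (dot3 p s * dot3 q (N s) - dot3 q s * dot3 p (N s))) *: N s.
Proof.
move=> bs p1 q1; apply: grad3_cvg => v bv.
have v1 : rho v <= 1 by case: bv => ->; rewrite /rho /dot3 /= !(mulr0, mul0r, mulr1, addr0, add0r).
apply: (cvg_within_eq (fun x Dx => esym (rot_Dv p q v Dx))).
set n := N s.
have -> : dot3 ((c * (dot3 p s * dot3 q n - dot3 q s * dot3 p n)) *: n) v =
    dot3 p s * (c * (dot3 n v * dot3 n q)) + 0 * dot3 p v - (dot3 q s * (c * (dot3 n v * dot3 n p)) + 0 * dot3 q v).
  by rewrite dot3Zl (dot3C p n) (dot3C q n); ring.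
have PF := bdry_within_proper bs.
have Hl w : dot3 w @ within D (nbhs s) --> dot3 w s by apply: cvg_within_of; exact: dot3_cont.
apply: cvgB; apply: cvgD; apply: cvgM.
- exact: Hl.
- exact: boundary_Hessian.
- exact: boundary_grad.
- exact: cvg_cst.
- exact: Hl.
- exact: boundary_Hessian.
- exact: boundary_grad.
- exact: cvg_cst.
Qed.

Lemma rot_dirichlet p q : rho p <= 1 -> rho q <= 1 -> dirichlet_sol D k (rot p q).
Proof.
move=> p1 q1; split.
- by apply: Ck_C2_on => //; exact: rot_Ck.
- by move=> s bs; exists ((c * (dot3 p s * dot3 q (N s) - dot3 q s * dot3 p (N s))) *: N s); exact: rot_boundary.
- by move=> x Dx; rewrite lap3E rot_helmholtz.
move=> s bs; rewrite (_ : 0 = dot3 p s * 0 - dot3 q s * 0); last by rewrite !mulr0 subrr.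
have PF := bdry_within_proper bs.
have Hl w : dot3 w @ within D (nbhs s) --> dot3 w s by apply: cvg_within_of; exact: dot3_cont.
by apply: cvgB; apply: cvgM; [exact: Hl | exact: boundary_grad | exact: Hl | exact: boundary_grad].
Qed.

Lemma rot_normal_deriv p q s : bdry D s -> rho p <= 1 -> rho q <= 1 ->
  normal_deriv D N (rot p q) s = c * (dot3 p s * dot3 q (N s) - dot3 q s * dot3 p (N s)).
Proof.
move=> bs p1 q1; rewrite (normal_derivE N bs (rot_boundary bs p1 q1)) dot3Zl -/(rho (N s)).
by have [-> _] := boundary_chart hN bs; rewrite mulr1.
Qed.

(** As [normal_deriv] is defined by [lim], additivity goes through the existence of the boundary
    limits: the full gradients converge by [grad_up_to_bdry], and their limits are combined before
    pairing with N s. *)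
Lemma normal_deriv_sum J (uj : 'I_J -> P -> R) (a : 'I_J -> R) f s : bdry D s ->
  (forall j, dirichlet_sol D k (uj j)) -> (forall x, D x -> f x = \sum_(j < J) a j * uj j x) ->
  normal_deriv D N f s = \sum_(j < J) a j * normal_deriv D N (uj j) s.
Proof.
move=> bs Hu fE; have PF := bdry_within_proper bs.
have L j : exists l : P, grad3 (uj j) @ within D (nbhs s) --> l by have [_ Hg _ _] := Hu j; exact: (Hg s bs).
pose l j := projT1 (cid (L j)).
have Hl j : grad3 (uj j) @ within D (nbhs s) --> l j by rewrite /l; case: cid.
have C1 j : Ck 1 D (uj j) by have [H2 _ _ _] := Hu j; apply: CkS; exact: C2_on_Ck.
pose L0 := \sum_(j < J) a j *: l j.
have dotL v : dot3 L0 v = \sum_(j < J) a j * dot3 (l j) v.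
  rewrite /L0; elim: (index_enum _) => [|i t IH]; first by rewrite !big_nil /dot3 /= !mul0r !addr0.
  by rewrite !big_cons dot3Dl dot3Zl IH.
have gL : grad3 f @ within D (nbhs s) --> L0.
  apply: grad3_cvg => v _.
  have E x : D x -> \sum_(j < J) a j * Dv v (uj j) x = Dv v f x.
    move=> Dx; have [_ <-] := Dv_sum a v (fun j => Ck_dif (C1 j) Dx).
    by apply: Dv_near; apply: (near_open oD Dx) => y Dy; rewrite fE.
  apply: (cvg_within_eq E); rewrite dotL.
  have Hj j : (fun x => a j * Dv v (uj j) x) @ within D (nbhs s) --> a j * dot3 (l j) v.
    apply: cvgM; first exact: cvg_cst.
    by apply: cvg_within_near => e e0; exact: (grad_within v (C1 j) (Hl j) e0).
  elim: (index_enum _) => [|i t IH].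
    rewrite (_ : (fun x => _) = fun=> 0); last by apply/funext => x; rewrite big_nil.
    by rewrite big_nil; exact: cvg_cst.
  rewrite (_ : (fun x => _) = fun x => a i * Dv v (uj i) x + \sum_(j <- t) a j * Dv v (uj j) x); last first.
    by apply/funext => x; rewrite big_cons.
  by rewrite big_cons; apply: cvgD.
rewrite (normal_derivE N bs gL) dotL; apply: eq_bigr => j _.
by rewrite (normal_derivE N bs (Hl j)).
Qed.

End Rotation.

Theorem theorem6 (R : realType) (D : set (R * R * R)) (N : R * R * R -> R * R * R)
  (k c : R) (u : R * R * R -> R) (J : nat) (uj : 'I_J -> R * R * R -> R) :
  open D -> connected D -> D !=set0 -> bounded_set D ->
  C1_boundary_outward_normal D N ->
  0 < k ->
  (* u solves (Delta + k^2) u = c in D, u|_S = u_N|_S = 0, c <> 0 *)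
  c != 0 ->
  C2_on D u -> grad_up_to_bdry D u ->
  (forall x, D x -> lap3 u x + k ^+ 2 * u x = c) ->
  zero_on_bdry D u ->
  (forall s, bdry D s -> normal_deriv D N u s = 0) ->
  (* {u_j} : maximal linearly independent set of Dirichlet solutions, L^2-normalized *)
  (forall j, dirichlet_sol D k (uj j)) ->
  (forall a : 'I_J -> R,
      (forall x, D x -> \sum_(j < J) a j * uj j x = 0) -> forall j, a j = 0) ->
  (forall v, dirichlet_sol D k v ->
      exists a : 'I_J -> R, forall x, D x -> v x = \sum_(j < J) a j * uj j x) ->
  (forall j, (\int[@leb3 R]_(x in D) ((uj j x) ^+ 2)%:E = 1)%E) ->
  exists cs : 'I_J -> R * R * R,
    forall s, bdry D s ->
      cross3 s (N s) =
      (\sum_(j < J) (scale3 (normal_deriv D N (uj j) s) (cs j)).1.1,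
       \sum_(j < J) (scale3 (normal_deriv D N (uj j) s) (cs j)).1.2,
       \sum_(j < J) (scale3 (normal_deriv D N (uj j) s) (cs j)).2).
Proof.
move=> oD _ _ _ hN k0 c0 hu2 ug ue uz un Hu _ Hspan _.
have u2 := C2_on_Ck oD hu2.
have ue' x : D x -> lapD u x + k ^+ 2 * u x = c by move=> Dx; rewrite -lap3E; exact: ue.
have r1 : rho (@e1 R) <= 1 by rewrite /rho /dot3 /= !(mulr0, mulr1, addr0).
have r2 : rho (@e2 R) <= 1 by rewrite /rho /dot3 /= !(mulr0, mulr1, addr0, add0r).
have r3 : rho (@e3 R) <= 1 by rewrite /rho /dot3 /= !(mulr0, mulr1, addr0, add0r).
have dirichlet p q := @rot_dirichlet R D N k c u oD hN k0 u2 ug uz un ue' p q.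
have [a1 A1] := Hspan _ (dirichlet _ _ r2 r3).
have [a2 A2] := Hspan _ (dirichlet _ _ r3 r1).
have [a3 A3] := Hspan _ (dirichlet _ _ r1 r2).
(* The normal derivatives of the three fields are c times the components of [s, N], whence the
   factor 1/c. *)
exists (fun j => (c^-1 * a1 j, c^-1 * a2 j, c^-1 * a3 j)) => s bs.
have key p q a : rho p <= 1 -> rho q <= 1 -> (forall x, D x -> rot u p q x = \sum_(j < J) a j * uj j x) ->
    dot3 p s * dot3 q (N s) - dot3 q s * dot3 p (N s) =
    \sum_(j < J) normal_deriv D N (uj j) s * (c^-1 * a j).
  move=> p1 q1 A; apply: (mulfI c0).
  rewrite -(rot_normal_deriv oD hN k0 u2 ug uz un ue' bs p1 q1).
  rewrite (normal_deriv_sum N oD bs Hu A) mulr_sumr; apply: eq_bigr => j _.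
  by rewrite mulrCA mulVKf // mulrC.
rewrite /cross3; congr (_, _, _).
- by rewrite -(key _ _ _ r2 r3 A1) /dot3 /=; ring.
- by rewrite -(key _ _ _ r3 r1 A2) /dot3 /=; ring.
- by rewrite -(key _ _ _ r1 r2 A3) /dot3 /=; ring.
Qed.
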